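(* Let $(\bar u,\bar y,\bar\varphi)\in U_{\rm ad}\times[H^1(\Omega)\cap C^{0,\mu}(\bar\Omega)]^2$ satisfy the first order optimality conditions $$A\bar y+a(x,\bar y)+\bar u\bar y=0\ \text{ in }\Omega,\quad\partial_{n_A}\bar y=g\ \text{ on }\Gamma,$$ $$A^*\bar\varphi+\frac{\partial a}{\partial y}(x,\bar y)\bar\varphi+\bar u\bar\varphi=\frac{\partial L}{\partial y}(x,\bar y)\ \text{ in }\Omega,\quad\partial_{n_{A^*}}\bar\varphi=0\ \text{ on }\Gamma,$$ $$\bar u(x)=\operatorname{Proj}_{[\alpha,\beta]}\Big(\frac1\nu\bar y(x)\bar\varphi(x)\Big)\ \text{ for a.a. }x\in\Omega,$$ the strict complementarity condition $|\Sigma_{\bar u}|=0$, and the second order sufficient optimality condition $J''(\bar u)v^2>0$ for every $v\in C_{\bar u}\setminus\{0\}$. Then there exist $\delta>0$ and $C>0$ such that for every $u\in B_\delta(\bar u)\subset\mathcal{A}$ the linear operator $M_u:L^2(\Omega)\to L^2(\Omega)$ is an isomorphism and $\|M_u^{-1}\|\le C$ holds.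
   Context: $\Omega\subset\mathbb{R}^d$, $d\in\{2,3\}$, is a bounded open connected set with Lipschitz boundary $\Gamma$. Operator: $Ay=-\sum_{i,j=1}^d\partial_{x_j}[a_{ij}(x)\partial_{x_i}y]$ with $a_{ij}\in L^\infty(\Omega)$ and, for some $M_A,\Lambda_A>0$, $M_A|\xi|^2\ge\sum_{i,j}a_{ij}(x)\xi_i\xi_j\ge\Lambda_A|\xi|^2$ for a.a. $x\in\Omega$ and all $\xi\in\mathbb{R}^d$; $\partial_{n_A}y=\sum_{i,j}a_{ij}\partial_{x_i}y\,n_j$ with $n$ the outward unit normal. $A^*$ and $\partial_{n_{A^*}}$ are defined in the same way with $a_{ji}$ in place of $a_{ij}$. Equations are understood in the weak $H^1(\Omega)$ sense. Nonlinearity: $a:\Omega\times\mathbb{R}\to\mathbb{R}$ is a Carathéodory function, of class $C^2$ in the second variable, such that for a.a. $x\in\Omega$: $a(\cdot,0)\in L^p(\Omega)$ for some $p>d/2$; $\frac{\partial a}{\partial y}(x,y)\ge a_0$ for all $y\in\mathbb{R}$, for some constant $a_0\ge0$; for every $M>0$ there is $C_{a,M}$ with $\sum_{j=1}^2|\frac{\partial^ja}{\partial y^j}(x,y)|\le C_{a,M}$ for all $|y|\le M$; for every $\varepsilon>0$ and $M>0$ there is $\rho>0$ with $|\frac{\partial^2a}{\partial y^2}(x,y_1)-\frac{\partial^2a}{\partial y^2}(x,y_2)|\le\varepsilon$ for all $|y_1|,|y_2|\le M$ with $|y_1-y_2|\le\rho$. Boundary datum: $g\in L^q(\Gamma)$,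 $q>d-1$. Cost integrand: $L:\Omega\times\mathbb{R}\to\mathbb{R}$ is Carathéodory, of class $C^2$ in the second variable, and for a.a. $x$: $L(\cdot,0)\in L^1(\Omega)$; for all $M>0$ there is $L_M\in L^p(\Omega)$ with $|\frac{\partial L}{\partial y}(x,y)|\le L_M(x)$ for $|y|\le M$; for all $M>0$ there is $C_{L,M}\in\mathbb{R}$ with $|\frac{\partial^2L}{\partial y^2}(x,y)|\le C_{L,M}$ for $|y|\le M$; for all $\varepsilon,M>0$ there is $\rho>0$ with $|\frac{\partial^2L}{\partial y^2}(x,y_1)-\frac{\partial^2L}{\partial y^2}(x,y_2)|\le\varepsilon$ for $|y_1|,|y_2|\le M$, $|y_1-y_2|\le\rho$. Control constraints: $\nu>0$, $-a_0<\alpha<\beta\le\infty$, $U_{\rm ad}=\{u\in L^2(\Omega):\alpha\le u(x)\le\beta\text{ a.e. in }\Omega\}$; $\operatorname{Proj}_{[\alpha,\beta]}(t)=\min\{\beta,\max\{\alpha,t\}\}$ (for $\beta=\infty$, $\max\{\alpha,t\}$). Exponent $\mu$: $\mu\in(0,1]$ is a fixed Hölder exponent provided by known elliptic regularity theory, i.e. such that, for $B\in\{A,A^*\}$, every weak solution $y\in H^1(\Omega)$ of $By+y=f$ in $\Omega$, $\partial_{n_B}y=h$ on $\Gamma$, with $f\in L^{\min\{p,2\}}(\Omega)$, $h\in L^q(\Gamma)$, belongs to $C^{0,\mu}(\bar\Omega)$ with $\|y\|_{C^{0,\mu}(\bar\Omega)}\le C(\|f\|_{L^{\min\{p,2\}}(\Omega)}+\|h\|_{L^q(\Gamma)})$.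 The open set $\mathcal{A}$ and the maps $G,\Phi$: let $m_u=\operatorname{ess\,inf}_\Omega u$, $\Lambda_u=\min\{\Lambda_A,a_0+m_u\}$, $\mathcal{A}_0=\{u\in L^2(\Omega):a_0+m_u>0\}$, and $C_{4,\Omega}$ a constant with $\|y\|_{L^4(\Omega)}\le C_{4,\Omega}\|y\|_{H^1(\Omega)}$ for all $y\in H^1(\Omega)$. Then $\mathcal{A}=\bigcup_{\bar u\in\mathcal{A}_0}B_{\varepsilon_{\bar u}}(\bar u)$ ($B_\varepsilon(\bar u)$ denotes an open ball in $L^2(\Omega)$), with radii $0<\varepsilon_{\bar u}<\Lambda_{\bar u}/C_{4,\Omega}^2$ chosen (this is possible) so that for every $u\in\mathcal{A}$ the state equation $Ay+a(x,y)+uy=0$ in $\Omega$, $\partial_{n_A}y=g$ on $\Gamma$, has a unique solution $y_u\in H^1(\Omega)\cap C^{0,\mu}(\bar\Omega)$ and $G:\mathcal{A}\to H^1(\Omega)\cap C^{0,\mu}(\bar\Omega)$, $G(u)=y_u$, is of class $C^2$. One has $U_{\rm ad}\subset\mathcal{A}_0\subset\mathcal{A}$. For $v\in L^2(\Omega)$, $z=z_{u,v}=G'(u)v$ is the unique solution of $Az+\frac{\partial a}{\partial y}(x,y_u)z+uz+vy_u=0$ in $\Omega$, $\partial_{n_A}z=0$ on $\Gamma$. The adjoint state $\varphi_u\in H^1(\Omega)\cap C^{0,\mu}(\bar\Omega)$ is the unique solution of $A^*\varphi+\frac{\partial a}{\partial y}(x,y_u)\varphi+u\varphi=\frac{\partial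 L}{\partial y}(x,y_u)$ in $\Omega$, $\partial_{n_{A^*}}\varphi=0$ on $\Gamma$. The map $\Phi(u)=\varphi_u$ is of class $C^1$ from $\mathcal{A}$ to $H^1(\Omega)\cap C^{0,\mu}(\bar\Omega)$ and $\eta=\eta_{u,v}=\Phi'(u)v$ is the unique solution of $A^*\eta+\frac{\partial a}{\partial y}(x,y_u)\eta+u\eta=[\frac{\partial^2L}{\partial y^2}(x,y_u)-\varphi_u\frac{\partial^2a}{\partial y^2}(x,y_u)]z_{u,v}-v\varphi_u$ in $\Omega$, $\partial_{n_{A^*}}\eta=0$ on $\Gamma$. Functional: $J:\mathcal{A}\to\mathbb{R}$, $J(u)=\int_\Omega L(x,y_u)\,dx+\frac{\nu}{2}\int_\Omega u^2\,dx$, is of class $C^2$ with $J''(u)(v_1,v_2)=\int_\Omega[\frac{\partial^2L}{\partial y^2}(x,y_u)-\varphi_u\frac{\partial^2a}{\partial y^2}(x,y_u)]z_{u,v_1}z_{u,v_2}\,dx-\int_\Omega[v_1z_{u,v_2}+v_2z_{u,v_1}]\varphi_u\,dx+\nu\int_\Omega v_1v_2\,dx$; $J''(u)v^2:=J''(u)(v,v)$. Sets associated with $(\bar u,\bar y,\bar\varphi)$ (conditions understood a.e. in $\Omega$; $|\cdot|$ of a set is Lebesgue measure): $\Sigma_{\bar u}=\{x\in\Omega:\bar u(x)\in\{\alpha,\beta\}\text{ and }\nu\bar u(x)-\bar y(x)\bar\varphi(x)=0\}$; $C_{\bar u}$ is the set of $v\in L^2(\Omega)$ with $v(x)=0$ if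 $\nu\bar u(x)-\bar y(x)\bar\varphi(x)\ne0$, $v(x)\ge0$ if $\bar u(x)=\alpha$, and $v(x)\le0$ if $\bar u(x)=\beta$. Operators $M_u$: for $u\in\mathcal{A}$, $M_u:L^2(\Omega)\to L^2(\Omega)$ is $M_uv=v-h_u\,\frac1\nu[z_{u,v}\varphi_u+y_u\eta_{u,v}]$, where $h_u(x)=1$ if $\frac1\nu y_u(x)\varphi_u(x)\in(\alpha,\beta)$ and $h_u(x)=0$ otherwise. $\|M_u^{-1}\|$ is the operator norm in $\mathcal{L}(L^2(\Omega),L^2(\Omega))$. *)

(* Defs.v *)
From HB Require Import structures.
From mathcomp Require Import all_boot all_order all_algebra.
From mathcomp Require Import all_classical all_reals all_analysis.
From mathcomp Require Import ess_sup_inf.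

Set Implicit Arguments.
Unset Strict Implicit.
Unset Printing Implicit Defensive.

Import Order.TTheory GRing.Theory Num.Theory.
Import numFieldNormedType.Exports.

Local Open Scope classical_set_scope.
Local Open Scope ring_scope.

(* Outer measures obtained from a weight on all sets.  The library's [mu_ext]  *)
(* covers by measurable sets; [g_sigma_algebraType setT] is the copy of [T] in *)
(* which every set is measurable, so that every countable cover is allowed.    *)
Section cover_outer_measure.
Context {R : realType} {T : pointedType}.

Definition discreteT : measurableType _ := g_sigma_algebraType [set: set T].

Definition cover_weight (w : set T -> \bar R) (U : set T) : \bar R :=
  if `[< U = set0 >] then 0%E else w U.

Definition cover_outer (w : set T -> \bar R) : set T -> \bar R :=
  @mu_ext _ discreteT R (cover_weight w).

Variable w : set T -> \bar R.
Hypothesis w_ge0 : forall U, (0 <= w U)%E.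

Lemma cover_weight0 : cover_weight w set0 = 0%E.
Proof. by rewrite /cover_weight; case: asboolP. Qed.

Lemma cover_weight_ge0 U : (0 <= cover_weight w U)%E.
Proof. by rewrite /cover_weight; case: ifP. Qed.

Lemma cover_outer0 : cover_outer w set0 = 0%E.
Proof. exact: (@mu_ext0 _ discreteT R _ cover_weight0 cover_weight_ge0). Qed.

Lemma cover_outer_ge0 A : (0 <= cover_outer w A)%E.
Proof. exact: (@mu_ext_ge0 _ discreteT R _ cover_weight_ge0). Qed.

Lemma le_cover_outer : {homo cover_outer w : A B / A `<=` B >-> (A <= B)%E}.
Proof. exact: (@le_mu_ext _ discreteT R (cover_weight w)). Qed.

Lemma cover_outer_sigma_subadditive : sigma_subadditive (cover_outer w).
Proof.
exact: (@mu_ext_sigma_subadditive _ discreteT R _ cover_weight_ge0).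
Qed.

End cover_outer_measure.

Section euclidean.
Context {R : realType} {n : nat}.
Implicit Types x y : 'rV[R]_n.

Definition dotv x y : R := \sum_i x 0 i * y 0 i.

(* The norm of the library on ['rV_n] is the sup norm. *)
Definition enorm x : R := Num.sqrt (dotv x x).

Definition diam (U : set 'rV[R]_n) : R :=
  sup [set r | exists x y, [/\ U x, U y & r = enorm (x - y)]].

End euclidean.

Section lebesgue.
Context {R : realType} (n : nat).

Definition box (a b : 'rV[R]_n) : set 'rV[R]_n :=
  [set x | forall i, a 0 i <= x 0 i <= b 0 i].

Definition box_weight (U : set 'rV[R]_n) : \bar R :=
  ereal_inf [set r | exists a b,
    U = box a b /\ r = (\prod_i `|b 0 i - a 0 i|)%:E].

Definition lebesgue_outer : set 'rV[R]_n -> \bar R := cover_outer box_weight.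

Lemma box_weight_ge0 U : (0 <= box_weight U)%E.
Proof.
by apply: le_ereal_inf_tmp => _ [a [b [_ ->]]]; rewrite lee_fin prodr_ge0.
Qed.

HB.instance Definition _ := isOuterMeasure.Build R 'rV[R]_n lebesgue_outer
  (cover_outer0 box_weight_ge0) (cover_outer_ge0 box_weight_ge0)
  (@le_cover_outer _ _ box_weight)
  (cover_outer_sigma_subadditive box_weight_ge0).

End lebesgue.

Section hausdorff.
Context {R : realType} (n s : nat).

(* The normalisation makes [hausdorff_outer] agree with the surface measure.  *)
Definition hausdorff_weight (delta : R) (U : set 'rV[R]_n) : \bar R :=
  if `[< forall x y, U x -> U y -> enorm (x - y) <= delta >]
  then (lebesgue_outer [set x : 'rV[R]_s | (enorm x <= 1)%R]
        * ((diam U / 2) ^+ s)%:E)%E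
  else +oo%E.

Definition hausdorff_outer (A : set 'rV[R]_n) : \bar R :=
  ereal_sup [set cover_outer (hausdorff_weight delta) A
            | delta in [set delta : R | 0 < delta]].

Lemma diam_ge0 (U : set 'rV[R]_n) : 0 <= diam U.
Proof.
rewrite /diam; set S := (X in sup X).
have S0 r : S r -> 0 <= r by move=> [x [y [_ _ ->]]]; exact: sqrtr_ge0.
have [supS|/sup_out->//] := pselect (has_sup S).
have [r Sr] := supS.1.
by apply: le_trans (S0 _ Sr) _; apply: ub_le_sup => //; exact: supS.2.
Qed.

Lemma hausdorff_weight_ge0 delta U : (0 <= hausdorff_weight delta U)%E.
Proof.
rewrite /hausdorff_weight; case: ifP => // _.
apply: mule_ge0; first exact: outer_measure_ge0.
by rewrite lee_fin exprn_ge0// divr_ge0// diam_ge0.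
Qed.

Lemma hausdorff_outer0 : hausdorff_outer set0 = 0%E.
Proof.
apply/eqP; rewrite eq_le; apply/andP; split.
  apply: ge_ereal_sup => _ [delta _ <-].
  by rewrite cover_outer0//; exact: hausdorff_weight_ge0.
apply: ereal_sup_ubound; exists 1 => //=.
by rewrite cover_outer0//; exact: hausdorff_weight_ge0.
Qed.

Lemma hausdorff_outer_ge0 A : (0 <= hausdorff_outer A)%E.
Proof.
apply: (@le_trans _ _ (cover_outer (hausdorff_weight 1) A)).
  exact: cover_outer_ge0 (hausdorff_weight_ge0 1) _.
by apply: ereal_sup_ubound; exists 1 => //=.
Qed.

Lemma le_hausdorff_outer :
  {homo hausdorff_outer : A B / A `<=` B >-> (A <= B)%E}.
Proof.
move=> A B AB; apply: ge_ereal_sup => _ [delta d0 <-].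
apply: le_trans (@le_cover_outer _ _ (hausdorff_weight delta) _ _ AB) _.
by apply: ereal_sup_ubound; exists delta.
Qed.

Lemma hausdorff_outer_sigma_subadditive : sigma_subadditive hausdorff_outer.
Proof.
move=> F; apply: ge_ereal_sup => _ [delta d0 <-].
apply: le_trans
  (cover_outer_sigma_subadditive (hausdorff_weight_ge0 delta) F) _.
apply: lee_nneseries => [k _ _|k _].
  exact: cover_outer_ge0 (hausdorff_weight_ge0 delta) _.
by apply: ereal_sup_ubound; exists delta.
Qed.

HB.instance Definition _ := isOuterMeasure.Build R 'rV[R]_n hausdorff_outer
  hausdorff_outer0 hausdorff_outer_ge0 le_hausdorff_outer
  hausdorff_outer_sigma_subadditive.

End hausdorff.

Section measures.
Context {R : realType} (n : nat).

Definition lebT : measurableType _ :=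
  caratheodory_type (@lebesgue_outer R n : {outer_measure set 'rV[R]_n -> \bar R}).

Definition leb : {measure set lebT -> \bar R} :=
  @lebesgue_outer R n : {outer_measure set 'rV[R]_n -> \bar R}.

Definition surfT : measurableType _ :=
  caratheodory_type
    (@hausdorff_outer R n n.-1 : {outer_measure set 'rV[R]_n -> \bar R}).

Definition surf : {measure set surfT -> \bar R} :=
  @hausdorff_outer R n n.-1 : {outer_measure set 'rV[R]_n -> \bar R}.

End measures.

(* Elements of L^p(Omega), H^1(Omega), ... are represented by functions on the *)
(* whole space, of which only the values on [Omega] (a.e.) matter.             *)
Section function_spaces.
Context {R : realType} {n : nat} (Omega : set 'rV[R]_n).
Implicit Types (u v w y f phi : 'rV[R]_n -> R) (p : \bar R) (mu : R).

Definition ae_in (P : 'rV[R]_n -> Prop) : Prop :=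
  {ae leb n, forall x, Omega x -> P x}.

Definition integral_in f : R := Rintegral (leb n) Omega f.

Definition in_Lp p f : Prop := (f \_ Omega : lebT n -> R) \in Lfun (leb n) p.

Definition eLp_norm p f : \bar R :=
  ('N[leb n]_p[EFin \o (f \_ Omega : lebT n -> R)])%E.

Definition Lp_norm p f : R := fine (eLp_norm p f).

Definition bd : set 'rV[R]_n := closure Omega `\` Omega°.

Definition integral_bd f : R := Rintegral (surf n) bd f.

Definition in_Lp_bd p f : Prop := (f \_ bd : surfT n -> R) \in Lfun (surf n) p.

Definition Lp_norm_bd p f : R :=
  fine ('N[surf n]_p[EFin \o (f \_ bd : surfT n -> R)])%E.

Definition partial (i : 'I_n) f : 'rV[R]_n -> R :=
  fun x => derive (f : 'rV[R]_n -> R^o) x (delta_mx 0 i).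

(* C^oo: all iterated partial derivatives exist and are continuous. *)
Definition smooth f : Prop := forall s : seq 'I_n,
  let g := foldr partial f s in
  continuous g /\
  forall i x, derivable (g : 'rV[R]_n -> R^o) x (delta_mx 0 i).

Definition test_function phi : Prop :=
  smooth phi /\
  exists K, [/\ compact K, K `<=` Omega & forall x, ~ K x -> phi x = 0].

Definition weak_partial (i : 'I_n) y w : Prop :=
  in_Lp 2%:E w /\
  forall phi, test_function phi ->
    integral_in (fun x => y x * partial i phi x) =
    - integral_in (fun x => w x * phi x).

Definition in_H1 y : Prop :=
  in_Lp 2%:E y /\ forall i, exists w, weak_partial i y w.

Definition wgrad (i : 'I_n) y : 'rV[R]_n -> R :=
  xget (fun=> 0) [set w | weak_partial i y w].

Definition H1_norm y : R :=
  Num.sqrt (Lp_norm 2%:E y ^+ 2 + \sum_i Lp_norm 2%:E (wgrad i y) ^+ 2).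

(* The trace on the boundary is the L^2(bd) limit of the boundary values of    *)
(* smooth functions that converge in H^1(Omega).                               *)
Definition is_trace y t : Prop :=
  in_Lp_bd 2%:E t /\
  exists f_ : nat -> 'rV[R]_n -> R,
    [/\ forall k, smooth (f_ k),
        H1_norm (f_ k \- y) @[k --> \oo] --> (0 : R) &
        Lp_norm_bd 2%:E (f_ k \- t) @[k --> \oo] --> (0 : R)].

Definition trace y : 'rV[R]_n -> R :=
  xget (fun=> 0) [set t | is_trace y t].

Definition in_hoelder mu y : Prop :=
  exists C : R, forall x x', closure Omega x -> closure Omega x' ->
    `|y x| <= C /\ `|y x - y x'| <= C * enorm (x - x') `^ mu.

Definition hoelder_norm mu y : R :=
  sup [set `|y x| | x in closure Omega] +
  sup [set r | exists x x', [/\ closure Omega x, closure Omega x', x != x' &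
                                r = `|y x - y x'| / enorm (x - x') `^ mu]].

(* Near each boundary point, in suitable orthonormal coordinates, [Omega] is   *)
(* the set of the points above the graph of a Lipschitz function; [e] is the   *)
(* vertical direction.                                                         *)
Definition lipschitz_boundary : Prop :=
  forall x0, bd x0 ->
  exists (r K : R) (e : 'rV[R]_n) (gamma : 'rV[R]_n -> R),
    [/\ 0 < r, enorm e = 1,
        forall x x', `|gamma x - gamma x'| <= K * enorm (x - x') &
        forall x, enorm (x - x0) < r ->
          (Omega x <-> gamma (x - dotv x e *: e) < dotv x e)].

Definition lipschitz_domain : Prop :=
  [/\ Omega !=set0, open Omega, connected Omega,
      bounded_set Omega & lipschitz_boundary].

End function_spaces.

(* A seminormed space given by a subset of a vector space and a seminorm on    *)
(* it: two elements at distance 0 represent the same vector.                   *)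
Record fspace (R : realType) (X : lmodType R) :=
  FSpace { fs_mem : set X ; fs_norm : X -> R }.

Section frechet.
Context {R : realType} {X Y : lmodType R}.
Variables (S : fspace X) (S' : fspace Y).

Definition fball (e : R) (u : X) : set X :=
  [set v | fs_mem S v /\ fs_norm S (v - u) < e].

Definition bounded_linear (T : X -> Y) : Prop :=
  [/\ forall v, fs_mem S v -> fs_mem S' (T v),
      forall (c : R) v w, fs_mem S v -> fs_mem S w ->
        fs_norm S' (T (c *: v + w) - (c *: T v + T w)) = 0 &
      exists C : R, forall v, fs_mem S v ->
        fs_norm S' (T v) <= C * fs_norm S v].

Definition opnorm (T : X -> Y) : R :=
  sup [set fs_norm S' (T v) | v in [set v | fs_mem S v /\ fs_norm S v <= 1]].

Definition bounded_bilinear (B : X -> X -> Y) : Prop :=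
  [/\ forall v, fs_mem S v -> bounded_linear (B v),
      forall v, fs_mem S v -> bounded_linear (B ^~ v) &
      exists C : R, forall v w, fs_mem S v -> fs_mem S w ->
        fs_norm S' (B v w) <= C * fs_norm S v * fs_norm S w].

(* [F] is of class C^1 on the open set [A], with Frechet derivative [DF]. *)
Definition class_C1 (A : set X) (F : X -> Y) (DF : X -> X -> Y) : Prop :=
  [/\ forall u, A u -> fs_mem S' (F u) /\ bounded_linear (DF u),
      forall u, A u -> forall e : R, 0 < e -> exists2 r : R, 0 < r &
        forall h, fs_mem S h -> fs_norm S h < r ->
          fs_norm S' (F (u + h) - F u - DF u h) <= e * fs_norm S h &
      forall u, A u -> forall e : R, 0 < e -> exists2 r : R, 0 < r &
        forall u', A u' -> fs_norm S (u' - u) < r ->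
          forall v, fs_mem S v ->
            fs_norm S' (DF u' v - DF u v) <= e * fs_norm S v].

(* [D2F u h v] is the derivative at [u] of [u |-> DF u v] in the direction [h]. *)
Definition class_C2 (A : set X) (F : X -> Y) (DF : X -> X -> Y)
    (D2F : X -> X -> X -> Y) : Prop :=
  [/\ class_C1 A F DF,
      forall u, A u -> bounded_bilinear (D2F u),
      forall u, A u -> forall e : R, 0 < e -> exists2 r : R, 0 < r &
        forall h, fs_mem S h -> fs_norm S h < r ->
          forall v, fs_mem S v ->
            fs_norm S' (DF (u + h) v - DF u v - D2F u h v)
              <= e * fs_norm S h * fs_norm S v &
      forall u, A u -> forall e : R, 0 < e -> exists2 r : R, 0 < r &
        forall u', A u' -> fs_norm S (u' - u) < r ->
          forall v w, fs_mem S v -> fs_mem S w ->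
            fs_norm S' (D2F u' v w - D2F u v w)
              <= e * fs_norm S v * fs_norm S w].

End frechet.

Definition is_inverse (R : realType) (X : lmodType R) (S : fspace X)
    (M N : X -> X) : Prop :=
  [/\ bounded_linear S S M, bounded_linear S S N,
      forall v, fs_mem S v -> fs_norm S (N (M v) - v) = 0 &
      forall v, fs_mem S v -> fs_norm S (M (N v) - v) = 0].

Definition real_space (R : realType) : fspace (R^o : lmodType R) :=
  FSpace setT (fun r : R^o => `|r|).

Section control_problem.
Context {R : realType} {n : nat} (Omega : set 'rV[R]_n).
Let E := 'rV[R]_n.
Implicit Types (u v w y z f phi eta : E -> R).

Definition L2 : fspace ((E -> R^o) : lmodType R) :=
  FSpace [set v | in_Lp Omega 2%:E v] (Lp_norm Omega 2%:E).

(* H^1(Omega) `&` C^{0,mu}(closure Omega) *)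
Definition H1C (mu : R) : fspace ((E -> R^o) : lmodType R) :=
  FSpace [set y | in_H1 Omega y /\ in_hoelder Omega mu y]
         (fun y => H1_norm Omega y + hoelder_norm Omega mu y).

Definition elliptic (aij : 'I_n -> 'I_n -> E -> R) (M_A Lam_A : R) : Prop :=
  [/\ 0 < M_A, 0 < Lam_A, forall i j, in_Lp Omega +oo%E (aij i j) &
      ae_in Omega (fun x => forall xi : E,
        Lam_A * enorm xi ^+ 2 <= \sum_i \sum_j aij i j x * xi 0 i * xi 0 j
        /\ \sum_i \sum_j aij i j x * xi 0 i * xi 0 j <= M_A * enorm xi ^+ 2)].

Definition adj (aij : 'I_n -> 'I_n -> E -> R) : 'I_n -> 'I_n -> E -> R :=
  fun i j => aij j i.

(* Weak H^1(Omega) solutions of                                                *)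
(*   - sum_(i,j) d_j (aij d_i y) + f = 0 in Omega, d_n y = h on the boundary,  *)
(* d_n being the conormal derivative.                                          *)
Definition weak_solution (aij : 'I_n -> 'I_n -> E -> R) f (h : E -> R) y :
    Prop :=
  in_H1 Omega y /\
  forall w, in_H1 Omega w ->
    integral_in Omega (fun x =>
      \sum_i \sum_j aij i j x * wgrad Omega i y x * wgrad Omega j w x)
    + integral_in Omega (fun x => f x * w x)
    = integral_bd Omega (fun x => h x * trace Omega w x).

Definition dy (a : E -> R -> R) (x : E) (t : R) : R :=
  derive1 (a x : R^o -> R^o) t.

Definition d2y (a : E -> R -> R) (x : E) (t : R) : R :=
  derive1n 2 (a x : R^o -> R^o) t.

Definition caratheodory_C2 (a : E -> R -> R) : Prop :=
  [/\ forall t, measurable_fun (Omega : set (lebT n)) (a ^~ t : lebT n -> R),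
      ae_in Omega (fun x => forall t, derivable (a x : R^o -> R^o) t 1),
      ae_in Omega (fun x => forall t, derivable (dy a x : R^o -> R^o) t 1) &
      ae_in Omega (fun x => continuous (d2y a x))].

Definition unif_cont_d2y (a : E -> R -> R) : Prop :=
  forall e M : R, 0 < e -> 0 < M -> exists2 rho : R, 0 < rho &
    ae_in Omega (fun x => forall t1 t2, `|t1| <= M -> `|t2| <= M ->
      `|t1 - t2| <= rho -> `|d2y a x t1 - d2y a x t2| <= e).

Definition nonlinearity (p : \bar R) (a0 : R) (a : E -> R -> R) : Prop :=
  [/\ caratheodory_C2 a, in_Lp Omega p (a ^~ 0),
      ae_in Omega (fun x => forall t, a0 <= dy a x t),
      forall M : R, 0 < M -> exists C : R, ae_in Omega (fun x =>
        forall t, `|t| <= M -> `|dy a x t| + `|d2y a x t| <= C) &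
      unif_cont_d2y a].

Definition cost_integrand (p : \bar R) (L : E -> R -> R) : Prop :=
  [/\ caratheodory_C2 L, in_Lp Omega 1%:E (L ^~ 0),
      forall M : R, 0 < M -> exists2 LM : E -> R, in_Lp Omega p LM &
        ae_in Omega (fun x => forall t, `|t| <= M -> `|dy L x t| <= LM x),
      forall M : R, 0 < M -> exists C : R, ae_in Omega (fun x =>
        forall t, `|t| <= M -> `|d2y L x t| <= C) &
      unif_cont_d2y L].

Definition hoelder_exponent (aij : 'I_n -> 'I_n -> E -> R) (p q : \bar R)
    (mu : R) : Prop :=
  0 < mu <= 1 /\
  forall B, B = aij \/ B = adj aij -> exists C : R,
    forall f h y, in_Lp Omega (mine p 2%:E) f -> in_Lp_bd Omega q h ->
      weak_solution B (fun x => y x - f x) h y ->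
      exists y', [/\ ae_in Omega (fun x => y' x = y x),
        in_hoelder Omega mu y' &
        hoelder_norm Omega mu y' <=
          C * (Lp_norm Omega (mine p 2%:E) f + Lp_norm_bd Omega q h)].

(* essinf over Omega: the extension by +oo is neutral *)
Definition minf u : \bar R :=
  ess_inf (leb n) (patch (fun=> +oo%E) Omega (EFin \o u) : lebT n -> \bar R).

Definition A0 (a0 : R) : set (E -> R) :=
  [set u | fs_mem L2 u /\ (0 < a0%:E + minf u)%E].

Definition Lam (Lam_A a0 : R) u : \bar R := mine Lam_A%:E (a0%:E + minf u)%E.

Definition embedding_constant (C4 : R) : Prop :=
  0 < C4 /\ forall y, in_H1 Omega y ->
    (eLp_norm Omega 4%:E y <= (C4 * H1_norm Omega y)%:E)%E.

Definition radii (Lam_A a0 C4 : R) (eps : (E -> R) -> R) : Prop :=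
  forall u, A0 a0 u ->
    0 < eps u /\ ((eps u)%:E < Lam Lam_A a0 u * (C4 ^- 2)%:E)%E.

Definition Aset (a0 : R) (eps : (E -> R) -> R) : set (E -> R) :=
  \bigcup_(u in A0 a0) fball L2 (eps u) u.

Definition state (aij : 'I_n -> 'I_n -> E -> R) (a : E -> R -> R) g (mu : R)
    u y : Prop :=
  fs_mem (H1C mu) y /\
  weak_solution aij (fun x => a x (y x) + u x * y x) g y.

Definition adjoint_state (aij : 'I_n -> 'I_n -> E -> R) (a L : E -> R -> R)
    (mu : R) u y phi : Prop :=
  fs_mem (H1C mu) phi /\
  weak_solution (adj aij)
    (fun x => dy a x (y x) * phi x + u x * phi x - dy L x (y x))
    (fun=> 0) phi.

Definition is_unique_solution (P : (E -> R) -> Prop) y : Prop :=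
  P y /\ forall y', P y' -> forall x, Omega x -> y' x = y x.

Definition J (L : E -> R -> R) (nu : R) (G : (E -> R) -> E -> R) u : R :=
  integral_in Omega (fun x => L x (G u x))
  + nu / 2 * integral_in Omega (fun x => u x ^+ 2).

Definition Uad (alpha : R) (beta : \bar R) : set (E -> R) :=
  [set u | in_Lp Omega 2%:E u /\
           ae_in Omega (fun x => alpha%:E <= (u x)%:E <= beta)%E].

Definition clamp (alpha : R) (beta : \bar R) (t : R) : R :=
  if beta is b%:E then Num.min b (Num.max alpha t) else Num.max alpha t.

Definition Sigma (nu alpha : R) (beta : \bar R) u y phi : set E :=
  [set x | [/\ Omega x, u x = alpha \/ (u x)%:E = beta &
               nu * u x - y x * phi x = 0]].

Definition critical_cone (nu alpha : R) (beta : \bar R) u y phi :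
    set (E -> R) :=
  [set v | in_Lp Omega 2%:E v /\
    ae_in Omega (fun x =>
      [/\ nu * u x - y x * phi x <> 0 -> v x = 0,
          u x = alpha -> 0 <= v x &
          (u x)%:E = beta -> v x <= 0])].

Definition hcut (nu alpha : R) (beta : \bar R) y phi : E -> R := fun x =>
  if (alpha%:E < (nu^-1 * (y x * phi x))%:E < beta)%E then 1 else 0.

(* [DG u v] and [DPhi u v] stand for z_{u,v} = G'(u)v and eta_{u,v} = Phi'(u)v. *)
Definition Mop (nu alpha : R) (beta : \bar R)
    (G Phi : (E -> R) -> E -> R) (DG DPhi : (E -> R) -> (E -> R) -> E -> R)
    u v : E -> R := fun x =>
  v x - hcut nu alpha beta (G u) (Phi u) x *
    (nu^-1 * (DG u v x * Phi u x + G u x * DPhi u v x)).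

End control_problem.

(* Main.v *)
(* Write M_u = 1 - K_u, where K_u v = h_u (z_{u,v} phi_u + y_u eta_{u,v}) / nu.
   Since z_{u,v} and eta_{u,v} are bounded in C^{0,mu} by |v|_{L^2}, Arzela-Ascoli
   makes K_u compact on L^2.  Testing the state equations for u and u + t v with
   phi_u and the adjoint equation with both states gives
   J'(u) v = int (nu u - y_u phi_u) v, and differentiating once more
   J''(ubar)(v, v) = nu |v|^2 - int (z phi + y eta) v.
   If v = t K_ubar v with 0 <= t <= 1, then v lives where h_ubar = 1, so it is in
   the critical cone and nu |v|^2 = t int (z phi + y eta) v, which the second order
   condition excludes unless v = 0.  By compactness 1 - t K_ubar is bounded below
   uniformly in t, and the continuity method from t = 0 to t = 1 makes M_ubar an
   isomorphism.  Strict complementarity says that y phi / nu takes the values alpha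
   and beta on a null set only, so h_u -> h_ubar in L^2 as u -> ubar.  The other
   factor of K_u maps L^2 into bounded functions continuously in u, whence
   M_u -> M_ubar in operator norm, and a perturbation argument concludes. *)

Require Import Defs.
From HB Require Import structures.
From mathcomp Require Import all_boot all_order all_algebra.
From mathcomp Require Import all_classical all_reals all_analysis.
From mathcomp Require Import measurable_realfun ess_sup_inf ring lra.

Set Implicit Arguments.
Unset Strict Implicit.
Unset Printing Implicit Defensive.

Import Order.TTheory GRing.Theory Num.Theory.
Import numFieldNormedType.Exports.

Local Open Scope classical_set_scope.
Local Open Scope ring_scope.

(** * Isomorphisms of complete seminormed spaces *)

(** Vectors are functions, and the seminorm does not separate functions that agree a.e. Linearity,
    inverses and equations are therefore handled up to vectors of seminorm 0, and a lower bound
    together with surjectivity ([iso_bound]) is the working form of an isomorphism. Compactness is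
    phrased along ultrafilters: a single one makes the scalars t_k and the images K v_k, or the
    functions z and eta, converge simultaneously, without extracting subsequences. The homotopy in t
    takes the place of the Fredholm alternative: injectivity along the whole path is what the second
    order condition delivers. The derivatives of J are given abstractly, as Frechet derivatives.
    Their formulas are recovered by comparing them with explicit expansions along lines u + t v, in
    which products such as y phi are estimated in the sup norm. The cut-off jumps, so h_u cannot be
    expected to converge uniformly. This forces the asymmetric estimate in which one factor is
    measured in L^2 and the other in the sup norm. *)

Lemma le0_of_le_geometric (R : realType) (x c : R) :
  (forall k, x <= c / 2 ^+ k) -> x <= 0.
Proof.
move=> h; have h0 : geometric c (2^-1 : R) @ \oo --> (0 : R).
  by apply: cvg_geometric; rewrite ger0_norm ?invf_lt1 ?ltr1n// invr_ge0.
apply: (ler_cvg_to (cvg_cst x) h0); apply: nearW => k.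
by rewrite /geometric /= exprVn; exact: h.
Qed.

Lemma le0_of_le_eps (R : realType) (x c : R) :
  (forall e, 0 < e -> x <= e * c) -> x <= 0.
Proof.
move=> h; rewrite leNgt; apply/negP => x0.
have c0 : 0 < c by have := lt_le_trans x0 (h _ ltr01); rewrite mul1r.
have := h (x / 2 / c) (divr_gt0 (divr_gt0 x0 (ltr0Sn R 1)) c0).
rewrite divfK ?gt_eqF//; lra.
Qed.

(** Compactness gives a cluster point of the image filter. An ultrafilter contains the preimage of a
    neighbourhood or its complement, and clustering rules out the complement. *)
Lemma ultra_compact_cvg (T : topologicalType) (A : set T) (F : set_system nat)
    (u : nat -> T) : compact A -> UltraFilter F -> (forall k, A (u k)) ->
  exists2 l, A l & forall U, nbhs l U -> F (u @^-1` U).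
Proof.
move=> cA UF uA.
have [|l [Al cl]] := cA (u @ F) _; first exact: nearW.
exists l => // U lU.
have [//|nF] := in_ultra_setVsetC (u @^-1` U) UF.
by have [x []] := cl (~` U) U nF lU.
Qed.

Lemma ultra_lim (R : realType) (F : set_system nat) (u : nat -> R) (a b : R) :
  UltraFilter F -> (forall k, a <= u k <= b) ->
  exists2 l, a <= l <= b & forall e, 0 < e -> F [set k | `|u k - l| < e].
Proof.
move=> UF uB.
have [|l lB lF] := @ultra_compact_cvg _ _ F u (@segment_compact R a b) UF.
  by move=> k; rewrite /= in_itv /=.
exists l; first by move: lB; rewrite /= in_itv.
move=> e e0; have := lF _ (nbhsx_ballx l e e0).
by apply: filterS => k; rewrite /= /ball /= distrC.
Qed.

Section seminormed_spaces.
Context {R : realType} {X : lmodType R}.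
Variable S : fspace X.

Definition seminormed : Prop :=
  [/\ fs_mem S 0,
      forall c v w, fs_mem S v -> fs_mem S w -> fs_mem S (c *: v + w),
      forall c v, fs_mem S v -> fs_norm S (c *: v) = `|c| * fs_norm S v &
      forall v w, fs_mem S v -> fs_mem S w ->
        fs_norm S (v + w) <= fs_norm S v + fs_norm S w].

(** Geometrically decreasing increments are all that the residual iteration in [iso_perturb]
    produces. The factor 2 sums the geometric tail, so the rate of convergence is part of the
    definition. *)
Definition fs_complete : Prop :=
  forall (v : nat -> X) (c : R), (forall k, fs_mem S (v k)) ->
    (forall k, fs_norm S (v k.+1 - v k) <= c / 2 ^+ k) ->
    exists2 w, fs_mem S w & forall k, fs_norm S (w - v k) <= c / 2 ^+ k * 2.

(* Isomorphism with inverse bounded by [C], up to vectors of norm 0. *)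
Definition iso_bound (C : R) (M : X -> X) : Prop :=
  [/\ bounded_linear S S M,
      forall v, fs_mem S v -> fs_norm S v <= C * fs_norm S (M v) &
      forall w, fs_mem S w -> exists2 v, fs_mem S v & fs_norm S (M v - w) = 0].

(** Ultrafilter form of sequential compactness of the image of the unit ball; the limit [x] need not
    be of the form [K v]. *)
Definition compact_op (K : X -> X) : Prop :=
  forall F : set_system nat, UltraFilter F ->
  forall v : nat -> X, (forall k, fs_mem S (v k) /\ fs_norm S (v k) <= 1) ->
  exists2 x, fs_mem S x &
    forall e : R, 0 < e -> F [set k | fs_norm S (K (v k) - x) < e].

Hypothesis HS : seminormed.
Implicit Types (v w : X) (c : R) (M K : X -> X).
Local Notation mem := (fs_mem S).
Local Notation nrm := (fs_norm S).

Lemma fs_mem0 : mem 0. Proof. by case: HS. Qed.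

Lemma fs_memP c v w : mem v -> mem w -> mem (c *: v + w).
Proof. by case: HS => _ + _ _; apply. Qed.

Lemma fs_memZ c v : mem v -> mem (c *: v).
Proof. by move=> mv; rewrite -[_ *: _]addr0; exact: fs_memP fs_mem0. Qed.

Lemma fs_memD v w : mem v -> mem w -> mem (v + w).
Proof. by move=> mv mw; rewrite -[v]scale1r; exact: fs_memP. Qed.

Lemma fs_memN v : mem v -> mem (- v).
Proof. by move=> mv; rewrite -scaleN1r; exact: fs_memZ. Qed.

Lemma fs_memB v w : mem v -> mem w -> mem (v - w).
Proof. by move=> mv mw; exact: fs_memD (fs_memN mw). Qed.

Lemma fs_normZ c v : mem v -> nrm (c *: v) = `|c| * nrm v.
Proof. by case: HS => _ _ + _; apply. Qed.

Lemma fs_normD v w : mem v -> mem w -> nrm (v + w) <= nrm v + nrm w.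
Proof. by case: HS => _ _ _; apply. Qed.

Lemma fs_normN v : mem v -> nrm (- v) = nrm v.
Proof. by move=> mv; rewrite -scaleN1r fs_normZ// normrN1 mul1r. Qed.

Lemma fs_norm0 : nrm 0 = 0.
Proof. by rewrite -(scale0r 0) fs_normZ ?normr0 ?mul0r//; exact: fs_mem0. Qed.

Lemma fs_norm_ge0 v : mem v -> 0 <= nrm v.
Proof.
move=> mv; have := fs_normD mv (fs_memN mv).
by rewrite subrr fs_norm0 fs_normN// -mulr2n pmulrn_lge0.
Qed.

Lemma fs_normB v w : mem v -> mem w -> nrm (v - w) <= nrm v + nrm w.
Proof. by move=> mv mw; rewrite -(fs_normN mw); exact: fs_normD (fs_memN mw). Qed.

Lemma fs_distC v w : mem v -> mem w -> nrm (v - w) = nrm (w - v).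
Proof. by move=> mv mw; rewrite -opprB fs_normN//; exact: fs_memB. Qed.

Lemma fs_dist_trans w v x : mem v -> mem w -> mem x ->
  nrm (v - x) <= nrm (v - w) + nrm (w - x).
Proof.
move=> mv mw mx; rewrite -(subrK w v) -addrA addrK.
by apply: fs_normD; apply: fs_memB.
Qed.

Lemma fs_norm_le_dist v w : mem v -> mem w -> nrm v <= nrm (v - w) + nrm w.
Proof. by move=> mv mw; rewrite -{1}(subrK w v); apply: fs_normD (fs_memB _ _) _. Qed.

Lemma lin_mem M v : bounded_linear S S M -> mem v -> mem (M v).
Proof. by case=> + _ _; apply. Qed.

Lemma linP M c v w : bounded_linear S S M -> mem v -> mem w ->
  nrm (M (c *: v + w) - (c *: M v + M w)) = 0.
Proof. by case=> _ + _; apply. Qed.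

Lemma lin_bound M : bounded_linear S S M ->
  exists2 C, 0 <= C & forall v, mem v -> nrm (M v) <= C * nrm v.
Proof.
move=> [Mm _ [C hC]]; exists `|C| => // v mv; apply: le_trans (hC _ mv) _.
by apply: ler_wpM2r (ler_norm _); exact: fs_norm_ge0.
Qed.

Lemma lin0 M : bounded_linear S S M -> nrm (M 0) = 0.
Proof.
move=> Ml; have [C C0 /(_ _ fs_mem0)] := lin_bound Ml.
rewrite fs_norm0 mulr0 => h; apply/eqP; rewrite eq_le h.
exact: fs_norm_ge0 (lin_mem Ml fs_mem0).
Qed.

(** Stands in for rewriting with an equation that holds only up to null vectors. *)
Lemma null_eq v w : mem v -> mem w -> nrm (v - w) = 0 -> nrm v = nrm w.
Proof.
move=> mv mw e; apply/eqP; rewrite eq_le.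
have := fs_norm_le_dist mv mw; have := fs_norm_le_dist mw mv.
by rewrite fs_distC// e !add0r => -> ->.
Qed.

Lemma null_trans v w x : mem v -> mem w -> mem x ->
  nrm (v - w) = 0 -> nrm (w - x) = 0 -> nrm (v - x) = 0.
Proof.
move=> mv mw mx vw wx; apply/eqP; rewrite eq_le fs_norm_ge0; last exact: fs_memB.
by rewrite andbT; apply: le_trans (fs_dist_trans mv mw mx) _; rewrite vw wx addr0.
Qed.

Lemma linB M v w : bounded_linear S S M -> mem v -> mem w ->
  nrm (M (v - w) - (M v - M w)) = 0.
Proof.
move=> Ml mv mw; have := linP (-1) Ml mw mv.
by rewrite !scaleN1r ![- _ + _]addrC.
Qed.

Lemma linZ M c v : bounded_linear S S M -> mem v ->
  nrm (M (c *: v) - c *: M v) = 0.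
Proof.
move=> Ml mv; have mM w : mem w -> mem (M w) := lin_mem Ml.
have mc := fs_memZ c (mM _ mv).
have m0 := mM _ fs_mem0; have := linP c Ml mv fs_mem0; rewrite addr0.
move/null_trans; apply => //; [exact/mM/fs_memZ|exact: fs_memD|].
by rewrite addrAC subrr add0r lin0.
Qed.

(** [N] picks an arbitrary preimage of each vector. The lower bound makes preimages unique up to
    null vectors, so linearity of [N] and [N (M v) = v] can be checked after applying [M]. *)
Lemma inverse_of_iso C M : 0 < C -> iso_bound C M ->
  exists N, is_inverse S M N /\ opnorm S S N <= C.
Proof.
move=> C0 [Ml lo onto].
have /choice[N HN] : forall w, exists v, mem w -> mem v /\ nrm (M v - w) = 0.
  move=> w; have [mw|nmw] := pselect (mem w); last by exists 0 => /nmw.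
  by have [v mv e] := onto _ mw; exists v.
have mN w : mem w -> mem (N w) by case/HN.
have mM w : mem w -> mem (M w) by exact: lin_mem.
have MN w : mem w -> nrm (M (N w) - w) = 0 by case/HN.
have bN w : mem w -> nrm (N w) <= C * nrm w.
  move=> mw; apply: le_trans (lo _ (mN _ mw)) _.
  by rewrite (null_eq (mM _ (mN _ mw)) mw)//; exact: MN.
have inj v : mem v -> nrm (M v) = 0 -> nrm v = 0.
  move=> mv e; apply/eqP; rewrite eq_le fs_norm_ge0// andbT.
  by apply: le_trans (lo _ mv) _; rewrite e mulr0.
exists N; split; last first.
  apply: ge_sup; first by exists (nrm (N 0)), 0 => //=; rewrite fs_norm0; split => //;
    exact: fs_mem0.
  move=> _ [v [mv v1] <-]; apply: le_trans (bN _ mv) _.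
  by rewrite ger_pMr.
split => //.
- split=> //; last by exists C.
  move=> c v w mv mw.
  have m1 := fs_memP c mv mw; have m2 := fs_memP c (mN _ mv) (mN _ mw).
  apply: inj; first exact: fs_memB (mN _ m1) m2.
  rewrite (null_eq _ _ (linB Ml (mN _ m1) m2)); last 2 first.
  - exact/mM/fs_memB/m2/mN.
  - exact: fs_memB (mM _ (mN _ m1)) (mM _ m2).
  apply: (null_trans (mM _ (mN _ m1)) m1 (mM _ m2)); first exact: MN.
  rewrite fs_distC//; last exact: mM.
  have m3 := fs_memP c (mM _ (mN _ mv)) (mM _ (mN _ mw)).
  apply: (null_trans (mM _ m2) m3 m1); first exact: linP (mN _ mv) (mN _ mw).
  have -> : c *: M (N v) + M (N w) - (c *: v + w) = c *: (M (N v) - v) + (M (N w) - w).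
    by rewrite scalerBr opprD addrACA.
  have mMN x : mem x -> mem (M (N x) - x) by move=> mx; exact: fs_memB (mM _ (mN _ mx)) mx.
  apply/eqP; rewrite eq_le fs_norm_ge0 ?andbT; last exact: fs_memP (mMN _ mv) (mMN _ mw).
  apply: le_trans (fs_normD (fs_memZ _ (mMN _ mv)) (mMN _ mw)) _.
  by rewrite fs_normZ ?MN ?mulr0 ?addr0//; exact: mMN.
- move=> v mv; have mNM := mN _ (mM _ mv).
  apply: inj; first exact: fs_memB.
  rewrite (null_eq _ _ (linB Ml mNM mv)); first exact: MN (mM _ mv).
    exact/mM/fs_memB.
  exact: fs_memB (mM _ mNM) (mM _ mv).
Qed.

(** For the lower bound, [|v| <= C |M v| <= C theta |v| + C |M' v|], and absorbing [C theta <= 1/2]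
    on the left doubles the constant. Surjectivity comes from a Neumann-type iteration. *)
Lemma iso_perturb C theta M M' : fs_complete -> 0 <= C -> 0 <= theta ->
  C * theta <= 2^-1 -> iso_bound C M -> bounded_linear S S M' ->
  (forall v, mem v -> nrm (M' v - M v) <= theta * nrm v) ->
  iso_bound (C * 2) M'.
Proof.
move=> HC C0 t0 Ct [Ml lo onto] M'l MM'.
have mM w : mem w -> mem (M w) by exact: lin_mem.
have mM' w : mem w -> mem (M' w) by exact: lin_mem.
split=> // [v mv|w mw].
  have n0 := fs_norm_ge0 (mM' _ mv).
  have : nrm v <= C * (theta * nrm v + nrm (M' v)).
    apply: le_trans (lo _ mv) _; apply: ler_wpM2l => //.
    apply: le_trans (fs_norm_le_dist (mM _ mv) (mM' _ mv)) _.
    by rewrite lerD2r fs_distC ?MM'//; [exact: mM|exact: mM'].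
  rewrite mulrDr mulrA => h.
  have := ler_wpM2r (fs_norm_ge0 mv) Ct; lra.
(* Residual correction: solve with [M], apply [M'], repeat on the residual. *)
have /choice[N HN] : forall r, exists v, mem r -> mem v /\ nrm (M v - r) = 0.
  move=> r; have [mr|nmr] := pselect (mem r); last by exists 0 => /nmr.
  by have [v mv e] := onto _ mr; exists v.
pose r := fix r k := if k is k'.+1 then r k' - M' (N (r k')) else w.
pose s := fix s k := if k is k'.+1 then s k' + N (r k') else 0.
have mr k : mem (r k).
  by elim: k => //= k mrk; apply: fs_memB => //; apply: mM'; case: (HN _ mrk).
have mN k : mem (N (r k)) by case: (HN _ (mr k)).
have ms k : mem (s k) by elim: k => [|k msk]; [exact: fs_mem0|exact: fs_memD].
have bN k : nrm (N (r k)) <= C * nrm (r k).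
  by rewrite -(null_eq (mM _ (mN k)) (mr k) (HN _ (mr k)).2); exact: lo.
(* The new residual is [(r - M (N r)) + (M (N r) - M' (N r))]: the first part is null, the second at
   most [theta * C * |r| <= |r| / 2]. *)
have br k : nrm (r k) <= nrm w / 2 ^+ k.
  elim: k => [|k IH]; first by rewrite expr0 divr1.
  rewrite exprS invfM mulrCA /=.
  apply: (@le_trans _ _ (2^-1 * nrm (r k))); last exact: ler_wpM2l.
  apply: le_trans (fs_dist_trans (mr k) (mM _ (mN k)) (mM' _ (mN k))) _.
  rewrite fs_distC ?(HN _ (mr k)).2 ?add0r//; last exact: mM.
  rewrite fs_distC; [|exact: mM|exact: mM'].
  apply: le_trans (MM' _ (mN k)) _.
  apply: le_trans (ler_wpM2l t0 (bN k)) _.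
  by rewrite mulrA [theta * C]mulrC; apply: ler_wpM2r Ct; exact: fs_norm_ge0.
have nMs k : nrm (w - M' (s k) - r k) = 0.
  elim: k => [|k IH] /=; first by rewrite addrAC subrr sub0r fs_normN ?lin0//;
    exact: mM' fs_mem0.
  rewrite -IH; apply: null_eq.
  - exact: fs_memB (fs_memB mw (mM' _ (ms k.+1))) (mr k.+1).
  - exact: fs_memB (fs_memB mw (mM' _ (ms k))) (mr k).
  have m1 := fs_memD (mM' _ (ms k)) (mM' _ (mN k)).
  have := linP 1 M'l (ms k) (mN k); rewrite !scale1r fs_distC//;
    last exact: (mM' _ (ms k.+1)).
  (* An identity in an abelian group, with [a = M' (s k.+1)], [b = M' (s k)], [c = M' (N (r k))],
     [e = r k], [f = w]: the left side is the null defect of additivity of [M']. *)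
  have zid (a b c e f : X) : b + c - a = f - a - (e - c) - (f - b - e).
    rewrite [f - a - _]addrC [- (e - c)]opprB [- (f - b - e)]opprB [- (f - b)]opprB.
    by rewrite addrACA subrK [f - a + _]addrC [b - f + _]addrA subrK addrA [c + b]addrC.
  by move=> <-; congr (nrm _); rewrite /= -zid.
have [|v mv hv] := HC s (C * nrm w) ms.
  move=> k; rewrite /= addrAC subrr add0r.
  by apply: le_trans (bN k) _; rewrite -mulrA; apply: ler_wpM2l.
exists v => //.
have [B B0 hB] := lin_bound M'l.
(* [M' v - w] is [M' (v - s k)] minus the residual [r k], up to null vectors; both are of order
   [2^-k]. *)
have hk k : nrm (M' v - w) <= (B * (C * nrm w * 2) + nrm w) / 2 ^+ k.
  apply: le_trans (fs_dist_trans (mM' _ mv) (mM' _ (ms k)) mw) _.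
  rewrite mulrDl; apply: lerD.
    rewrite -(null_eq _ _ (linB M'l mv (ms k))).
    - apply: le_trans (hB _ (fs_memB mv (ms k))) _; rewrite -mulrA.
      by apply: ler_wpM2l => //; rewrite mulrAC; exact: hv.
    - exact/mM'/fs_memB.
    - by apply: fs_memB; exact: mM'.
  rewrite fs_distC//; last exact: mM'.
  by rewrite (null_eq _ _ (nMs k))//; exact/fs_memB/mM'.
apply/eqP; rewrite eq_le fs_norm_ge0 ?andbT; last exact: fs_memB (mM' _ mv) mw.
exact: le0_of_le_geometric hk.
Qed.

(** If it fails, there are unit vectors [v k] and parameters [t k] with [v k - t k *: K (v k)]
    tending to 0. Taking limits of the parameters too makes the bound uniform in [t]. *)
Lemma homotopy_lower_bound K : bounded_linear S S K -> compact_op K ->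
  (forall t v, 0 <= t <= 1 -> mem v -> nrm (v - t *: K v) = 0 -> nrm v = 0) ->
  exists2 C, 0 < C & forall t v, 0 <= t <= 1 -> mem v ->
    nrm v <= C * nrm (v - t *: K v).
Proof.
move=> Kl Kc inj; apply: contrapT => nC.
have mK v : mem v -> mem (K v) by exact: lin_mem.
have mtK t v : mem v -> mem (t *: K v) by move=> mv; exact/fs_memZ/mK.
have [B B0 KB] := lin_bound Kl.
(* The constant [k.+1] violates the bound for some [t] and [v]; dividing by [nrm v], which is then
   positive, gives a unit vector. *)
have /choice[tv Htv] : forall k : nat, exists tv : R * X,
    [/\ 0 <= tv.1 <= 1, mem tv.2, nrm tv.2 = 1 &
        nrm (tv.2 - tv.1 *: K tv.2) <= k.+1%:R^-1].
  move=> k; apply: contrapT => nk; apply: nC; exists k.+1%:R => // t v t01 mv.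
  rewrite leNgt; apply/negP => lt; apply: nk.
  have mvK : mem (v - t *: K v) by apply: fs_memB => //; exact: mtK.
  have v0 : 0 < nrm v by apply: le_lt_trans lt; rewrite mulr_ge0// fs_norm_ge0.
  have vi0 : 0 <= (nrm v)^-1 by rewrite invr_ge0 ltW.
  have mcv := fs_memZ (nrm v)^-1 mv.
  exists (t, (nrm v)^-1 *: v) => /=; split => //.
    by rewrite fs_normZ// (ger0_norm vi0) mulVf// gt_eqF.
  rewrite (@null_eq _ ((nrm v)^-1 *: (v - t *: K v))); last 3 first.
  - by apply: fs_memB => //; exact: mtK.
  - exact: fs_memZ.
  - rewrite scalerBr opprB addrC subrKA scalerA mulrC -scalerA -scalerBr.
    have mcK := fs_memZ (nrm v)^-1 (mK _ mv).
    rewrite fs_normZ; last exact: fs_memB mcK (mK _ mcv).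
    by rewrite fs_distC ?linZ ?mulr0//; exact: mK.
  rewrite fs_normZ// (ger0_norm vi0) ler_pdivrMl//.
  by rewrite ler_pdivlMr// mulrC ltW.
have [F [UF sF]] := @ultraFilterLemma nat eventually _.
have t01 k : 0 <= (tv k).1 <= 1 by case: (Htv k).
have mv k : mem (tv k).2 by case: (Htv k).
have [t tB tF] := ultra_lim UF t01.
have [|x mx xF] := Kc F UF (fun k => (tv k).2).
  by move=> k; case: (Htv k) => _ ? ->.
(* [v k] converges to [t x] along [F], so [t x] is a unit vector killed by [I - t K]. *)
have small e : 0 < e -> exists k,
    [/\ `|(tv k).1 - t| < e, nrm (K (tv k).2 - x) < e & k.+1%:R^-1 < e].
  move=> e0.
  have Fe : F [set k | k.+1%:R^-1 < e].
    by apply: sF; exact: near_infty_natSinv_lt (PosNum e0).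
  by have [k [[]]] := filter_ex (filterI (filterI (tF _ e0) (xF _ e0)) Fe); exists k.
have mtx : mem (t *: x) by exact: fs_memZ.
(* [v k - t *: x] is the residual plus [t k *: (K (v k) - x)] plus [(t k - t) *: x], of sizes at
   most [e], [e] and [e * nrm x]. *)
pose c := 2 + nrm x.
have c0 : 0 < c by have := fs_norm_ge0 mx; rewrite /c; lra.
have vx e : 0 < e -> exists2 k, nrm ((tv k).2 - t *: x) <= e * c &
    nrm (K (tv k).2 - x) <= e.
  move=> e0; have [k [tk xk ke]] := small _ e0; exists k; last exact: ltW.
  have [/andP[tk0 tk1] _ _ res] := Htv k.
  have mtKk := mtK (tv k).1 _ (mv k).
  have mKx : mem (K (tv k).2 - x) by exact/fs_memB/mx/mK.
  apply: le_trans (fs_dist_trans (mv k) mtKk mtx) _.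
  have -> : (tv k).1 *: K (tv k).2 - t *: x =
            (tv k).1 *: (K (tv k).2 - x) + ((tv k).1 - t) *: x.
    by rewrite scalerBr scalerBl subrKA.
  have h1 := fs_normD (fs_memZ (tv k).1 mKx) (fs_memZ ((tv k).1 - t) mx).
  rewrite !fs_normZ// (ger0_norm tk0) in h1.
  have h2 : (tv k).1 * nrm (K (tv k).2 - x) <= e.
    by rewrite -[e]mul1r ler_pM// ?fs_norm_ge0// ltW.
  have h3 : `|(tv k).1 - t| * nrm x <= e * nrm x.
    by rewrite ler_wpM2r ?fs_norm_ge0// ltW.
  have h4 := le_trans res (ltW ke); rewrite /c mulrDr; lra.
have /inj : nrm (t *: x - t *: K (t *: x)) = 0.
  rewrite -scalerBr fs_normZ//; last exact/fs_memB/mK.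
  have mxK : mem (x - K (t *: x)) by exact/fs_memB/mK.
  suff -> : nrm (x - K (t *: x)) = 0 by rewrite mulr0.
  apply/eqP; rewrite eq_le fs_norm_ge0// andbT.
  apply: (@le0_of_le_eps _ _ (1 + B * c)) => e /vx[k h1 h2].
  apply: le_trans (fs_dist_trans mx (mK _ (mv k)) (mK _ mtx)) _.
  rewrite fs_distC//; last exact: mK.
  rewrite mulrDr mulr1 mulrCA; apply: lerD => //.
  rewrite -(null_eq _ _ (linB Kl (mv k) mtx)).
  - by apply: le_trans (KB _ (fs_memB (mv k) mtx)) _; exact: ler_wpM2l.
  - exact/mK/fs_memB.
  - by apply: fs_memB; exact: mK.
move=> /(_ tB mtx) tx0; suff : (1 : R) <= 0 by rewrite ler10.
apply: (@le0_of_le_eps _ _ c) => e /vx[k h1 _].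
have [_ _ <- _] := Htv k; apply: le_trans (fs_norm_le_dist (mv k) mtx) _.
by rewrite tx0 addr0.
Qed.

Lemma bounded_linear_id_sub t K : bounded_linear S S K ->
  bounded_linear S S (fun v => v - t *: K v).
Proof.
move=> Kl; have mK v : mem v -> mem (K v) by exact: lin_mem.
have mtK v : mem v -> mem (t *: K v) by move=> mv; exact/fs_memZ/mK.
have [B B0 KB] := lin_bound Kl.
split=> [v mv|c v w mv mw|]; first exact/fs_memB/mtK.
  have m1 := fs_memP c mv mw.
  rewrite /= [c *: (_ - _)]scalerBr [c *: v - _ + _]addrACA -opprD opprB
    [X in nrm X]addrC subrKA.
  rewrite scalerA mulrC -scalerA -scalerDr -scalerBr fs_normZ; last first.
    by apply: fs_memB (mK _ m1); apply: fs_memP; exact: mK.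
  rewrite fs_distC; [by rewrite linP// mulr0| |exact: mK].
  by apply: fs_memP; exact: mK.
exists (1 + `|t| * B) => v mv; apply: le_trans (fs_normB mv (mtK _ mv)) _.
rewrite mulrDl mul1r lerD2l fs_normZ -?mulrA; last exact: mK.
by apply: ler_wpM2l => //; exact: KB.
Qed.

(* Continuity method along [I - t K], [0 <= t <= 1]: the uniform lower bound lets
   [iso_perturb] advance by steps of fixed length. *)
Lemma iso_id_sub_compact K : fs_complete -> bounded_linear S S K ->
  compact_op K ->
  (forall t v, 0 <= t <= 1 -> mem v -> nrm (v - t *: K v) = 0 -> nrm v = 0) ->
  exists2 C, 0 < C & iso_bound C (fun v => v - K v).
Proof.
move=> HC Kl Kc inj.
have mK v : mem v -> mem (K v) by exact: lin_mem.
have mtK t v : mem v -> mem (t *: K v) by move=> mv; exact/fs_memZ/mK.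
have [B B0 KB] := lin_bound Kl.
have [C C0 lo] := homotopy_lower_bound Kl Kc inj.
have lin t := bounded_linear_id_sub t Kl.
(* A step of length [1 / n] in [t] changes the operator by at most [B / n], and [n > 2 C B] keeps
   this within reach of [iso_perturb]. *)
pose n := (Num.truncn (C * 2 * B)).+1.
have nB : C * (B / n%:R) <= 2^-1.
  have := truncnS_gt (C * 2 * B); rewrite -/n => hn.
  rewrite mulrA ler_pdivrMr ?ltr0n//; lra.
have step i : (i <= n)%N -> iso_bound C (fun v => v - (i%:R / n%:R) *: K v).
  have t01 j : (j <= n)%N -> 0 <= (j%:R / n%:R : R) <= 1.
    by move=> jn; rewrite divr_ge0// ler_pdivrMr ?ltr0n// mul1r ler_nat.
  elim: i => [_|i IH lin_].
    split=> // [v mv|w mw]; first by apply: lo => //; exact: t01.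
    by exists w => //; rewrite mul0r scale0r subr0 subrr fs_norm0.
  have Bn0 : 0 <= B / n%:R by rewrite divr_ge0.
  have [|_ _ onto] := iso_perturb HC (ltW C0) Bn0 nB (IH (ltnW lin_)) (lin
    (i.+1%:R / n%:R)).
    move=> v mv; rewrite /= opprB addrC addrA subrK -scalerBl -mulrBl.
    rewrite fs_normZ; last exact: mK.
    rewrite normrM distrC -natrB// subSnn.
    rewrite normr1 mul1r ger0_norm ?invr_ge0// mulrAC.
    by rewrite mulrC; apply: ler_wpM2r; [rewrite invr_ge0|exact: KB].
  (* Only surjectivity is kept from the perturbation step. The lower bound is taken afresh from
     [lo], so the constant stays [C] instead of doubling at each step. *)
  by split=> // v mv; apply: lo => //; exact: t01.
exists C => //.
rewrite (_ : (fun v => _) = (fun v => v - (n%:R / n%:R) *: K v)); first exact: step.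
by apply/funext => v; rewrite divff ?scale1r// pnatr_eq0.
Qed.

End seminormed_spaces.

(** * Square-integrable functions *)

Section square_integrable.
Context d (T : measurableType d) (R : realType) (mu : {measure set T -> \bar R}).
Variable D : set T.
Implicit Types (f g h : T -> R) (B c : R).

Definition rintegrable f : Prop := mu.-integrable D (EFin \o f).
(** Measurability is required separately because it does not follow from that of [f ^ 2]. *)
Definition sqint f : Prop :=
  measurable_fun D f /\ rintegrable (fun x => f x ^+ 2).
Definition l2norm f : R := Num.sqrt (\int[mu]_(x in D) (f x ^+ 2)).

Hypothesis mD : measurable D.
Local Notation Int f := (\int[mu]_(x in D) f x).

Lemma rint_meas f : rintegrable f -> measurable_fun D f.
Proof. by move/measurable_int/measurable_EFinP. Qed.

Lemma rintD f g : rintegrable f -> rintegrable g ->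
  rintegrable (fun x => f x + g x).
Proof. by move=> fi gi; apply: eq_integrable (integrableD mD fi gi). Qed.

Lemma rintZ c f : rintegrable f -> rintegrable (fun x => c * f x).
Proof. by move=> fi; apply: eq_integrable (integrableZl mD c fi). Qed.

Lemma rintB f g : rintegrable f -> rintegrable g ->
  rintegrable (fun x => f x - g x).
Proof. by move=> fi gi; apply: eq_integrable (integrableB mD fi gi). Qed.

Lemma rint_ae_le f g : measurable_fun D f -> rintegrable g ->
  {ae mu, forall x, D x -> `|f x| <= g x} -> rintegrable f.
Proof.
move=> mf gi [N [mN N0 sN]].
apply/(negligible_integrable mN mD _ N0); first exact/measurable_EFinP.
apply: (@le_integrable _ _ _ _ _ (measurableD mD mN) _ (EFin \o g)).
- by apply/measurable_EFinP; apply: measurable_funS mf.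
- move=> x [Dx Nx]; rewrite /= lee_fin; apply: le_trans (ler_norm _).
  by apply: contrapT => h; apply: Nx; apply: sN => /= /(_ Dx).
- by apply: integrableS gi => //; exact: measurableD.
Qed.

Lemma rint_le f g : measurable_fun D f -> rintegrable g ->
  (forall x, D x -> `|f x| <= g x) -> rintegrable f.
Proof. by move=> mf gi fg; apply: rint_ae_le gi _ => //; apply: nearW. Qed.

Lemma rint_mul_bounded f h B : rintegrable f -> measurable_fun D h ->
  (forall x, D x -> `|h x| <= B) -> rintegrable (fun x => f x * h x).
Proof.
move=> fi mh hB; have fi' : rintegrable (fun x => `|f x|) by exact: integrable_norm fi.
apply: rint_le (rintZ B fi') _; first exact: measurable_funM (rint_meas fi) mh.
by move=> x Dx; rewrite normrM mulrC ler_wpM2r// hB.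
Qed.

Lemma ae_le_Rint f g : rintegrable f -> rintegrable g ->
  {ae mu, forall x, D x -> f x <= g x} -> Int f <= Int g.
Proof.
move=> fi gi [N [mN N0 sN]].
have mDN := measurableD mD mN.
rewrite /Rintegral (negligible_integral mN mD fi N0) (negligible_integral mN mD gi N0).
apply: le_Rintegral => //; [exact: integrableS fi|exact: integrableS gi|].
move=> x [Dx Nx]; apply: contrapT => h; apply: Nx; apply: sN => /= /(_ Dx).
exact: h.
Qed.

Lemma ae_eq_Rint f g : rintegrable f -> rintegrable g ->
  {ae mu, forall x, D x -> f x = g x} -> Int f = Int g.
Proof.
move=> fi gi fg; apply/eqP; rewrite eq_le; apply/andP; split;
  by apply: ae_le_Rint => //; apply: filterS fg => x fg Dx; rewrite fg.
Qed.

Lemma Rint_norm_le f g : rintegrable f -> rintegrable g ->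
  {ae mu, forall x, D x -> `|f x| <= g x} -> `|Int f| <= Int g.
Proof.
move=> fi gi fg; rewrite ler_norml; apply/andP; split.
  rewrite -mulN1r -RintegralZl//; apply: ae_le_Rint => //; first exact: rintZ.
  by apply: filterS fg => x fg Dx; rewrite mulN1r; have := fg Dx;
    rewrite ler_norml => /andP[].
by apply: ae_le_Rint => //; apply: filterS fg => x fg Dx;
  exact: le_trans (ler_norm _) (fg Dx).
Qed.

Lemma sqint_mul f g : sqint f -> sqint g -> rintegrable (fun x => f x * g x).
Proof.
move=> [mf fi] [mg gi]; apply: rint_le (rintD fi gi) _.
  exact: measurable_funM.
move=> x _; rewrite ler_norml; have := sqr_ge0 (f x + g x); have := sqr_ge0 (f x - g x).
by rewrite sqrrB sqrrD; have := sqr_ge0 (f x); have := sqr_ge0 (g x) => *; apply/andP;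
  split; lra.
Qed.

Lemma sqintP c f g : sqint f -> sqint g -> sqint (fun x => c * f x + g x).
Proof.
move=> sf sg; have [[mf fi] [mg gi]] := (sf, sg); split.
  by apply: measurable_funD => //; exact: measurable_funM.
have := rintD (rintD (rintZ (c ^+ 2) fi) gi) (rintZ (2 * c) (sqint_mul sf sg)).
apply: eq_integrable => // x _; congr EFin => /=; ring.
Qed.

Lemma l2norm_ge0 f : 0 <= l2norm f. Proof. exact: sqrtr_ge0. Qed.

Lemma l2norm_sq f : l2norm f ^+ 2 = Int (fun x => f x ^+ 2).
Proof. by rewrite sqr_sqrtr//; apply: Rintegral_ge0 => x _; exact: sqr_ge0. Qed.

Lemma Rint_sq_lin c f g : sqint f -> sqint g ->
  Int (fun x => (c * f x + g x) ^+ 2) =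
  c ^+ 2 * Int (fun x => f x ^+ 2) + 2 * c * Int (fun x => f x * g x)
  + Int (fun x => g x ^+ 2).
Proof.
move=> sf sg; have [[mf fi] [mg gi]] := (sf, sg).
have fgi := sqint_mul sf sg.
rewrite -!RintegralZl// -!RintegralD//; first last.
- exact: rintZ.
- exact: rintZ.
- by apply: rintD; exact: rintZ.
- by apply: eq_Rintegral => x _ /=; ring.
Qed.

(** The quadratic polynomial [s |-> |s f + g|^2] is nonnegative; it is evaluated at a suitable
    [s]. *)
Lemma l2norm_cauchy_schwarz f g : sqint f -> sqint g ->
  `|Int (fun x => f x * g x)| <= l2norm f * l2norm g.
Proof.
move=> sf sg; set b := Int _.
have h (s : R) : 0 <= s ^+ 2 * l2norm f ^+ 2 + 2 * s * b + l2norm g ^+ 2.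
  by rewrite !l2norm_sq -Rint_sq_lin//; apply: Rintegral_ge0 => x _; exact: sqr_ge0.
have f0 := l2norm_ge0 f; have g0 := l2norm_ge0 g.
rewrite -(@ler_pXn2r _ 2)// ?nnegrE ?mulr_ge0// exprMn real_normK ?num_real//.
have [f00|fn0] := eqVneq (l2norm f) 0.
  (* With [|f| = 0] the polynomial is affine in [s], and at this [s] its value would be -1 unless
     [b = 0]. *)
  have := h (- (l2norm g ^+ 2 + 1) / (2 * b)).
  rewrite f00 expr0n mul0r mulr0 add0r.
  have [-> _|bn0] := eqVneq b 0; first by rewrite expr0n.
  have -> : 2 * (- (l2norm g ^+ 2 + 1) / (2 * b)) * b = - (l2norm g ^+ 2 + 1) by field.
  lra.
have fp : 0 < l2norm f ^+ 2 by rewrite exprn_gt0// lt_def fn0.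
(* The minimiser of the polynomial. *)
have := h (- b / l2norm f ^+ 2).
have -> : (- b / l2norm f ^+ 2) ^+ 2 * l2norm f ^+ 2 + 2 * (- b / l2norm f ^+ 2) * b
    + l2norm g ^+ 2 = (l2norm f ^+ 2 * l2norm g ^+ 2 - b ^+ 2) / l2norm f ^+ 2 by field.
by rewrite pmulr_lge0 ?invr_gt0// subr_ge0.
Qed.

Lemma l2norm_triangle f g : sqint f -> sqint g ->
  l2norm (fun x => f x + g x) <= l2norm f + l2norm g.
Proof.
move=> sf sg; have f0 := l2norm_ge0 f; have g0 := l2norm_ge0 g.
rewrite -(@ler_pXn2r _ 2)// ?nnegrE ?addr_ge0 ?l2norm_ge0//.
have := l2norm_cauchy_schwarz sf sg => /(le_trans (ler_norm _)) h.
rewrite l2norm_sq; under eq_Rintegral do rewrite -[f _]mul1r.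
rewrite Rint_sq_lin// -!l2norm_sq sqrrD; lra.
Qed.

Lemma l2normZ c f : sqint f -> l2norm (fun x => c * f x) = `|c| * l2norm f.
Proof.
move=> [mf fi]; rewrite /l2norm; under eq_Rintegral do rewrite exprMn.
by rewrite RintegralZl// sqrtrM ?sqr_ge0// sqrtr_sqr.
Qed.

Lemma sqint_ae_le f g : measurable_fun D f -> sqint g ->
  {ae mu, forall x, D x -> `|f x| <= `|g x|} -> sqint f.
Proof.
move=> mf [mg gi] fg; split=> //; apply: rint_ae_le gi _.
  exact: measurable_funX.
apply: filterS fg => x /[apply] fg; rewrite ger0_norm ?sqr_ge0//.
by rewrite -real_normK ?num_real// -[leRHS]real_normK ?num_real// ler_pXn2r// nnegrE.
Qed.

Lemma l2norm_ae_le f g : sqint f -> sqint g ->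
  {ae mu, forall x, D x -> `|f x| <= `|g x|} -> l2norm f <= l2norm g.
Proof.
move=> [mf fi] [mg gi] fg; apply: ler_wsqrtr; apply: ae_le_Rint => //.
apply: filterS fg => x /[apply] fg.
by rewrite -real_normK ?num_real// -[leRHS]real_normK ?num_real// ler_pXn2r// nnegrE.
Qed.

Lemma l2norm_eq0_ae f : sqint f -> l2norm f = 0 ->
  {ae mu, forall x, D x -> f x = 0}.
Proof.
move=> [mf fi] f0.
have : (\int[mu]_(x in D) `|(f x ^+ 2)%:E| = 0)%E.
  have := l2norm_sq f; rewrite f0 expr0n /= /Rintegral => h.
  rewrite (eq_integral (EFin \o (fun x => f x ^+ 2))); last first.
    by move=> x _; rewrite /= ger0_norm// sqr_ge0.
  by rewrite -[LHS]fineK -?h//; exact: integrable_fin_num.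
move/(ae_eq_integral_abs mu mD).
have : measurable_fun D (EFin \o (fun x => f x ^+ 2))
  by exact/measurable_EFinP/measurable_funX.
move=> /[swap] /[apply]; apply: filterS => x h Dx.
by have /= /eqP := h Dx; rewrite eqe sqrf_eq0 => /eqP.
Qed.

Lemma l2norm_ae0 f : sqint f -> {ae mu, forall x, D x -> f x = 0} ->
  l2norm f = 0.
Proof.
move=> [mf fi] f0; rewrite /l2norm (@ae_eq_Rint _ (fun=> 0))//.
- by rewrite Rintegral_cst// mul0r sqrtr0.
- exact: integrable0.
- by apply: filterS f0 => x /[apply] ->; rewrite expr0n.
Qed.

Hypothesis finD : (mu D < +oo)%E.

Lemma rint_cst c : rintegrable (fun=> c).
Proof.
apply/integrableP; split; first exact/measurable_EFinP/measurable_cst.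
by rewrite integral_cst// lte_mul_pinfty.
Qed.

Lemma rint_bounded f B : measurable_fun D f ->
  {ae mu, forall x, D x -> `|f x| <= B} -> rintegrable f.
Proof. by move=> mf; apply: rint_ae_le => //; exact: rint_cst. Qed.

Lemma sqint_bounded f B : measurable_fun D f ->
  {ae mu, forall x, D x -> `|f x| <= B} -> sqint f.
Proof.
move=> mf fB; apply: (@sqint_ae_le _ (fun=> B)) => //.
  by split; [exact: measurable_cst|exact: rint_cst].
by apply: filterS fB => x /[apply] /le_trans; apply; exact: ler_norm.
Qed.

Lemma sqint_rint f : sqint f -> rintegrable f.
Proof.
move=> sf; have s1 : sqint (fun=> 1).
  by apply: (@sqint_bounded _ 1) => //; apply: nearW => x _; rewrite normr1.
by have := sqint_mul sf s1; apply: eq_integrable => // x _ /=; rewrite mulr1.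
Qed.

Lemma l2norm_bounded f B : 0 <= B -> measurable_fun D f ->
  {ae mu, forall x, D x -> `|f x| <= B} ->
  l2norm f <= B * Num.sqrt (fine (mu D)).
Proof.
move=> B0 mf fB; have sc : sqint (fun=> B).
  by split; [exact: measurable_cst|exact: rint_cst].
apply: le_trans (l2norm_ae_le (sqint_bounded mf fB) sc _) _.
  by apply: filterS fB => x /[apply] /le_trans; apply; exact: ler_norm.
by rewrite /l2norm Rintegral_cst// sqrtrM ?sqr_ge0// sqrtr_sqr ger0_norm.
Qed.

End square_integrable.

(** * Completeness of L^2 on a set of finite measure *)

Section square_integrable_complete.
Context d (T : measurableType d) (R : realType) (mu : {measure set T -> \bar R}).
Variable D : set T.
Hypothesis mD : measurable D.
Hypothesis finD : (mu D < +oo)%E.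
Local Notation sqint := (sqint mu D).
Local Notation l2norm := (l2norm mu D).

Lemma l2norm_sub_telescope (v : nat -> T -> R) (c : R) :
  (forall k, sqint (v k)) ->
  (forall k, l2norm (fun x => v k.+1 x - v k x) <= c / 2 ^+ k) ->
  forall k n, l2norm (fun x => v (n + k)%N x - v k x) <= c / 2 ^+ k * 2.
Proof.
move=> sv hv k n.
have sB f g : sqint f -> sqint g -> sqint (fun x => f x - g x).
  move=> sf sg; rewrite (_ : (fun x => _) = (fun x => -1 * g x + f x)).
    exact: sqintP.
  by apply/funext => x; rewrite mulN1r addrC.
have c0 j : 0 <= c / 2 ^+ j := le_trans (l2norm_ge0 _ _ _) (hv j).
(* The exact partial sum of the geometric series; the bound with 2 alone would not survive the
   induction. *)
suff : l2norm (fun x => v (n + k)%N x - v k x) <= c / 2 ^+ k * (2 - 2 / 2 ^+ n).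
  by move/le_trans; apply; apply: ler_wpM2l => //; rewrite gerBl divr_ge0// exprn_ge0.
elim: n => [|n IH].
  rewrite add0n expr0 divr1 subrr mulr0 (_ : (fun x => _) = fun=> 0).
    by rewrite l2norm_ae0//; [split; [exact: measurable_cst|]|exact: nearW];
      rewrite expr0n; exact: rint_cst.
  by apply/funext => x; rewrite subrr.
rewrite (_ : (fun x => _) = (fun x => (v (n.+1 + k)%N x - v (n + k)%N x)
    + (v (n + k)%N x - v k x))); last by apply/funext => x; rewrite subrKA.
apply: le_trans (l2norm_triangle mD (sB _ _ (sv _) (sv _)) (sB _ _ (sv _) (sv _))) _.
rewrite addSn; apply: le_trans (lerD (hv _) IH) _.
rewrite exprD exprS !invfM le_eqVlt; apply/orP; left; apply/eqP.
have n0 : (2 : R) ^+ n != 0 by rewrite expf_neq0// pnatr_eq0.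
have k0 : (2 : R) ^+ k != 0 by rewrite expf_neq0// pnatr_eq0.
by field; rewrite n0 k0.
Qed.

(** On a set of finite measure Cauchy-Schwarz bounds the L^1 norms of the increments by a summable
    sequence. Their absolute values therefore have an integrable sum, finite a.e., and the
    telescoping series converges absolutely there. *)
Lemma ae_cvg_of_l2_summable (v : nat -> T -> R) (c : R) :
  (forall k, sqint (v k)) ->
  (forall k, l2norm (fun x => v k.+1 x - v k x) <= c / 2 ^+ k) ->
  {ae mu, forall x, D x -> cvgn (fun k => v k x)}.
Proof.
move=> sv hv.
pose g (k : nat) (x : T) : R := `|v k.+1 x - v k x|.
have sg k : sqint (g k).
  have := sqintP mD (-1) (sv k) (sv k.+1).
  rewrite (_ : (fun x => _) = (fun x => v k.+1 x - v k x)) => [s|]; last first.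
    by apply/funext => x; rewrite mulN1r addrC.
  apply: (sqint_ae_le mD _ s); last by apply: nearW => x _; rewrite normr_id.
  by apply: measurableT_comp => //; case: s.
have mg k : measurable_fun D (fun x => (g k x)%:E) by apply/measurable_EFinP; case: (sg k).
have g0 k x : D x -> (0 <= (g k x)%:E)%E by move=> _; rewrite lee_fin /g.
pose s := Num.sqrt (fine (mu D)).
have ig k : (\int[mu]_(x in D) (g k x)%:E <= (c * s / 2 ^+ k)%:E)%E.
  have rg := sqint_rint mD finD (sg k).
  rewrite -[leLHS]fineK; last exact: integrable_fin_num.
  rewrite lee_fin.
  have s1 : sqint (fun=> 1).
    by apply: (@sqint_bounded _ _ _ _ _ mD finD _ 1) => //; apply: nearW => x _;
      rewrite normr1.
  have := l2norm_cauchy_schwarz mD (sg k) s1.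
  have -> : l2norm (fun=> 1) = s by rewrite /l2norm expr1n Rintegral_cst// mul1r.
  have -> : l2norm (g k) = l2norm (fun x => v k.+1 x - v k x).
    by congr Num.sqrt; apply: eq_Rintegral => x _; rewrite /g real_normK ?num_real.
  move/(le_trans (ler_norm _)); under eq_Rintegral do rewrite mulr1.
  move/le_trans; apply; rewrite mulrAC; apply: ler_wpM2r => //; exact: sqrtr_ge0.
have iS : (\int[mu]_(x in D) (\sum_(k <oo) (g k x)%:E) < +oo)%E.
  rewrite (integral_nneseries mu mD mg g0).
  apply: (@le_lt_trans _ _ (\sum_(k <oo) (c * s / 2 ^+ k)%:E)%E).
    by apply: lee_nneseries => k *; [apply: integral_ge0 => x Dx; exact: g0|exact: ig].
  (* The factor 2 compensates the exponent shift: the terms of the series are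
     [2 * (c * s) / 2 ^ (k + 1)]. *)
  rewrite (_ : (\sum_(k <oo) _)%E = (2 * (c * s) / 2 ^+ 0)%:E) ?ltry//.
  apply/cvg_lim => //; have := @cvg_geometric_eseries_half R (2 * (c * s)) 0.
  rewrite (_ : eseries _ = fun n => (\sum_(0 <= k < n) (c * s / 2 ^+ k)%:E)%E)//.
  apply/funext => n; apply: eq_bigr => k _; congr EFin.
  by rewrite addn1 natrX exprS; field; rewrite expf_neq0// pnatr_eq0.
have mS : measurable_fun D (fun x => \sum_(k <oo) (g k x)%:E)%E.
  by apply: ge0_emeasurable_sum => // k x Dx _; exact: g0.
have : mu.-integrable D (fun x => \sum_(k <oo) (g k x)%:E)%E.
  apply/integrableP; split=> //; apply: le_lt_trans iS; rewrite le_eqVlt; apply/orP; left.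
  apply/eqP; apply: eq_integral => x /set_mem Dx; rewrite gee0_abs//.
  by apply: nneseries_ge0 => n _ _; exact: g0.
move/(integrable_ae mD); apply: filterS => x h Dx.
have := h Dx; set S := (X in X \is a fin_num) => Sfin.
have cs : cvgn (series (fun k => v k.+1 x - v k x)).
  apply: normed_cvg; apply: nondecreasing_is_cvgn.
    apply: nondecreasing_series => n _ _; exact: normr_ge0.
  exists (fine S) => _ [n _ <-].
  rewrite -lee_fin fineK//.
  have /(_ n) := @nneseries_lim_ge _ (fun k => (g k x)%:E) xpredT 0%N.
  move=> /(_ (fun i _ _ => g0 i x Dx)); apply: le_trans.
  by rewrite /series /= sumEFin.
rewrite (_ : (fun k => v k x) = (fun k => v 0%N x + series (fun k => v k.+1 x - v k x) k)).
  by apply: is_cvgD => //; exact: is_cvg_cst.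
apply/funext => k; rewrite /series /= telescope_sumr//.
by rewrite addrC subrK.
Qed.

(** Riesz-Fischer: the limit is taken pointwise a.e., and Fatou's lemma turns the telescoped Cauchy
    bound into the rate of convergence. *)
Lemma sqint_complete (v : nat -> T -> R) (c : R) :
  (forall k, sqint (v k)) ->
  (forall k, l2norm (fun x => v k.+1 x - v k x) <= c / 2 ^+ k) ->
  exists2 w, sqint w & forall k, l2norm (fun x => w x - v k x) <= c / 2 ^+ k * 2.
Proof.
move=> sv hv; have [N [mN N0 sN]] := ae_cvg_of_l2_summable sv hv.
have sB f g : sqint f -> sqint g -> sqint (fun x => f x - g x).
  move=> sf sg; rewrite (_ : (fun x => _) = (fun x => -1 * g x + f x)).
    exact: sqintP.
  by apply/funext => x; rewrite mulN1r addrC.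
have aeN (P : T -> Prop) : (forall x, ~ N x -> P x) -> {ae mu, forall x, P x}.
  by move=> h; exists N; split=> // x; apply: contra_notP; exact: h.
(* Setting the functions to 0 on the exceptional null set makes them converge everywhere on [D], so
   that the limit is measurable. *)
pose u n x := if x \in N then 0 else v n x.
have uv n x : ~ N x -> u n x = v n x by move=> Nx; rewrite /u memNset.
have mu_ n : measurable_fun D (u n).
  rewrite (_ : u n = (v n \_ (~` N))); last first.
    by apply/funext => x; rewrite /u patchE in_setC; case: (x \in N).
  apply/measurable_restrict => //; first exact: measurableC.
  by apply: measurable_funS (sv n).1.
have su n : sqint (u n).
  apply: (sqint_ae_le mD (mu_ n) (sv n)); apply: aeN => x Nx _; by rewrite uv.
pose w (x : T) : R := limn (fun n => u n x).
have uw x : D x -> u n x @[n --> \oo] --> w x.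
  move=> Dx; have [Nx|Nx] := pselect (N x).
    rewrite /w (_ : (fun n => u n x) = fun=> 0); last by apply/funext => n;
      rewrite /u mem_set.
    by rewrite lim_cst//; exact: cvg_cst.
  rewrite /w (_ : (fun n => u n x) = fun n => v n x).
    by apply: contrapT => nc; apply: Nx; apply: sN => /= h; exact/nc/h.
  by apply/funext => n; rewrite uv.
have mw : measurable_fun D w by apply: measurable_fun_cvg mu_ uw.
(* Fatou in [n] with [k] fixed. Each infimum over a tail is bounded by its term of index [n + k], to
   which the telescoped bound applies. *)
have fat k : (\int[mu]_(x in D) ((w x - u k x) ^+ 2)%:E
    <= ((c / 2 ^+ k * 2) ^+ 2)%:E)%E.
  pose f n x : \bar R := ((u n x - u k x) ^+ 2)%:E.
  have mf n : measurable_fun D (f n).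
    by apply/measurable_EFinP/measurable_funX/measurable_funB.
  have f0 n x : D x -> (0 <= f n x)%E by move=> _; rewrite lee_fin sqr_ge0.
  have := fatou mu mD mf f0.
  rewrite (eq_integral (fun x => ((w x - u k x) ^+ 2)%:E)); last first.
    move=> x /set_mem Dx; apply: (cvg_limn_einf_sup _).1.
    apply: cvg_EFin; first exact: nearW.
    have h : (fun n => u n x - u k x) @ \oo --> w x - u k x by exact: cvgB (uw x Dx)
      (cvg_cst _).
    exact: (cvgM h h).
  move=> /le_trans; apply; rewrite limn_einf_lim; apply: lime_le; first exact: is_cvg_einfs.
  apply: nearW => n; apply: le_trans (ereal_inf_lbound _) _.
    by exists (n + k)%N => //=; exact: leq_addr.
  have suk := sB _ _ (su (n + k)%N) (su k).
  rewrite /= -[leLHS]fineK; last exact: (integrable_fin_num mD suk.2).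
  rewrite lee_fin -[leLHS]l2norm_sq ler_pXn2r ?nnegrE ?l2norm_ge0//; last first.
    by rewrite mulr_ge0//; exact: le_trans (l2norm_ge0 _ _ _) (hv k).
  apply: le_trans (l2norm_sub_telescope sv hv k n).
  by apply: (l2norm_ae_le mD suk (sB _ _ (sv _) (sv _))); apply: aeN => x Nx _; rewrite !uv.
have swu k : sqint (fun x => w x - u k x).
  split; first exact: measurable_funB.
  apply/integrableP; split; first by apply/measurable_EFinP/measurable_funX/measurable_funB.
  rewrite (eq_integral (fun x => ((w x - u k x) ^+ 2)%:E)).
    by apply: le_lt_trans (fat k) _; rewrite ltry.
  by move=> x _; rewrite /= ger0_norm// sqr_ge0.
have sw : sqint w.
  have := sqintP mD 1 (swu 0%N) (su 0%N); congr sqint.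
  by apply/funext => x; rewrite mul1r subrK.
exists w => // k.
have c0 : 0 <= c / 2 ^+ k := le_trans (l2norm_ge0 _ _ _) (hv k).
apply: (@le_trans _ _ (l2norm (fun x => w x - u k x))).
  by apply: l2norm_ae_le (sB _ _ sw (sv k)) (swu k) _ => //; apply: aeN => x Nx _;
    rewrite uv.
have c20 : 0 <= c / 2 ^+ k * 2 by rewrite mulr_ge0.
rewrite -(@ler_pXn2r _ 2) ?nnegrE ?l2norm_ge0// l2norm_sq.
rewrite -lee_fin /Rintegral fineK ?fat//.
by have := integrable_fin_num mD (swu k).2.
Qed.
End square_integrable_complete.

(** * The space L^2(Omega) as a complete seminormed space *)

Section Lfun_sqint.
Context d (T : measurableType d) (R : realType) (mu : {measure set T -> \bar R}).
Variable D : set T.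
Hypothesis mD : measurable D.
Implicit Types f : T -> R.

Lemma sqr_restrict f x : ((f \_ D) x) ^+ 2 = ((fun y => f y ^+ 2) \_ D) x.
Proof. by rewrite !patchE; case: ifP => // _; rewrite expr0n. Qed.

Lemma Lnorm2_restrict f : ('N[mu]_2%:E[EFin \o (f \_ D)] =
  (\int[mu]_(x in D) (f x ^+ 2)%:E) `^ 2^-1)%E.
Proof.
rewrite unlock; congr poweR; rewrite [RHS]integral_mkcond; apply: eq_integral => x _.
rewrite /= powR_mulrn// real_normK ?num_real// sqr_restrict restrict_EFin//.
Qed.

Lemma sqint_Lfun f : sqint mu D f <-> (f \_ D) \in Lfun mu 2%:E.
Proof.
split=> [[mf fi]|].
  rewrite inE; apply/andP; split; rewrite inE /=.
    by apply/(measurable_restrictT _ mD).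
  rewrite /finite_norm Lnorm2_restrict poweR_lty//.
  by rewrite -ge0_fin_numE; [exact: integrable_fin_num|apply: integral_ge0 => x _;
    rewrite lee_fin sqr_ge0].
move=> h; move: (h); rewrite inE => /andP[]; rewrite inE /= => mf _; split.
  by apply/(measurable_restrictT _ mD).
have := Lfun2_integrable_sqr h.
rewrite (_ : EFin \o _ = (EFin \o (fun y => f y ^+ 2)) \_ D).
  by rewrite -integrable_mkcond.
by apply/funext => x; rewrite /= sqr_restrict restrict_EFin.
Qed.

Lemma l2norm_Lnorm f : sqint mu D f ->
  fine ('N[mu]_2%:E[EFin \o (f \_ D)])%E = l2norm mu D f.
Proof.
move=> [mf fi]; rewrite Lnorm2_restrict /l2norm /Rintegral.
rewrite -[X in (X `^ _)%E]fineK /=; last exact: (integrable_fin_num mD fi).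
rewrite powR12_sqrt// fine_ge0//; apply: integral_ge0 => x _; rewrite lee_fin sqr_ge0//.
Qed.

End Lfun_sqint.

Section L2_space.
Context {R : realType} {n : nat} (Omega : set 'rV[R]_n).
Local Notation E := 'rV[R]_n.
Hypothesis mO : measurable (Omega : set (lebT n)).
Hypothesis fO : (leb n Omega < +oo)%E.
Local Notation sq := (@sqint _ (lebT n) R (leb n) Omega).
Local Notation l2 := (@l2norm _ (lebT n) R (leb n) Omega).

Lemma L2_mem (f : E -> R) : fs_mem (L2 Omega) f <-> sq f.
Proof. by split=> h; apply/(sqint_Lfun _ mO). Qed.

Lemma L2_norm (f : E -> R) : sq f -> fs_norm (L2 Omega) f = l2 f.
Proof. by move=> sf; exact: (l2norm_Lnorm mO sf). Qed.

Lemma L2_seminormed : seminormed (L2 Omega).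
Proof.
have s0 : sq (fun=> 0).
  by split; [exact: measurable_cst|rewrite expr0n; exact: rint_cst].
split.
- exact/L2_mem.
- by move=> c v w /L2_mem sv /L2_mem sw; apply/L2_mem; exact: sqintP.
- move=> c v /L2_mem sv.
  have scv : sq (fun x => c * v x).
    by have := sqintP mO c sv s0; congr sqint; apply/funext => x; rewrite addr0.
  by rewrite !L2_norm//; exact: l2normZ.
- move=> v w /L2_mem sv /L2_mem sw.
  have svw : sq (fun x => v x + w x).
    by have := sqintP mO 1 sv sw; congr sqint; apply/funext => x; rewrite mul1r.
  by rewrite !L2_norm//; exact: l2norm_triangle.
Qed.

Lemma L2_complete : fs_complete (L2 Omega).
Proof.
move=> v c mv hv.
have sv k : sq (v k) by apply/L2_mem.
have sB f g : sq f -> sq g -> sq (f - g).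
  by move=> /L2_mem sf /L2_mem sg; apply/L2_mem; exact: (fs_memB L2_seminormed).
have [k|w sw hw] := @sqint_complete _ (lebT n) R (leb n) Omega mO fO v c sv.
  by apply: le_trans (hv k); rewrite L2_norm//; exact: sB.
exists w; first exact/L2_mem.
by move=> k; rewrite L2_norm; [exact: hw|exact: sB].
Qed.

End L2_space.

(** * Measurability of superpositions *)

Section complete_measure.
Context d (T : measurableType d) (R : realType) (mu : {measure set T -> \bar R}).
Hypothesis cmu : measure_is_complete mu.
Variable D : set T.
Implicit Types f g y : T -> R.

(** Off the exceptional null set the two sets coincide, and the part of [B] inside it is measurable
    by completeness. *)
Lemma ae_eq_measurable A B : measurable A ->
  {ae mu, forall x, A x <-> B x} -> measurable B.
Proof.
move=> mA [N [mN N0 sN]].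
have AB x : ~ N x -> (A x <-> B x) by move=> Nx; apply: contrapT => h; apply: Nx; exact: sN.
rewrite (_ : B = (A `\` N) `|` (B `&` N)).
  apply: measurableU; first exact: measurableD.
  by apply: cmu; exists N; split=> // x [].
apply/seteqP; split=> x.
  by move=> Bx; have [Nx|Nx] := pselect (N x); [right|left; split=> //; exact/AB].
by case=> [[Ax Nx]|[]//]; apply/(AB x Nx).
Qed.

Hypothesis mD : measurable D.

Lemma ae_eq_measurable_fun f g : measurable_fun D g ->
  {ae mu, forall x, D x -> f x = g x} -> measurable_fun D f.
Proof.
move=> mg fg _ B mB; apply: (ae_eq_measurable (mg mD B mB)).
by apply: filterS fg => x h /=; split=> -[Dx]; rewrite h//.
Qed.

Lemma ae_cvg_measurable_fun (h : nat -> T -> R) f :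
  (forall k, measurable_fun D (h k)) ->
  {ae mu, forall x, D x -> h ^~ x @ \oo --> f x} -> measurable_fun D f.
Proof.
move=> mh [N [mN N0 sN]].
apply: (@ae_eq_measurable_fun _ (f \_ (~` N))); last first.
  exists N; split=> // x /= /not_implyP[Dx]; apply: contra_notP => Nx.
  by rewrite patchE mem_set.
apply/measurable_restrict => //; first exact: measurableC.
apply: (@measurable_fun_cvg _ _ _ _ h).
  by move=> k; apply: measurable_funS (mh k).
by move=> x [Dx Nx]; apply: contrapT => nc; apply: Nx; apply: sN => /= /(_ Dx).
Qed.

(** Rounding [y] down to multiples of [1 / (k + 1)] leaves countably many values, so the
    superposition is glued from measurable sections [a ^~ t] on countably many measurable pieces.
    Continuity in the second variable passes to the limit a.e. *)
Lemma caratheodory_comp_measurable (a : T -> R -> R) y :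
  (forall t, measurable_fun D (a ^~ t)) ->
  {ae mu, forall x, D x -> continuous (a x)} -> measurable_fun D y ->
  measurable_fun D (fun x => a x (y x)).
Proof.
move=> ma ca my.
pose fl (k : nat) x : int := Num.floor (y x * k.+1%:R).
pose h k x := a x ((fl k x)%:~R / k.+1%:R).
apply: (@ae_cvg_measurable_fun h).
  move=> k _ B mB.
  rewrite (_ : _ `&` _ = \bigcup_(m : int) ((D `&` [set x | fl k x = m]) `&`
      (D `&` (a ^~ (m%:~R / k.+1%:R)) @^-1` B))); last first.
    apply/seteqP; split=> x; first by move=> [Dx hB]; exists (fl k x).
    by move=> [m _ [[Dx /= <-] [_ hB]]].
  apply: countable_bigcupT_measurable => // m.
  apply: measurableI; last exact: ma.
  rewrite (_ : [set x | _] = (fun x => y x * k.+1%:R) @^-1` `[m%:~R, (m + 1)%:~R[%classic).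
    have myk : measurable_fun D (fun x => y x * k.+1%:R) by exact: measurable_funM.
    by apply: myk => //; exact: measurable_itv.
  apply/seteqP; split=> x /=; rewrite in_itv /=.
    by rewrite /fl => <-; exact: floor_itv.
  by move=> /floor_def.
apply: filterS ca => x /[apply] cx.
have : (fun k => (fl k x)%:~R / k.+1%:R) @ \oo --> y x.
  apply/cvgrPdist_le => e e0; near=> k.
  have /andP[h1 h2] := floor_itv (y x * k.+1%:R).
  have k0 : 0 < k.+1%:R :> R by rewrite ltr0n.
  rewrite -[X in X - _](@mulfK _ k.+1%:R) ?gt_eqF// -mulrBl normrM.
  rewrite [X in _ * X]gtr0_norm ?invr_gt0// ger0_norm ?subr_ge0//.
  apply: (@le_trans _ _ (1 / k.+1%:R)).
    by apply: ler_wpM2r; [rewrite invr_ge0 ltW|rewrite lerBlDl -intrD1 ltW].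
  rewrite div1r ltW//; near: k; exact: (near_infty_natSinv_lt (PosNum e0)).
by move=> hk; exact: (cvg_comp _ _ hk (cx (y x))).
Unshelve. all: by end_near.
Qed.

End complete_measure.

(** * Mean value and Taylor estimates on the line *)

Section mean_value.
Context {R : realType}.
Implicit Types (f : R -> R) (r s t C : R).

Lemma deriv_bound_lipschitz f r s C : (forall t, derivable (f : R^o -> R^o) t 1) ->
  (forall t, Num.min r s <= t <= Num.max r s -> `|derive1 f t| <= C) ->
  `|f s - f r| <= C * `|s - r|.
Proof.
move=> df; wlog rs : r s / r <= s => [hw|].
  case/orP: (le_total r s) => [/hw//|sr].
  by move=> h; rewrite distrC [`|s - r|]distrC; apply: hw => // t; rewrite minC maxC;
    exact: h.
rewrite min_l// max_r// => h.
have [| |c ct ->] := @MVT_segment R f (derive1 f) r s rs.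
- by move=> x _; split => //; rewrite derive1E.
- apply: derivable_within_continuous => t _; exact: df.
by rewrite normrM ler_wpM2r//; apply: h; move: ct; rewrite in_itv.
Qed.

(** The mean value bound is used twice: for [f'] and then for [f t - f' r * t], whose derivative is
    [f' t - f' r]. This costs the factor 1/2 of the sharp constant, which is immaterial. *)
Lemma taylor2_bound f r s C : (forall t, derivable (f : R^o -> R^o) t 1) ->
  (forall t, derivable (derive1 f : R^o -> R^o) t 1) ->
  (forall t, Num.min r s <= t <= Num.max r s -> `|derive1 (derive1 f) t| <= C) ->
  `|f s - f r - derive1 f r * (s - r)| <= C * `|s - r| ^+ 2.
Proof.
move=> df ddf h.
pose g (t : R) : R := f t - derive1 f r * t.
have dg t : is_derive t (1 : R^o) (g : R^o -> R^o) (derive1 f t - derive1 f r).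
  have -> : derive1 f t - derive1 f r = derive1 f t - derive1 f r *: (1 : R^o)
    by rewrite /GRing.scale /= mulr1.
  have h1 : is_derive t (1 : R^o) (f : R^o -> R^o) (derive1 f t) by split=> //;
    rewrite derive1E.
  exact: is_deriveB.
have -> : f s - f r - derive1 f r * (s - r) = g s - g r by rewrite /g; ring.
rewrite expr2 mulrA; apply: deriv_bound_lipschitz => [t|t /andP[t1 t2]].
  by case: (dg t).
rewrite derive1E derive_val.
have tr : `|t - r| <= `|s - r|.
  by move: t1 t2; rewrite minElt maxElt; case: ltP => rs t1 t2;
    [rewrite !ger0_norm ?subr_ge0 ?(ltW rs)// lerB|rewrite !ler0_norm ?subr_le0// !opprB lerB].
apply: le_trans (deriv_bound_lipschitz ddf _) (ler_wpM2l _ tr).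
  move=> t' /andP[t1' t2']; apply: h; apply/andP; split.
    by apply: le_trans t1'; rewrite le_min ge_min lexx /=.
  by apply: le_trans t2' _; rewrite ge_max le_max lexx.
by apply: le_trans (h r _); rewrite // ge_min le_max lexx.
Qed.

End mean_value.

(** * Measurability and finite measure of the domain *)

Section lebesgue_measure_of_domain.
Context {R : realType} {n : nat}.
Implicit Types Omega : set 'rV[R]_n.

#[local] Instance leb_ae_filter : Filter (nbhs (almost_everywhere (@leb R n))).
Proof. exact: (@ae_filter_ringOfSetsType _ _ _ (leb n)). Qed.

Lemma leb_aeS (P Q : 'rV[R]_n -> Prop) : (forall x, P x -> Q x) ->
  {ae leb n, forall x, P x} -> {ae leb n, forall x, Q x}.
Proof. by move=> PQ; apply: filterS => x; exact: PQ. Qed.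

Lemma ae_inW Omega (P Q : 'rV[R]_n -> Prop) :
  (forall x, Omega x -> P x -> Q x) -> ae_in Omega P -> ae_in Omega Q.
Proof. by move=> PQ; apply: leb_aeS => x + Ox => /(_ Ox); exact: PQ. Qed.

Lemma ae_inI Omega (P Q : 'rV[R]_n -> Prop) : ae_in Omega P -> ae_in Omega Q ->
  ae_in Omega (fun x => P x /\ Q x).
Proof.
by rewrite /ae_in => P_ Q_; apply: filterS2 P_ Q_ => x p q Ox; split; [exact: p|exact: q].
Qed.

Lemma ae_in_all Omega (P : 'rV[R]_n -> Prop) :
  (forall x, Omega x -> P x) -> ae_in Omega P.
Proof. by move=> h; apply: nearW. Qed.

Lemma leb_complete : measure_is_complete (leb n : set (lebT n) -> \bar R).
Proof. exact: measure_is_complete_caratheodory. Qed.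

Lemma leb_bounded_lty Omega : bounded_set Omega -> (leb n Omega < +oo)%E.
Proof.
move=> [M [_ /(_ (M + 1))]]; rewrite ltrDl ltr01 => /(_ isT) hM.
pose b : 'rV[R]_n := const_mx (M + 1).
have Ob : Omega `<=` box (- b) b.
  move=> x /hM xM i; rewrite !mxE -ler_norml.
  by apply: le_trans xM; rewrite /Num.norm /= mx_normrE;
    exact: (le_bigmax _ (fun ij => `|x ij.1 ij.2|) (0, i)).
apply: (@le_lt_trans _ _ (leb n (box (- b) b))); first exact: le_outer_measure.
(* A single box padded with empty sets, which [cover_weight] gives weight 0. *)
pose F (k : nat) : set 'rV[R]_n := if k is 0%N then box (- b) b else set0.
have h1 : (leb n (box (- b) b) <= \sum_(k <oo) cover_weight (@box_weight R n) (F k))%E.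
  apply: ereal_inf_lbound; exists F => //; split.
    by move=> k; exact: sub_sigma_algebra.
  by move=> x bx; exists 0%N.
apply: le_lt_trans h1 _.
rewrite nneseries_recl//; last by move=> k _;
  exact: (cover_weight_ge0 (@box_weight_ge0 R n)).
rewrite [X in (_ + X)%E]eseries0 ?adde0; last first.
  by move=> [//|i] _ _; rewrite cover_weight0.
rewrite /cover_weight; case: asboolP => // _.
apply: (@le_lt_trans _ _ (\prod_i `|b 0 i - (- b) 0 i|)%:E); last by rewrite ltry.
by apply: ereal_inf_lbound; exists (- b), b.
Qed.

(* Ellipticity makes [aij i i], extended by 0, positive a.e. on [Omega] and zero outside. *)
Lemma elliptic_measurable Omega aij M_A Lam_A : (0 < n)%N ->
  elliptic Omega aij M_A Lam_A -> measurable (Omega : set (lebT n)).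
Proof.
move=> n0 [MA0 L0 aL ell].
pose i0 := Ordinal n0.
have : measurable_fun setT (aij i0 i0 \_ Omega : lebT n -> R).
  by have := aL i0 i0; rewrite /in_Lp inE => /andP[]; rewrite inE.
move=> /(_ measurableT [set r | 0 < r]) /(_ _).
rewrite setTI => mA.
apply: (ae_eq_measurable leb_complete (mA _)).
  by rewrite -set_itvoy; exact: measurable_itv.
apply: leb_aeS ell => x ell; split.
  by rewrite /= patchE; case: ifP => [/set_mem//|]; rewrite ltxx.
move=> Ox; rewrite /= patchE mem_set//.
(* For a coordinate vector the quadratic form reduces to the diagonal entry. *)
have [] := ell Ox (delta_mx 0 i0).
rewrite (bigD1 i0)//= (bigD1 i0)//= !mxE !eqxx !mulr1.
rewrite big1 ?addr0; last by move=> j /negbTE ji; rewrite !mxE ji mulr0.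
rewrite [X in _ + X]big1 ?addr0; last first.
  by move=> i /negbTE ii; apply: big1 => j _; rewrite !mxE ii mulr0 mul0r.
move=> + _; apply: lt_le_trans.
rewrite mulr_gt0// exprn_gt0// sqrtr_gt0 /dotv (bigD1 i0)//= !mxE !eqxx mulr1.
by rewrite ltr_pwDl// sumr_ge0// => j _; rewrite -expr2 sqr_ge0.
Qed.

End lebesgue_measure_of_domain.

(** * Compactness of bounded sets of Hoelder functions *)

Section hoelder_functions.
Context {R : realType} {n : nat} (Omega : set 'rV[R]_n) (mu : R).
Hypothesis mu0 : 0 < mu.
Hypothesis O0 : Omega !=set0.
Implicit Types (y z : 'rV[R]_n -> R).

Lemma enorm_gt0 (x : 'rV[R]_n) : x != 0 -> 0 < enorm x.
Proof.
move=> x0; rewrite sqrtr_gt0 lt_def sumr_ge0 ?andbT; last by move=> i _;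
  rewrite -expr2 sqr_ge0.
apply: contra_neq x0 => /eqP; rewrite psumr_eq0; last by move=> i _; rewrite -expr2 sqr_ge0.
move=> /allP h; apply/rowP => i; have := h i (mem_index_enum _).
by rewrite mulf_eq0 orbb mxE => /eqP.
Qed.

Lemma enorm_le_norm (x : 'rV[R]_n) : enorm x <= n%:R * `|x|.
Proof.
have xi i : `|x 0 i| <= `|x|.
  by rewrite [leRHS]/Num.norm /= mx_normrE;
    exact: (le_bigmax _ (fun ij => `|x ij.1 ij.2|) (0, i)).
apply: (@le_trans _ _ (Num.sqrt (\sum_(i < n) `|x| ^+ 2))).
  apply: ler_wsqrtr; apply: ler_sum => i _; rewrite -expr2 -real_normK ?num_real//.
  by rewrite ler_pXn2r ?nnegrE.
rewrite sumr_const card_ord -[X in Num.sqrt X]mulr_natl sqrtrM// sqrtr_sqr normr_id ler_wpM2r//.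
rewrite -[leRHS]ger0_norm// -sqrtr_sqr; apply: ler_wsqrtr.
by rewrite -natrX ler_nat; case: (n) => // m; rewrite expnS leq_pmulr.
Qed.

(** A real [sup] bounds its set only when that set is nonempty and bounded above. Nonemptiness of
    [Omega] settles the first term; the set of quotients may be empty, in which case its [sup] is
    0. *)
Lemma hoelder_norm_terms y : in_hoelder Omega mu y ->
  [/\ 0 <= sup [set `|y x| | x in closure Omega],
      forall x, closure Omega x -> `|y x| <= sup [set `|y x| | x in closure Omega],
      0 <= sup [set r | exists x x', [/\ closure Omega x, closure Omega x', x != x' &
                                r = `|y x - y x'| / enorm (x - x') `^ mu]] &
      forall x x', closure Omega x -> closure Omega x' -> x != x' ->
       `|y x - y x'| / enorm (x - x') `^ mu <=
       sup [set r | exists x x', [/\ closure Omega x, closure Omega x', x != x' &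
                                r = `|y x - y x'| / enorm (x - x') `^ mu]]].
Proof.
move=> [C hC]; set S1 := [set `|y x| | x in _]; set S2 := [set r | _].
have ub1 : has_ubound S1 by exists C => _ [x cx <-]; case: (hC x x cx cx).
have ub2 : has_ubound S2.
  exists C => _ [x [x' [cx cx' xx' ->]]]; have [_ h] := hC x x' cx cx'.
  by rewrite ler_pdivrMr// powR_gt0// enorm_gt0// subr_eq0.
have [x0 Ox0] := O0; have cx0 := subset_closure Ox0.
have h1 x : closure Omega x -> `|y x| <= sup S1.
  by move=> cx; apply: ub_le_sup => //; exists x.
have h2 x x' : closure Omega x -> closure Omega x' -> x != x' ->
    `|y x - y x'| / enorm (x - x') `^ mu <= sup S2.
  by move=> cx cx' xx'; apply: ub_le_sup => //; exists x, x'.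
split=> //; first exact: le_trans (h1 _ cx0).
have [[r [x [x' [cx cx' xx' e]]]]|] := pselect (S2 !=set0).
  by apply: le_trans (h2 x x' cx cx' xx'); rewrite divr_ge0// powR_ge0.
by move/nonemptyPn ->; rewrite sup0.
Qed.

Lemma hoelder_norm_sup y x : in_hoelder Omega mu y -> closure Omega x ->
  `|y x| <= hoelder_norm Omega mu y.
Proof.
move=> /hoelder_norm_terms[_ h1 s0 _] cx; rewrite /hoelder_norm.
by apply: le_trans (h1 _ cx) _; rewrite lerDl.
Qed.

Lemma hoelder_norm_lip y x x' : in_hoelder Omega mu y ->
  closure Omega x -> closure Omega x' ->
  `|y x - y x'| <= hoelder_norm Omega mu y * enorm (x - x') `^ mu.
Proof.
move=> /hoelder_norm_terms[s0 _ s2 h2] cx cx'.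
have [->|xx'] := eqVneq x x'.
  by rewrite subrr normr0 mulr_ge0 ?powR_ge0//; exact: addr_ge0.
rewrite -ler_pdivrMr ?powR_gt0 ?enorm_gt0 ?subr_eq0//.
by apply: le_trans (h2 _ _ cx cx' xx') _; rewrite lerDr.
Qed.

Lemma hoelder_norm_ge0 y : in_hoelder Omega mu y -> 0 <= hoelder_norm Omega mu y.
Proof. by move=> /hoelder_norm_terms[s1 _ s2 _]; exact: addr_ge0. Qed.

Lemma in_hoelder_lin c y z : in_hoelder Omega mu y -> in_hoelder Omega mu z ->
  in_hoelder Omega mu (fun x => c * y x + z x).
Proof.
move=> [C hC] [C' hC']; exists (`|c| * C + C') => x x' cx cx'.
have [h1 h2] := hC x x' cx cx'; have [h1' h2'] := hC' x x' cx cx'; split.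
  apply: le_trans (ler_normD _ _) _; rewrite normrM; apply: lerD => //.
  exact: ler_wpM2l.
have -> : c * y x + z x - (c * y x' + z x') = c * (y x - y x') + (z x - z x') by ring.
apply: le_trans (ler_normD _ _) _; rewrite normrM mulrDl; apply: lerD => //.
by rewrite -mulrA; apply: ler_wpM2l.
Qed.

Lemma H1C_norm_hoelder y : hoelder_norm Omega mu y <= fs_norm (H1C Omega mu) y.
Proof. by rewrite /= lerDr sqrtr_ge0. Qed.

Lemma H1C_norm_sup y x : in_hoelder Omega mu y -> closure Omega x ->
  `|y x| <= fs_norm (H1C Omega mu) y.
Proof. by move=> hy cx; exact: le_trans (hoelder_norm_sup hy cx) (H1C_norm_hoelder _). Qed.

Lemma compact_closure : bounded_set Omega -> compact (closure Omega).
Proof.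
move=> [M [_ /(_ (M + 1))]]; rewrite ltrDl ltr01 => /(_ isT) hM.
apply: bounded_closed_compact; last exact: closed_closure.
exists (M + 1 + 1); split; first exact: num_real.
move=> N MN x /= cx; have [z [Oz xz]] := cx _ (nbhsx_ballx x 1 ltr01).
apply: le_trans (ltW MN); rewrite -(subrK z x); apply: le_trans (ler_normD _ _) _.
rewrite addrC; apply: lerD; first exact: hM.
by move: xz; rewrite -ball_normE => /ltW.
Qed.

(** Arzela-Ascoli along an ultrafilter. The pointwise limits along [F] define [g], which inherits
    the Hoelder bound; equicontinuity and compactness of the closure upgrade the convergence to a
    uniform one. *)
Lemma hoelder_compact (f : nat -> 'rV[R]_n -> R) (B : R) (F : set_system nat) :
  bounded_set Omega -> UltraFilter F ->
  (forall k x, closure Omega x -> `|f k x| <= B) ->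
  (forall k x x', closure Omega x -> closure Omega x' ->
     `|f k x - f k x'| <= B * enorm (x - x') `^ mu) ->
  exists2 g, forall x, closure Omega x -> `|g x| <= B &
    forall e, 0 < e -> F [set k | forall x, closure Omega x -> `|f k x - g x| <= e].
Proof.
move=> /compact_closure cO UF fB fL.
have /choice[g hg] : forall x, exists l, closure Omega x -> `|l| <= B /\
    forall e, 0 < e -> F [set k | `|f k x - l| < e].
  move=> x; have [cx|ncx] := pselect (closure Omega x); last by exists 0.
  have [|l lB lF] := @ultra_lim R F (fun k => f k x) (- B) B UF.
    by move=> k; rewrite -ler_norml; exact: fB.
  by exists l => _; split=> //; rewrite ler_norml.
have [x0 /subset_closure cx0] := O0.
have B0 : 0 <= B by apply: le_trans (fB 0%N _ cx0).
exists g => [x /hg[]//|e e0].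
have gL x x' : closure Omega x -> closure Omega x' ->
    `|g x - g x'| <= B * enorm (x - x') `^ mu.
  move=> cx cx'; have [[_ gx] [_ gx']] := (hg _ cx, hg _ cx').
  rewrite -subr_le0; apply: (@le0_of_le_eps _ _ 2) => s s0.
  have [k [/= k1 k2]] := filter_ex (filterI (gx s s0) (gx' s s0)).
  have := fL k x x' cx cx'.
  have -> : g x - g x' = (f k x - f k x') - (f k x - g x) + (f k x' - g x') by ring.
  have := ler_normD ((f k x - f k x') - (f k x - g x)) (f k x' - g x').
  have := ler_normB (f k x - f k x') (f k x - g x); lra.
(* Otherwise points [u k] violating the bound converge along [F] to some [p], and
   [f k p] tends to [g p]. *)
apply: contrapT => nF.
have {}nF : F (~` [set k | forall x, closure Omega x -> `|f k x - g x| <= e]).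
  by case: (in_ultra_setVsetC [set k | forall x, closure Omega x -> `|f k x - g x|
    <= e] UF).
have /choice[u hu] : forall k, exists x, closure Omega x /\
    (~ (forall x, closure Omega x -> `|f k x - g x| <= e) -> e < `|f k x - g x|).
  move=> k; have [h|/existsNP[x /not_implyP[cx /negP]]] :=
    pselect (forall x, closure Omega x -> `|f k x - g x| <= e); first by exists x0.
  by rewrite -ltNge => h; exists x.
have [p cp pF] := ultra_compact_cvg cO UF (fun k => (hu k).1).
have [_ gp] := hg _ cp.
(* Three errors of size [e / 3]: two Hoelder increments, at most [B * s] each, and the convergence
   at [p]. The radius [s ^ (1/mu)] below is where the modulus equals [s]; the summand 1 allows
   [B = 0]. *)
pose s := e / (3 * (B + 1)).
have B1 : 0 < B + 1 by lra.
have s0 : 0 < s by rewrite divr_gt0// mulr_gt0.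
pose r := s `^ mu^-1.
have r0 : 0 < r by rewrite powR_gt0.
have Bs : B * s <= e / 3.
  have -> : B * s = e / 3 * (B / (B + 1)) by rewrite /s; field; rewrite gt_eqF.
  by rewrite ler_piMr ?divr_ge0 ?(ltW e0)// ler_pdivrMr// mul1r lerDl.
have n1 : 0 < n.+1%:R :> R by rewrite ltr0n.
have near_p : F [set k | enorm (u k - p) `^ mu <= s].
  have := pF _ (nbhsx_ballx p (r / n.+1%:R) (divr_gt0 r0 n1)).
  apply: filterS => k; rewrite /= -ball_normE /= distrC ltr_pdivlMr// => h.
  have h1 : enorm (u k - p) <= r.
    apply: le_trans (enorm_le_norm _) _; apply: le_trans (ltW h).
    by rewrite mulrC ler_wpM2l// ler_nat.
  have -> : s = r `^ mu by rewrite -powRrM mulVf ?gt_eqF// powRr1// ltW.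
  by apply: ge0_ler_powR; rewrite ?nnegrE ?sqrtr_ge0// ltW.
have e3 : 0 < e / 3 by rewrite divr_gt0.
have [k [[/= k1 k2] /(hu k).2 k3]] := filter_ex (filterI (filterI near_p (gp _ e3)) nF).
have [cu _] := hu k.
have h1 := le_trans (fL k _ _ cu cp) (ler_wpM2l B0 k1).
have h2 := le_trans (gL _ _ cu cp) (ler_wpM2l B0 k1).
move: k3; apply/negP; rewrite -leNgt.
have -> : f k (u k) - g (u k) = (f k (u k) - f k p) - (g (u k) - g p) + (f k p - g p)
  by ring.
have := ler_normD ((f k (u k) - f k p) - (g (u k) - g p)) (f k p - g p).
have := ler_normB (f k (u k) - f k p) (g (u k) - g p); lra.
Qed.

End hoelder_functions.

(** * Integrands of class C^2 *)

Section integrands.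
Context {R : realType} {n : nat} (Omega : set 'rV[R]_n).
Local Notation E := 'rV[R]_n.
Hypothesis mO : measurable (Omega : set (lebT n)).
Hypothesis fO : (leb n Omega < +oo)%E.
Local Notation rint := (@rintegrable _ (lebT n) R (leb n) Omega).
Local Notation meas f := (measurable_fun (Omega : set (lebT n)) (f : lebT n -> R)).

Lemma in_Lp_rint (p : \bar R) (f : E -> R) : (1 <= p)%E -> in_Lp Omega p f ->
  rint f.
Proof.
move=> p1 fp.
have mf : meas f.
  apply/(measurable_restrictT _ mO).
  by move: fp; rewrite /in_Lp inE => /andP[]; rewrite inE.
case: p p1 fp => [p| |//]; last first.
  move=> _; rewrite /in_Lp inE => /andP[_]; rewrite inE /= /finite_norm unlock.
  case: ifPn => [_|].
    set N := ess_sup _ _ => Nfin.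
    have := @ess_sup_ge _ (lebT n) R (leb n) (abse \o (EFin \o (f \_ Omega))).
    rewrite -/N => hN.
    apply: (@rint_bounded _ (lebT n) R (leb n) Omega mO fO f (fine N) mf).
    apply: leb_aeS hN => x /= h Ox.
    move: h; rewrite patchE mem_set// => h.
    have Nf : N \is a fin_num by rewrite ge0_fin_numE//; exact: le_trans h.
    by rewrite -lee_fin fineK.
  (* The norm with exponent infinity is an essential supremum only when the whole space has positive
     measure; in the other case [Omega] is null. *)
  rewrite -leNgt => T0 _.
  have O0 : leb n Omega = 0%E.
    by apply/eqP; rewrite eq_le measure_ge0 andbT; apply: le_trans T0;
      exact: le_outer_measure.
  apply: (null_set_integrable mO) => //; exact/measurable_EFinP.
rewrite lee_fin => p1 /(Lfun_integrable p1) ip.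
have ip' : rint (fun x => `|f x| `^ p).
  have := integrableS measurableT mO (@subsetT _ _) ip.
  by apply: eq_integrable => // x /set_mem Ox; rewrite /= patchE mem_set.
apply: (@rint_le _ (lebT n) R (leb n) Omega mO f (fun x => 1 + `|f x| `^ p) mf).
  by apply: rintD => //; exact: rint_cst.
move=> x _; have [f1|f1] := leP `|f x| 1; first by rewrite (le_trans f1)// lerDl powR_ge0.
by rewrite (le_trans (le1r_powR (ltW f1) p1))// lerDr.
Qed.

(** What the nonlinearity and the cost integrand have in common: the first derivative has a constant
    majorant for one and an L^p majorant for the other, both integrable on [Omega]. *)
Definition C2_integrand (a : E -> R -> R) : Prop :=
  [/\ caratheodory_C2 Omega a, rint (a ^~ 0),
      forall M, 0 < M -> exists2 LM, rint LM & ae_in Omega (fun x =>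
        forall t, `|t| <= M -> `|dy a x t| <= LM x) &
      forall M, 0 < M -> exists C, ae_in Omega (fun x =>
        forall t, `|t| <= M -> `|d2y a x t| <= C)].

Lemma nonlinearity_C2_integrand p a0 a : (1 <= p)%E -> nonlinearity Omega p a0 a ->
  C2_integrand a.
Proof.
move=> p1 [Ca ap _ bd _]; split=> // [|M /bd[C hC]|M /bd[C hC]].
- exact: in_Lp_rint ap.
- exists (fun=> C); first exact: rint_cst.
  by apply: ae_inW hC => x _ h t /h; apply: le_trans; rewrite lerDl.
- exists C; apply: ae_inW hC => x _ h t /h; apply: le_trans; rewrite lerDr//.
Qed.

Lemma cost_C2_integrand p L : (1 <= p)%E -> cost_integrand Omega p L ->
  C2_integrand L.
Proof.
move=> p1 [CL L0 bd bd2 _]; split=> // [|M /bd[LM hLM ae]].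
  exact: in_Lp_rint L0.
by exists LM => //; exact: in_Lp_rint hLM.
Qed.

Variable a : E -> R -> R.
Hypothesis ha : C2_integrand a.
Implicit Types y : E -> R.

Lemma C2_integrand_meas y : meas y -> meas (fun x => a x (y x)).
Proof.
case: ha => -[ma da _ _] _ _ _ my.
apply: (@caratheodory_comp_measurable _ (lebT n) R (leb n)
  (@leb_complete R n) Omega mO a y) => //.
apply: ae_inW da => x _ dax t; apply: differentiable_continuous.
exact/derivable1_diffP.
Qed.

(** The derivative is the a.e. limit of difference quotients with steps [1 / (k + 1)], each of which
    is a difference of measurable superpositions. *)
Lemma C2_integrand_dy_meas y : meas y -> meas (fun x => dy a x (y x)).
Proof.
case: (ha) => -[_ da _ _] _ _ _ my.
pose h (k : nat) x := k.+1%:R * (a x (k.+1%:R^-1 + y x) - a x (y x)).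
apply: (@ae_cvg_measurable_fun _ (lebT n) R (leb n) (@leb_complete R n) Omega mO h).
  move=> k; apply: (measurable_funM (measurable_cst _)).
  apply: (measurable_funB _ (C2_integrand_meas my)).
  exact: (C2_integrand_meas (measurable_funD (measurable_cst _) my)).
apply: ae_inW da => x _ dax.
have dx : (fun r : R => r^-1 * (a x (r + y x) - a x (y x))) @ 0^' --> dy a x (y x).
  have := dax (y x); rewrite /derivable /dy /derive1.
  by under eq_fun do rewrite /GRing.scale /= mulr1.
have inv0 : (fun k : nat => k.+1%:R^-1 : R) @ \oo --> (0 : R)^'.
  move=> U U0.
  have : \forall k \near \oo, (@harmonic R k != 0 -> U (@harmonic R k)).
    exact: (@cvg_harmonic R _ U0).
  have hn k : @harmonic R k != 0 by rewrite invr_eq0 pnatr_eq0.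
  move=> h0; rewrite /= nbhs_filterE /=.
  by apply: (filterS _ h0) => k /(_ (hn k)).
have := cvg_comp _ _ inv0 dx.
rewrite (_ : _ \o _ = h ^~ x)//.
by apply/funext => k; rewrite /h /= invrK.
Qed.

Lemma C2_integrand_dy_bound y M : 0 < M -> (forall x, Omega x -> `|y x| <= M) ->
  exists2 LM, rint LM & ae_in Omega (fun x => `|dy a x (y x)| <= LM x).
Proof.
move=> M0 yM; have [_ _ /(_ _ M0)[LM hLM ae] _] := ha.
by exists LM => //; apply: ae_inW ae => x Ox h; exact: h (yM _ Ox).
Qed.

Lemma C2_integrand_dy_rint y M : 0 < M -> meas y ->
  (forall x, Omega x -> `|y x| <= M) -> rint (fun x => dy a x (y x)).
Proof.
move=> M0 my yM; have [LM iLM ae] := C2_integrand_dy_bound M0 yM.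
exact: (rint_ae_le mO (C2_integrand_dy_meas my) iLM ae).
Qed.

Lemma C2_integrand_rint y M : 0 < M -> meas y ->
  (forall x, Omega x -> `|y x| <= M) -> rint (fun x => a x (y x)).
Proof.
move=> M0 my yM; have [Ca a0 /(_ _ M0)[LM iLM ae] _] := ha.
have i1 : rint (fun x => `|a x 0|) by exact: integrable_norm a0.
apply: (rint_ae_le mO (C2_integrand_meas my) (rintD mO i1 (rintZ mO M iLM))).
have [_ da _ _] := Ca.
apply: ae_inW (ae_inI ae da) => x Ox [aex dax].
have : `|a x (y x) - a x 0| <= LM x * `|y x - 0|.
  apply: (deriv_bound_lipschitz dax) => t /andP[t1 t2]; apply: aex.
  have := yM _ Ox; rewrite !ler_norml => /andP[y1 y2].
  move: t1 t2; rewrite ge_min le_max => /orP[] t1 /orP[] t2; apply/andP; split; lra.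
rewrite subr0 => h; rewrite -(subrK (a x 0) (a x (y x))).
apply: le_trans (ler_normD _ _) _; rewrite addrC lerD2l.
apply: le_trans h _; rewrite mulrC ler_wpM2r ?yM//.
by apply: le_trans (aex 0 _); rewrite ?normr0 ?(ltW M0)//.
Qed.

Lemma C2_integrand_taylor M : 0 < M -> exists2 C, 0 <= C & forall y y',
  (forall x, Omega x -> `|y x| <= M) -> (forall x, Omega x -> `|y' x| <= M) ->
  ae_in Omega (fun x => `|a x (y' x) - a x (y x) - dy a x (y x) * (y' x - y x)|
    <= C * `|y' x - y x| ^+ 2).
Proof.
move=> M0; have [[_ da dda _] _ _ /(_ _ M0)[C aeC]] := ha.
exists `|C| => // y y' yM y'M.
apply: ae_inW (ae_inI aeC (ae_inI da dda)) => x Ox [hC [dax ddax]].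
apply: (taylor2_bound dax ddax) => t /andP[t1 t2].
apply: le_trans (ler_norm C); apply: hC.
have := yM _ Ox; have := y'M _ Ox; rewrite !ler_norml => /andP[y1 y2] /andP[y3 y4].
by move: t1 t2; rewrite ge_min le_max => /orP[] t1 /orP[] t2; apply/andP; split; lra.
Qed.

End integrands.

(** * Stability of the cut-off *)

Lemma lt_perturb (R : realType) (c s s' r : R) :
  `|s' - s| <= r -> r < `|s - c| ->
  (c < s') = (c < s) /\ (s' < c) = (s < c).
Proof.
rewrite ler_norml ltr_normr => /andP[h1 h2] /orP[] h3; split; apply/idP/idP => h; lra.
Qed.

Section cut_off.
Context {R : realType} {n : nat} (Omega : set 'rV[R]_n).
Local Notation E := 'rV[R]_n.
Hypothesis mO : measurable (Omega : set (lebT n)).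
Hypothesis fO : (leb n Omega < +oo)%E.
Local Notation meas f := (measurable_fun (Omega : set (lebT n)) (f : lebT n -> R)).
Local Notation sq := (@sqint _ (lebT n) R (leb n) Omega).
Local Notation l2 := (@l2norm _ (lebT n) R (leb n) Omega).
Local Notation Int := (integral_in Omega).

Variables (alpha : R) (beta : \bar R).

(** The cut-off [hcut] as a function of the value of [y phi / nu] alone. *)
Definition cut (r : R) : R := if (alpha%:E < r%:E < beta)%E then 1 else 0.

Lemma cut01 r : `|cut r| <= 1.
Proof. by rewrite /cut; case: ifP; rewrite ?normr1 ?normr0. Qed.

Lemma measurable_cut (s : E -> R) : meas s -> meas (fun x => cut (s x)).
Proof.
move=> ms; pose C := [set r : R | (alpha%:E < r%:E < beta)%E].
have mC : measurable C.
  rewrite (_ : C = EFin @^-1` `]alpha%:E, beta[%classic).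
    have mE : measurable_fun [set: R] (EFin \o (@idfun R)) by apply/measurable_EFinP;
      exact: measurable_id.
    by have := mE measurableT _ (emeasurable_itv `]alpha%:E, beta[); rewrite setTI.
  by apply/seteqP; split=> r /=; rewrite in_itv.
rewrite (_ : (fun x => _) = (\1_C : R -> R) \o s).
  apply: (measurableT_comp _ ms); exact: measurable_indic.
apply/funext => x; rewrite /= indicE /cut; case: ifPn => h; first by rewrite mem_set.
by rewrite memNset//; exact/negP.
Qed.

Lemma measurable_level_band (s : E -> R) c rho : meas s ->
  measurable (Omega `&` [set x | `|s x - c| <= rho] : set (lebT n)).
Proof.
move=> ms; have := measurable_funB ms (@measurable_cst _ _ (lebT n) R Omega c).
move=> /(measurableT_comp (@normr_measurable R setT)) h.
have := h mO `]-oo, rho]%classic (measurable_itv _).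
by congr measurable; apply/seteqP; split=> x /= [Ox]; rewrite in_itv.
Qed.

(** The bands around the level decrease to the level set, and a finite measure is continuous from
    above. *)
Lemma level_set_small (s : E -> R) c : meas s ->
  leb n (Omega `&` [set x | s x = c]) = 0%E ->
  forall e : R, 0 < e -> exists2 rho : R, 0 < rho &
    (leb n (Omega `&` [set x | (`|s x - c| <= rho)%R]) <= e%:E)%E.
Proof.
move=> ms s0 e e0.
pose F (k : nat) : set (lebT n) := Omega `&` [set x | `|s x - c| <= k.+1%:R^-1].
have mF k : measurable (F k) by exact: measurable_level_band.
have FI : \bigcap_k F k = Omega `&` [set x | s x = c].
  apply/seteqP; split=> x.
    move=> Fx; split; first by case: (Fx 0%N I).
    apply/eqP; rewrite -subr_eq0 -normr_le0; apply/ler_addgt0Pr => d d0.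
    have [k hk] : exists k : nat, k.+1%:R^-1 < d.
      by have [k _ hk] := near_infty_natSinv_lt (PosNum d0); exists k;
        exact: (hk k (leqnn k)).
    by rewrite add0r; case: (Fx k I) => _ /le_trans; apply; exact: ltW.
  by move=> [Ox /= sx] k _; split=> //=; rewrite sx subrr normr0 invr_ge0.
have mI : measurable (\bigcap_k F k) by exact: bigcap_measurableType.
have nF : nonincreasing_seq F.
  move=> i j ij; apply/subsetPset => x [Ox] h; split=> //.
  by apply: le_trans h _; rewrite lef_pV2 ?posrE ?ltr0n// ler_nat.
have F0 : (leb n (F 0%N) < +oo)%E.
  by apply: le_lt_trans fO; apply: le_outer_measure => x [].
have := @nonincreasing_cvg_mu _ (lebT n) R (leb n) F F0 mF mI nF.
rewrite FI s0 => /fine_cvgP[_]; move/cvgrPdist_lt => /(_ e e0) [k _ hk].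
exists k.+1%:R^-1; first by rewrite invr_gt0 ltr0n.
have Fk0 : (0 <= leb n (F k))%E by exact: outer_measure_ge0.
have Fkfin : leb n (F k) \is a fin_num.
  by rewrite ge0_fin_numE//; apply: le_lt_trans F0; apply: le_outer_measure;
    exact/subsetPset/nF.
have := hk k (leqnn k); rewrite /= sub0r normrN ger0_norm; last exact: fine_ge0.
by move=> h; rewrite -[leLHS]/(leb n (F k)) -(fineK Fkfin) lee_fin; exact: ltW.
Qed.

Lemma l2norm_small_support (E0 : set E) (f : E -> R) (e : R) : 0 <= e ->
  measurable (Omega `&` E0 : set (lebT n)) -> (leb n (Omega `&` E0) <= (e ^+ 2)%:E)%E ->
  meas f -> (forall x, Omega x -> `|f x| <= 1) ->
  (forall x, Omega x -> ~ E0 x -> f x = 0) -> l2 f <= e.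
Proof.
move=> e0 mE lE mf f1 fE.
have sf : sq f by apply: (sqint_bounded mO fO mf); apply: (ae_in_all f1).
rewrite -(@ler_pXn2r _ 2) ?nnegrE ?l2norm_ge0// l2norm_sq.
have ind : @rintegrable _ (lebT n) R (leb n) Omega (\1_(Omega `&` E0) : lebT n -> R).
  by apply: (@rint_bounded _ (lebT n) R (leb n) Omega mO fO _ 1);
   [exact: measurable_indic | apply: ae_in_all => x _; rewrite indicE; case: (_ \in _);
     rewrite ?normr1 ?normr0].
have [_ isf] := sf.
apply: (@le_trans _ _ (Int (\1_(Omega `&` E0)))).
  apply: (le_Rintegral mO isf ind) => x Ox; rewrite indicE.
  have [Ex|Ex] := pselect (E0 x).
    rewrite mem_set//= -real_normK ?num_real//.
    by rewrite exprn_ile1// f1.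
  by rewrite fE// expr0n.
rewrite /integral_in /Rintegral integral_indic// setIAC setIid.
rewrite -lee_fin fineK//.
by rewrite ge0_fin_numE//; apply: le_lt_trans lE _; rewrite ltry.
Qed.

(** Outside narrow bands around the levels [alpha] and [beta], a uniform perturbation smaller than
    the band width crosses no threshold. The cut-offs thus differ by at most 1, and only on a set of
    small measure. *)
Lemma cut_stable (s : E -> R) : (alpha%:E < beta)%E -> meas s ->
  leb n (Omega `&` [set x | s x = alpha]) = 0%E ->
  leb n (Omega `&` [set x | (s x)%:E = beta]) = 0%E ->
  forall e : R, 0 < e -> exists2 rho : R, 0 < rho & forall s' : E -> R, meas s' ->
    (forall x, Omega x -> `|s' x - s x| <= rho) ->
    l2 (fun x => cut (s' x) - cut (s x)) <= e.
Proof.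
move=> ab ms sa sb e e0.
have e20 : 0 < e ^+ 2 / 2 by rewrite divr_gt0// exprn_gt0.
have [r1 r10 h1] := level_set_small ms sa e20.
(* [E0] is the exceptional band at the upper bound; it is empty when [beta] is infinite. *)
have [E0 [mE hE [r2 r20 h2]]] : exists E0 : set E,
    [/\ measurable (Omega `&` E0 : set (lebT n)),
       (leb n (Omega `&` E0) <= (e ^+ 2 / 2)%:E)%E &
       exists2 r2 : R, 0 < r2 & forall x r, Omega x -> ~ E0 x -> `|r - s x| <= r2 ->
         (r%:E < beta)%E = ((s x)%:E < beta)%E].
  case: beta ab sb => [b _ sb|_ _|//]; last first.
    exists set0; rewrite setI0 measure0; split=> //; first by rewrite lee_fin ltW.
    by exists 1 => // x r _ _ _; rewrite !ltry.
  have sb' : leb n (Omega `&` [set x | s x = b]) = 0%E.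
    by rewrite -sb; congr (leb n _); apply/seteqP; split=> x [Ox] /=; [move=> ->|move=> []].
  have [r2 r20 h2] := level_set_small ms sb' e20.
  exists [set x | `|s x - b| <= r2]; split=> //; first exact: measurable_level_band.
  exists r2 => // x r Ox /negP; rewrite -ltNge !lte_fin => h1' h2'.
  by case: (lt_perturb h2' h1').
exists (Num.min r1 r2); first by rewrite lt_min r10.
move=> s' ms' hs'.
pose E1 := [set x | `|s x - alpha| <= r1] `|` E0.
have mE1 : measurable (Omega `&` [set x | `|s x - alpha| <= r1] : set (lebT n)).
  exact: measurable_level_band.
have mE0 : measurable (Omega `&` E1 : set (lebT n)) by rewrite setIUr; exact: measurableU.
have lE : (leb n (Omega `&` E1) <= (e ^+ 2)%:E)%E.
  rewrite setIUr (le_trans (measureU2 _ _ _))// [in leRHS](splitr (e ^+ 2)) EFinD.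
  exact: leeD.
have md : meas (fun x => cut (s' x) - cut (s x)).
  exact: (measurable_funB (measurable_cut ms') (measurable_cut ms)).
apply: (l2norm_small_support (ltW e0) mE0 lE md).
  by move=> x _; rewrite /cut; case: ifP; case: ifP;
    rewrite ?subrr ?subr0 ?sub0r ?normrN ?normr1 ?normr0.
move=> x Ox /not_orP[/negP]; rewrite -ltNge => nE1 nE0.
have := hs' x Ox; rewrite le_min => /andP[d1 d2].
rewrite /cut (h2 x (s' x) Ox nE0 d2) !lte_fin.
by rewrite (lt_perturb d1 nE1).1 subrr.
Qed.

End cut_off.

(** * First and second derivative of the cost *)

Section control_to_state.
Context {R : realType} {n : nat} (Omega : set 'rV[R]_n).
Local Notation E := 'rV[R]_n.
Hypothesis mO : measurable (Omega : set (lebT n)).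
Hypothesis fO : (leb n Omega < +oo)%E.
Hypothesis O0 : Omega !=set0.
Variable mu : R.
Hypothesis mu0 : 0 < mu.
Local Notation rint := (@rintegrable _ (lebT n) R (leb n) Omega).
Local Notation meas f := (measurable_fun (Omega : set (lebT n)) (f : lebT n -> R)).
Local Notation sq := (@sqint _ (lebT n) R (leb n) Omega).
Local Notation l2 := (@l2norm _ (lebT n) R (leb n) Omega).
Local Notation Int := (integral_in Omega).
Local Notation V := (H1C Omega mu).
Local Notation inO x := (@subset_closure _ Omega x).
Implicit Types (u v w y z phi : E -> R).

Lemma H1C_meas y : fs_mem V y -> meas y.
Proof. by move=> [[y2 _] _]; have /(L2_mem mO)[] : fs_mem (L2 Omega) y by []. Qed.

Lemma H1C_bounded y : fs_mem V y ->
  exists2 M, 0 < M & forall x, Omega x -> `|y x| <= M.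
Proof.
move=> [_ hy]; exists (hoelder_norm Omega mu y + 1).
  by rewrite ltr_wpDl// hoelder_norm_ge0.
move=> x /subset_closure cx; apply: le_trans (hoelder_norm_sup O0 hy cx) _.
by rewrite lerDl.
Qed.

(* [y] and [y'] are only ever tested against [phi], and the adjoint equation against
   [y] and [y'] separately, so that the gradient terms cancel without using linearity
   of weak gradients. *)
Lemma adjoint_identity aij a L g u u' y y' phi :
  C2_integrand Omega a -> C2_integrand Omega L -> sq u -> sq u' ->
  state Omega aij a g mu u y -> state Omega aij a g mu u' y' ->
  adjoint_state Omega aij a L mu u y phi ->
  Int (fun x => dy L x (y x) * (y' x - y x) + (u' x - u x) * (y' x * phi x)
    + (a x (y' x) - a x (y x) - dy a x (y x) * (y' x - y x)) * phi x) = 0.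
Proof.
have lin (b1 b2 i1 i2 j1 j2 c : R) : b1 + i1 = c -> b2 + i2 = c -> b1 + j1 = 0 ->
    b2 + j2 = 0 -> i2 - i1 - (j2 - j1) = 0 by lra.
move=> ha hL su su' [my [yH Sy]] [my' [yH' Sy']] [mphi [phiH Sphi]].
have [M M0 yM] := H1C_bounded my; have [M' M0' yM'] := H1C_bounded my'.
have [B B0 phiB] := H1C_bounded mphi.
have mmy := H1C_meas my; have mmy' := H1C_meas my'; have mmphi := H1C_meas mphi.
have iu := sqint_rint mO fO su; have iu' := sqint_rint mO fO su'.
have ia := C2_integrand_rint mO ha M0 mmy yM.
have ia' := C2_integrand_rint mO ha M0' mmy' yM'.
have ida := C2_integrand_dy_rint mO ha M0 mmy yM.
have idL := C2_integrand_dy_rint mO hL M0 mmy yM.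
pose f1 x := (a x (y x) + u x * y x) * phi x.
pose f2 x := (a x (y' x) + u' x * y' x) * phi x.
pose g1 x := (dy a x (y x) * phi x + u x * phi x - dy L x (y x)) * y x.
pose g2 x := (dy a x (y x) * phi x + u x * phi x - dy L x (y x)) * y' x.
have if1 : rint f1.
  by apply: (rint_mul_bounded mO _ mmphi phiB); apply: rintD => //;
    exact: (rint_mul_bounded mO iu mmy yM).
have if2 : rint f2.
  by apply: (rint_mul_bounded mO _ mmphi phiB); apply: rintD => //;
    exact: (rint_mul_bounded mO iu' mmy' yM').
have ig : rint (fun x => dy a x (y x) * phi x + u x * phi x - dy L x (y x)).
  apply: rintB => //; apply: rintD => //.
    exact: (rint_mul_bounded mO ida mmphi phiB).
  exact: (rint_mul_bounded mO iu mmphi phiB).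
have ig1 : rint g1 by exact: (rint_mul_bounded mO ig mmy yM).
have ig2 : rint g2 by exact: (rint_mul_bounded mO ig mmy' yM').
pose Bil w := Int (fun x => \sum_i \sum_j aij i j x * wgrad Omega i w x * wgrad Omega j phi x).
pose bd w := integral_bd Omega (fun x => g x * trace Omega w x).
have e1 : Bil y + Int f1 = bd phi := Sy _ phiH.
have e2 : Bil y' + Int f2 = bd phi := Sy' _ phiH.
have bd0 w : integral_bd Omega (fun x => (fun=> 0) x * trace Omega w x) = 0.
  rewrite /integral_bd (_ : (fun x => _) = (fun=> 0)); last by apply/funext => x;
    rewrite mul0r.
  by rewrite /Rintegral integral0.
have swap w : Int (fun x => \sum_i \sum_j adj aij i j x * wgrad Omega i phi x * wgrad Omega j w x) =
    Bil w.
  congr (Int _); apply/funext => x; rewrite exchange_big; apply: eq_bigr => i _.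
  by apply: eq_bigr => j _;
    exact: (mulrAC (aij i j x) (wgrad Omega j phi x) (wgrad Omega i w x)).
have e3 : Bil y + Int g1 = 0 by rewrite -swap; exact: (etrans (Sphi _ yH) (bd0 y)).
have e4 : Bil y' + Int g2 = 0 by rewrite -swap; exact: (etrans (Sphi _ yH') (bd0 y')).
have := lin _ _ _ _ _ _ _ e1 e2 e3 e4.
rewrite /integral_in -!RintegralB//; last 2 first.
- exact: rintB.
- exact: rintB.
by move=> <-; apply: eq_Rintegral => x _; rewrite /f1 /f2 /g1 /g2; ring.
Qed.

Local Notation L2 := (L2 Omega).
Local Notation L2s := (L2_seminormed mO fO).

(** The norm of [H1C] dominates the sup norm, so linearity up to null vectors becomes an equality at
    every point of [Omega]. *)
Lemma bounded_linear_pointwise (T : (E -> R) -> E -> R) c v w x :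
  bounded_linear L2 V T -> fs_mem L2 v -> fs_mem L2 w -> Omega x ->
  T (c *: (v : E -> R^o) + w) x = c * T v x + T w x.
Proof.
move=> [Tm Tl _] mv mw /subset_closure cx.
have mcv := fs_memP L2s c mv mw.
have h : in_hoelder Omega mu (fun x => T (c *: (v : E -> R^o) + w) x - (c * T v x + T w x)).
  have h1 := in_hoelder_lin c (Tm _ mv).2 (Tm _ mw).2.
  have := in_hoelder_lin (-1) h1 (Tm _ mcv).2.
  by congr in_hoelder; apply/funext => x'; rewrite mulN1r addrC.
have := H1C_norm_sup O0 h cx; rewrite (Tl c v w mv mw) normr_le0 subr_eq0.
by move/eqP.
Qed.

Lemma bounded_linear0_pointwise (T : (E -> R) -> E -> R) x :
  bounded_linear L2 V T -> Omega x -> T 0 x = 0.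
Proof.
move=> Tl Ox; have m0 := fs_mem0 L2s.
have := bounded_linear_pointwise 1 Tl m0 m0 Ox; rewrite scaler0 addr0 mul1r.
by move=> /eqP; rewrite -subr_eq subrr => /eqP <-.
Qed.

Lemma bounded_linearZ_pointwise (T : (E -> R) -> E -> R) c v x :
  bounded_linear L2 V T -> fs_mem L2 v -> Omega x ->
  T (c *: (v : E -> R^o)) x = c * T v x.
Proof.
move=> Tl mv Ox; have := bounded_linear_pointwise c Tl mv (fs_mem0 L2s) Ox.
by rewrite addr0 (bounded_linear0_pointwise Tl Ox) addr0.
Qed.

Variable A : set (E -> R).
Hypothesis AL2 : forall u, A u -> fs_mem L2 u.
Hypothesis Aopen : forall u, A u -> exists2 r : R, 0 < r &
  forall w, fs_mem L2 w -> fs_norm L2 (w - (u : E -> R^o)) < r -> A w.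

Lemma line_in_open u v : A u -> fs_mem L2 v -> exists2 r : R, 0 < r &
  forall t, `|t| < r -> A (u + t *: (v : E -> R^o)).
Proof.
move=> Au mv; have [r r0 hr] := Aopen Au; have v0 := fs_norm_ge0 L2s mv.
have v1 : 0 < fs_norm L2 v + 1 by lra.
exists (r / (fs_norm L2 v + 1)); first exact: divr_gt0.
move=> t; rewrite ltr_pdivlMr// => tr; apply: hr.
  by apply: (fs_memD L2s) (AL2 Au) _; exact: (fs_memZ L2s).
rewrite addrAC subrr add0r (fs_normZ L2s)//; apply: le_lt_trans tr.
by rewrite ler_wpM2l// lerDl.
Qed.

Lemma C1_sup_expansion (F : (E -> R) -> E -> R) (DF : (E -> R) -> (E -> R) -> E -> R) u v :
  class_C1 L2 V A F DF -> A u -> fs_mem L2 v ->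
  forall e, 0 < e -> exists2 r : R, 0 < r & forall t, `|t| < r ->
    A (u + t *: (v : E -> R^o)) /\ forall x, Omega x ->
    `|F (u + t *: (v : E -> R^o)) x - F u x - t * DF u v x| <= e * `|t|.
Proof.
move=> [Fm Fd _] Au mv e e0.
have v0 := fs_norm_ge0 L2s mv; have v1 : 0 < fs_norm L2 v + 1 by lra.
have [r1 r10 hr1] := line_in_open Au mv.
have [r2 r20 hr2] := Fd u Au _ (divr_gt0 e0 v1).
exists (Num.min r1 (r2 / (fs_norm L2 v + 1))); first by rewrite lt_min r10 divr_gt0.
move=> t; rewrite lt_min => /andP[/hr1 Aut t2]; split=> // x Ox.
have mtv := fs_memZ L2s t mv.
have ntv : fs_norm L2 (t *: (v : E -> R^o)) = `|t| * fs_norm L2 v by exact: (fs_normZ L2s).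
have := hr2 _ mtv; rewrite ntv => /(_ _) h.
have {}h : fs_norm V (F (u + t *: (v : E -> R^o)) - F u - DF u (t *: (v : E -> R^o)))
    <= e / (fs_norm L2 v + 1) * (`|t| * fs_norm L2 v).
  apply: h; move: t2; rewrite ltr_pdivlMr//; apply: le_lt_trans.
  by rewrite ler_wpM2l// lerDl.
have [FmA linu] := Fm _ Au; have [FmB _] := Fm _ Aut.
have [DFm _ _] := linu; have DFtv := DFm _ mtv.
rewrite -(bounded_linearZ_pointwise t linu mv Ox).
have hh : in_hoelder Omega mu (fun x => F (u + t *: (v : E -> R^o)) x - F u x - DF u
  (t *: (v : E -> R^o)) x).
  have h1 := in_hoelder_lin (-1) FmA.2 FmB.2.
  have := in_hoelder_lin (-1) DFtv.2 h1.
  by congr in_hoelder; apply/funext => x'; rewrite !mulN1r addrC [- F u x' + _]addrC.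
apply: le_trans (H1C_norm_sup O0 hh (subset_closure Ox)) _; apply: le_trans h _.
rewrite mulrAC -mulrA ler_wpM2l ?(ltW e0)// -mulrA ler_piMr//.
by rewrite ler_pdivrMr// mul1r lerDl.
Qed.

Lemma C1_line_lipschitz (F : (E -> R) -> E -> R) (DF : (E -> R) -> (E -> R) -> E -> R) u v :
  class_C1 L2 V A F DF -> A u -> fs_mem L2 v ->
  exists2 K : R, 0 < K & exists2 r : R, 0 < r & forall t, `|t| < r ->
    forall x, Omega x -> `|F (u + t *: (v : E -> R^o)) x - F u x| <= K * `|t|.
Proof.
move=> HF Au mv; have [r r0 hr] := C1_sup_expansion HF Au mv ltr01.
have [Fm _ _] := HF; have [_ [DFm _ _]] := Fm _ Au.
have [M M0 zM] := H1C_bounded (DFm _ mv).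
exists (M + 1); first by rewrite addr_gt0.
exists r => // t /hr[_ h] x Ox.
rewrite -(subrK (t * DF u v x) (_ - F u x)); apply: le_trans (ler_normD _ _) _.
rewrite addrC mulrDl; apply: lerD; last exact: h.
by rewrite normrM mulrC ler_wpM2r// zM.
Qed.

Variables (aij : 'I_n -> 'I_n -> E -> R) (a L : E -> R -> R) (g : E -> R) (nu : R).
Hypothesis ha : C2_integrand Omega a.
Hypothesis hL : C2_integrand Omega L.
Hypothesis nu0 : 0 < nu.
Variables (G Phi : (E -> R) -> E -> R) (DG DPhi : (E -> R) -> (E -> R) -> E -> R).
Hypothesis hG : forall u, A u -> state Omega aij a g mu u (G u).
Hypothesis hG1 : class_C1 L2 V A G DG.
Hypothesis hPhi : forall u, A u -> adjoint_state Omega aij a L mu u (G u) (Phi u).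
Hypothesis hPhi1 : class_C1 L2 V A Phi DPhi.

(** Subtracting the identity of [adjoint_identity] from the increment of [J] cancels all terms of
    first order in the change of state. What is left is quadratic in [t], given only that the state
    changes by at most [K * |t|] uniformly. *)
Lemma cost_expansion u v : A u -> fs_mem L2 v ->
  exists2 C, 0 <= C & exists2 r : R, 0 < r & forall t, `|t| < r ->
  `|J Omega L nu G (u + t *: (v : E -> R^o)) - J Omega L nu G u
    - t * Int (fun x => (nu * u x - G u x * Phi u x) * v x)| <= C * t ^+ 2.
Proof.
move=> Au mv.
have [K K0 [r0 r00 hK]] := C1_line_lipschitz hG1 Au mv.
have [r1 r10 hr1] := line_in_open Au mv.
pose r := Num.min r0 r1.
have r_gt0 : 0 < r by rewrite lt_min r00.
have su : sq u by exact/(L2_mem mO)/AL2.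
have sv : sq v by exact/(L2_mem mO).
have my := (hG Au).1; have mphi := (hPhi Au).1.
have mmy := H1C_meas my; have mmphi := H1C_meas mphi.
have [M0 M00 yM0] := H1C_bounded my; have [B B0 phiB] := H1C_bounded mphi.
(* A common bound for all states on the segment [|t| < r], so that one Taylor constant serves for
   all [t]. *)
pose M := M0 + K * r.
have M_gt0 : 0 < M by rewrite addr_gt0// mulr_gt0.
have yM x : Omega x -> `|G u x| <= M.
  by move=> Ox; rewrite (le_trans (yM0 _ Ox))// lerDl mulr_ge0 ?ltW.
have [CL CL0 tL] := C2_integrand_taylor hL M_gt0.
have [Ca Ca0 ta] := C2_integrand_taylor ha M_gt0.
(* Majorant of the remainder divided by [t ^ 2]: the Taylor remainders of [L] and [a], the quadratic
   control cost, and the product of [t * v] with the change of state and [Phi u]. *)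
pose Q x := (CL + Ca * B) * K ^+ 2 + nu / 2 * v x ^+ 2 + K * B * `|v x|.
have iQ : rint Q.
  apply: rintD => //; last by apply: rintZ => //;
    exact/integrable_norm/(sqint_rint mO fO sv).
  by apply: rintD => //; [exact: rint_cst|apply: rintZ => //; case: sv].
exists (Int Q).
  apply: Rintegral_ge0 => x _; apply: addr_ge0; first apply: addr_ge0.
  - by rewrite mulr_ge0 ?sqr_ge0// addr_ge0// mulr_ge0// ltW.
  - by rewrite mulr_ge0 ?sqr_ge0// divr_ge0// ltW.
  - by rewrite mulr_ge0// mulr_ge0// ltW.
exists r => // t; rewrite lt_min => /andP[tr0 tr1].
have Aut := hr1 t tr1; have yty := hK t tr0.
set ut := u + t *: (v : E -> R^o).
have sut : sq ut by exact/(L2_mem mO)/AL2.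
have myt := (hG Aut).1; have mmyt := H1C_meas myt.
have ytM x : Omega x -> `|G ut x| <= M.
  move=> Ox; rewrite -(subrK (G u x) (G ut x)); apply: le_trans (ler_normD _ _) _.
  rewrite addrC; apply: lerD (yM0 _ Ox) _; apply: le_trans (yty _ Ox) _.
  by rewrite ler_wpM2l ?(ltW K0)// ltW// lt_min tr0.
have adj := adjoint_identity ha hL su sut (hG Au) (hG Aut) (hPhi Au).
set I1 := (fun x => _) in adj.
have iu := sqint_rint mO fO su; have iut := sqint_rint mO fO sut.
have myty : meas (fun x => G ut x - G u x) by exact: measurable_funB.
have ytyM x : Omega x -> `|G ut x - G u x| <= M + M.
  by move=> Ox; apply: le_trans (ler_normB _ _) _; apply: lerD; [exact: ytM|exact: yM].
have iI1 : rint I1.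
  apply: rintD => //; first (apply: rintD => //).
  - exact: (rint_mul_bounded mO (C2_integrand_dy_rint mO hL M_gt0 mmy yM) myty ytyM).
  - apply: (@rint_mul_bounded _ (lebT n) R (leb n) Omega mO _ _ (M * B) (rintB mO iut iu)).
      exact: measurable_funM.
    by move=> x Ox; rewrite normrM ler_pM// ?ytM ?phiB.
  - apply: (rint_mul_bounded mO _ mmphi phiB); apply: rintB => //.
      by apply: rintB => //; exact: (C2_integrand_rint mO ha M_gt0).
    exact: (rint_mul_bounded mO (C2_integrand_dy_rint mO ha M_gt0 mmy yM) myty ytyM).
have iLt : rint (fun x => L x (G ut x)) by exact: (C2_integrand_rint mO hL M_gt0).
have iL : rint (fun x => L x (G u x)) by exact: (C2_integrand_rint mO hL M_gt0).
have i3 : rint (fun x => (nu * u x - G u x * Phi u x) * v x).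
  apply: (sqint_mul mO _ sv).
  have sGP : sq (fun x => G u x * Phi u x).
    apply: (@sqint_bounded _ (lebT n) R (leb n) Omega mO fO _ (M * B)).
      exact: measurable_funM.
    by apply: ae_in_all => x Ox; rewrite normrM ler_pM// ?yM ?phiB.
  have sN : sq (fun x => - (G u x * Phi u x)).
    have s0 : sq (fun=> 0) by exact/(L2_mem mO)/(fs_mem0 L2s).
    by have := sqintP mO (-1) sGP s0; congr sqint; apply/funext => x; rewrite mulN1r addr0.
  exact: sqintP.
have [[_ i4] [_ i5]] := (sut, su).
pose q1 x := L x (G ut x) - L x (G u x).
pose q2 x := ut x ^+ 2 - u x ^+ 2.
pose q3 x := (nu * u x - G u x * Phi u x) * v x.
pose D x := q1 x + nu / 2 * q2 x - t * q3 x - I1 x.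
have iq1 : rint q1 by exact: rintB.
have iq2 : rint q2 by exact: rintB.
have iq2' : rint (fun x => nu / 2 * q2 x) by exact: rintZ.
have iq12 : rint (fun x => q1 x + nu / 2 * q2 x) by exact: rintD.
have iq3' : rint (fun x => t * q3 x) by exact: rintZ.
have iq123 : rint (fun x => q1 x + nu / 2 * q2 x - t * q3 x) by exact: rintB.
have iD : rint D by exact: rintB.
have -> : J Omega L nu G ut - J Omega L nu G u
    - t * Int (fun x => (nu * u x - G u x * Phi u x) * v x) = Int D.
  have e1 : Int D = Int (fun x => q1 x + nu / 2 * q2 x - t * q3 x) - Int I1.
    exact: (RintegralB mO iq123 iI1).
  have e2 : Int (fun x => q1 x + nu / 2 * q2 x - t * q3 x) =
      Int (fun x => q1 x + nu / 2 * q2 x) - Int (fun x => t * q3 x).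
    exact: (RintegralB mO iq12 iq3').
  have e3 : Int (fun x => q1 x + nu / 2 * q2 x) = Int q1 + Int (fun x => nu / 2 * q2 x).
    exact: (RintegralD mO iq1 iq2').
  have e4 : Int (fun x => nu / 2 * q2 x) = nu / 2 * Int q2 by exact: (RintegralZl _ mO iq2).
  have e5 : Int (fun x => t * q3 x) = t * Int q3 by exact: (RintegralZl _ mO i3).
  have e6 : Int q1 = Int (fun x => L x (G ut x)) - Int (fun x => L x (G u x)).
    exact: (RintegralB mO iLt iL).
  have e7 : Int q2 = Int (fun x => ut x ^+ 2) - Int (fun x => u x ^+ 2).
    exact: (RintegralB mO i4 i5).
  rewrite e1 adj subr0 e2 e3 e4 e5 e6 e7 mulrBr /J.
  by congr (_ - _); rewrite opprD addrACA.
rewrite mulrC /integral_in -RintegralZl//.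
apply: Rint_norm_le => //; first exact: rintZ.
apply: ae_inW (ae_inI (tL _ _ yM ytM) (ta _ _ yM ytM)) => x Ox [hLx hax].
have d := yty x Ox; rewrite -/ut in d.
set dl := G ut x - G u x in d hLx hax *.
have d2 : `|dl| ^+ 2 <= K ^+ 2 * t ^+ 2.
  have Kt0 : 0 <= K * `|t| by rewrite mulr_ge0// ltW.
  by rewrite -[t ^+ 2]real_normK ?num_real// -exprMn ler_pXn2r.
have h1 := le_trans hLx (ler_wpM2l CL0 d2).
have h2 := le_trans hax (ler_wpM2l Ca0 d2).
change (`|D x| <= t ^+ 2 * Q x).
have -> : D x = (L x (G ut x) - L x (G u x) - dy L x (G u x) * dl)
   + nu / 2 * (t ^+ 2 * v x ^+ 2) - t * v x * dl * Phi u x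
   - (a x (G ut x) - a x (G u x) - dy a x (G u x) * dl) * Phi u x.
  by rewrite /D /q1 /q2 /q3 /I1 (_ : ut x = u x + t * v x)// /dl; field.
set rL := L x _ - _ - _ in h1 *; set ra := a x _ - _ - _ in h2 *.
have h3 : `|ra * Phi u x| <= Ca * (K ^+ 2 * t ^+ 2) * B.
  by rewrite normrM ler_pM// phiB.
have h4 : `|t * v x * dl * Phi u x| <= t ^+ 2 * (K * B * `|v x|).
  rewrite -[t ^+ 2]real_normK ?num_real// !normrM.
  have -> : `|t| ^+ 2 * (K * B * `|v x|) = `|t| * `|v x| * (K * `|t|) * B by ring.
  by rewrite ler_pM// ?mulr_ge0// ?phiB// ler_wpM2l// mulr_ge0.
have h5 : `|nu / 2 * (t ^+ 2 * v x ^+ 2)| = nu / 2 * (t ^+ 2 * v x ^+ 2).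
  have nu20 : 0 <= nu / 2 by rewrite divr_ge0// ltW.
  by rewrite ger0_norm//; apply: mulr_ge0 => //; apply: mulr_ge0; exact: sqr_ge0.
rewrite [leRHS](_ : _ = CL * (K ^+ 2 * t ^+ 2) + nu / 2 * (t ^+ 2 * v x ^+ 2)
   + t ^+ 2 * (K * B * `|v x|) + Ca * (K ^+ 2 * t ^+ 2) * B); last by rewrite /Q; ring.
apply: le_trans (ler_normB _ _) _; apply: lerD => //.
apply: le_trans (ler_normB _ _) _; apply: lerD => //.
by apply: le_trans (ler_normD _ _) _; rewrite h5 lerD2r.
Qed.

Lemma real_linearZ (T : (E -> R) -> R) c v :
  bounded_linear L2 (real_space R) T -> fs_mem L2 v ->
  T (c *: (v : E -> R^o)) = c * T v.
Proof.
move=> [_ Tl _] mv; have m0 := fs_mem0 L2s.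
have T0 : T 0 = 0.
  have /eqP := Tl 1 0 0 m0 m0; rewrite /= normr_eq0 subr_eq0 scaler0 addr0 scale1r.
  by rewrite -subr_eq subrr eq_sym => /eqP.
have /eqP := Tl c v 0 mv m0; rewrite /= normr_eq0 subr_eq0 addr0 => /eqP ->.
by rewrite T0 addr0.
Qed.

Variables (DJ : (E -> R) -> (E -> R) -> R) (D2J : (E -> R) -> (E -> R) -> (E -> R) -> R).
Hypothesis hJ2 : class_C2 L2 (real_space R) A (J Omega L nu G) DJ D2J.

(** The Frechet derivative and the expansion above describe the same increment along [t *: v] to
    first order, so they agree. *)
Lemma cost_gradient u v : A u -> fs_mem L2 v ->
  DJ u v = Int (fun x => (nu * u x - G u x * Phi u x) * v x).
Proof.
have zid (t e N C : R) : t * (e * (N + C)) = C * (t * e) + e * (t * N) by ring.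
move=> Au mv; have [[Jm Jd _] _ _ _] := hJ2.
have [C C0 [r r0 hr]] := cost_expansion Au mv.
have [_ DJl] := Jm _ Au.
have N0 := fs_norm_ge0 L2s mv; set N := fs_norm L2 v in N0.
set I := Int _ in hr *.
apply/eqP; rewrite -subr_eq0 -normr_le0; apply: (@le0_of_le_eps _ _ (N + C)) => e e0.
have [r' r'0 hr'] := Jd _ Au _ e0.
have N1 : 0 < N + 1 by apply: ltr_wpDl.
(* [t <= e] turns the quadratic remainder [C t ^ 2] into [t * (e * C)]; the other two bounds keep
   [t *: v] inside both radii. *)
pose t := Num.min e (Num.min (r / 2) (r' / 2 / (N + 1))).
have t0 : 0 < t by rewrite !lt_min e0 !divr_gt0.
have te : t <= e by rewrite ge_min lexx.
have tr : `|t| < r.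
  rewrite gtr0_norm//; apply: (@le_lt_trans _ _ (r / 2));
    first by rewrite !ge_min lexx orbT.
  by rewrite ltr_pdivrMr// ltr_pMr// ltr1n.
have mtv := fs_memZ L2s t mv.
have ntv : fs_norm L2 (t *: (v : E -> R^o)) = t * N by rewrite (fs_normZ L2s)// gtr0_norm.
have tr' : fs_norm L2 (t *: (v : E -> R^o)) < r'.
  rewrite ntv; apply: (@le_lt_trans _ _ (r' / 2)).
    apply: (@le_trans _ _ (t * (N + 1))); first by rewrite ler_wpM2l ?lerDl// ltW.
    by rewrite -ler_pdivlMr// !ge_min lexx !orbT.
  by rewrite ltr_pdivrMr// ltr_pMr// ltr1n.
have h1 := hr' _ mtv tr'; rewrite ntv (real_linearZ t DJl mv) /= in h1.
have h2 := hr _ tr.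
rewrite -(ler_pM2l t0) -[X in X * `|_|](gtr0_norm t0) -normrM mulrBr.
set j := J Omega L nu G u in h1 h2 *; set jt := J Omega L nu G _ in h1 h2 *.
have -> : t * DJ u v - t * I = (jt - j - t * I) - (jt - j - t * DJ u v).
  by rewrite opprB [RHS]addrC subrKA.
apply: le_trans (ler_normB _ _) _.
rewrite zid; apply: lerD h1; apply: le_trans h2 _; rewrite ler_wpM2l// expr2.
by rewrite ler_wpM2l// ltW.
Qed.

(** The increment of the explicit gradient along [t *: v] is expanded by a product rule for the
    state times the adjoint state in the sup norm, and compared with the Frechet expansion of
    [DJ]. *)
Lemma cost_hessian u v : A u -> fs_mem L2 v ->
  D2J u v v = nu * Int (fun x => v x ^+ 2)
    - Int (fun x => (DG u v x * Phi u x + G u x * DPhi u v x) * v x).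
Proof.
have zid (x y z : R) : x - y = - (y - z - x) - z by ring.
have zid2 (t e N b i : R) :
  e * (t * N) * N + t * (e * b) * i = t * (e * (N ^+ 2 + b * i)) by ring.
move=> Au mv; have [_ D2b D2d _] := hJ2.
have su : sq u by exact/(L2_mem mO)/AL2.
have sv : sq v by exact/(L2_mem mO).
have N0 := fs_norm_ge0 L2s mv; set N := fs_norm L2 v in N0.
have [Gm _ _] := hG1; have [Phim _ _] := hPhi1.
have [my Gl] := Gm _ Au; have [mphi Phil] := Phim _ Au.
have mz : fs_mem V (DG u v) by case: Gl => + _ _; apply.
have meta : fs_mem V (DPhi u v) by case: Phil => + _ _; apply.
have [B B0 yB] := H1C_bounded my; have [B' B'0 phiB] := H1C_bounded mphi.
have [Z Z0 zB] := H1C_bounded mz; have [H H0 etaB] := H1C_bounded meta.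
have mmy := H1C_meas my; have mmphi := H1C_meas mphi.
have mmz := H1C_meas mz; have mmeta := H1C_meas meta.
have iv := sqint_rint mO fO sv.
have iav : rint (fun x => `|v x|) by exact: integrable_norm.
have [_ iv2] := sv.
have bdv f (M : R) : meas f -> (forall x, Omega x -> `|f x| <= M) -> rint
  (fun x => f x * v x).
  move=> mf fM; have := rint_mul_bounded mO iv mf fM.
  by apply: eq_integrable => // x _; rewrite /= mulrC.
pose w x := DG u v x * Phi u x + G u x * DPhi u v x.
have mw : meas w by apply: measurable_funD; exact: measurable_funM.
have iw : rint (fun x => w x * v x).
  apply: (bdv _ (Z * B' + B * H) mw) => x Ox; apply: le_trans (ler_normD _ _) _.
  by rewrite !normrM; apply: lerD; rewrite ler_pM// ?zB ?phiB ?yB ?etaB.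
pose c := N ^+ 2 + (B + B' + (Z + 1) * (H + 1)) * Int (fun x => `|v x|).
rewrite -/w; set I := _ - Int _.
apply/eqP; rewrite -subr_eq0 -normr_le0; apply: (@le0_of_le_eps _ _ c) => e0 e0_gt0.
(* [e <= 1] bounds both increments by [t * (Z + 1)] and [t * (H + 1)]; choosing [t < e] below makes
   their product of order [e * t]. *)
have [e [e_gt0 ee0 e1]] : exists e : R, [/\ 0 < e, e <= e0 & e <= 1].
  by exists (Num.min e0 1); rewrite lt_min e0_gt0 ltr01 !ge_min !lexx orbT.
have [r1 r10 h1] := D2d _ Au _ e_gt0.
have [r2 r20 h2] := C1_sup_expansion hG1 Au mv e_gt0.
have [r3 r30 h3] := C1_sup_expansion hPhi1 Au mv e_gt0.
have N1 : 0 < N + 1 by apply: ltr_wpDl.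
pose t := Num.min e (Num.min (r1 / (N + 1)) (Num.min r2 r3)) / 2.
have tm : 0 < Num.min e (Num.min (r1 / (N + 1)) (Num.min r2 r3)).
  by rewrite !lt_min e_gt0 r20 r30 divr_gt0.
have t0 : 0 < t by exact: divr_gt0.
have : t < Num.min e (Num.min (r1 / (N + 1)) (Num.min r2 r3)).
  by rewrite ltr_pdivrMr// ltr_pMr// ltr1n.
rewrite !lt_min => /and4P[te tr1 tr2 tr3].
have mtv := fs_memZ L2s t mv.
have ntv : fs_norm L2 (t *: (v : E -> R^o)) = t * N by rewrite (fs_normZ L2s)// gtr0_norm.
have tr1' : fs_norm L2 (t *: (v : E -> R^o)) < r1.
  rewrite ntv; move: tr1; rewrite ltr_pdivlMr//; apply: le_lt_trans.
  by rewrite ler_wpM2l ?lerDl// ltW.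
have /h2[Aut Gexp] : `|t| < r2 by rewrite gtr0_norm.
have /h3[_ Phiexp] : `|t| < r3 by rewrite gtr0_norm.
have {h1} := h1 _ mtv tr1' _ mv.
rewrite ntv (cost_gradient Au mv) (cost_gradient Aut mv).
have [_ D2l _] := D2b _ Au; have D2lin := D2l _ mv.
rewrite (real_linearZ t D2lin mv) /=.
set ut := u + t *: (v : E -> R^o) in Aut Gexp Phiexp *.
have myt := (hG Aut).1; have mphit := (hPhi Aut).1.
have mmyt := H1C_meas myt; have mmphit := H1C_meas mphit.
have [Bt _ ytB] := H1C_bounded myt; have [Bt' _ phitB] := H1C_bounded mphit.
pose rem x := G ut x * Phi ut x - G u x * Phi u x - t * w x.
have mrem : meas rem.
  by apply: measurable_funB; [apply: measurable_funB;
    exact: measurable_funM|exact: measurable_funM].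
have remB x : Omega x -> `|rem x| <= t * (e * (B + B' + (Z + 1) * (H + 1))).
  move=> Ox.
  have hy := Gexp x Ox; have hphi := Phiexp x Ox.
  rewrite (gtr0_norm t0) in hy hphi.
  set dy := G ut x - G u x - t * DG u v x in hy.
  set dphi := Phi ut x - Phi u x - t * DPhi u v x in hphi.
  have -> : rem x = dy * Phi u x + G u x * dphi
      + (dy + t * DG u v x) * (dphi + t * DPhi u v x).
    by rewrite /rem /w /dy /dphi; ring.
  have g1 : `|dy * Phi u x| <= e * t * B' by rewrite normrM ler_pM// phiB.
  have g2 : `|G u x * dphi| <= B * (e * t) by rewrite normrM ler_pM// yB.
  have g3 : `|dy + t * DG u v x| <= t * (Z + 1).
    apply: le_trans (ler_normD _ _) _; rewrite mulrDr addrC mulr1; apply: lerD.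
      by rewrite normrM gtr0_norm// ler_wpM2l ?zB// ltW.
    by apply: le_trans hy _; rewrite ler_piMl// ltW.
  have g4 : `|dphi + t * DPhi u v x| <= t * (H + 1).
    apply: le_trans (ler_normD _ _) _; rewrite mulrDr addrC mulr1; apply: lerD.
      by rewrite normrM gtr0_norm// ler_wpM2l ?etaB// ltW.
    by apply: le_trans hphi _; rewrite ler_piMl// ltW.
  have g5 : `|(dy + t * DG u v x) * (dphi + t * DPhi u v x)| <= t * (Z + 1) * (e * (H + 1)).
    rewrite normrM; apply: le_trans (ler_pM _ _ g3 g4) _ => //.
    have Z1 : 0 <= Z + 1 by rewrite addr_ge0// ltW.
    have H1 : 0 <= H + 1 by rewrite addr_ge0// ltW.
    apply: ler_wpM2l; first by rewrite mulr_ge0// ltW.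
    by apply: ler_wpM2r => //; exact: ltW.
  have -> : t * (e * (B + B' + (Z + 1) * (H + 1))) =
      e * t * B' + B * (e * t) + t * (Z + 1) * (e * (H + 1)) by ring.
  apply: le_trans (ler_normD _ _) _; apply: lerD => //.
  by apply: le_trans (ler_normD _ _) _; exact: lerD.
have irem : rint (fun x => rem x * v x) by exact: (bdv _ _ mrem remB).
have remI : `|Int (fun x => rem x * v x)| <= t * (e * (B + B' + (Z + 1) * (H + 1))) * Int
  (fun x => `|v x|).
  rewrite /integral_in -RintegralZl//; apply: Rint_norm_le => //; first exact: rintZ.
  by apply: ae_in_all => x Ox; rewrite normrM ler_wpM2r// remB.
have -> : Int (fun x => (nu * ut x - G ut x * Phi ut x) * v x)
    - Int (fun x => (nu * u x - G u x * Phi u x) * v x) = t * I - Int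
      (fun x => rem x * v x).
  have igr u' yy pp M M' : sq u' -> meas yy -> meas pp ->
      (forall x, Omega x -> `|yy x| <= M) -> (forall x, Omega x -> `|pp x| <= M') ->
      rint (fun x => (nu * u' x - yy x * pp x) * v x).
    move=> su' myy mpp yyM ppM.
    have i1 := rintZ mO nu (sqint_mul mO su' sv).
    have i2 : rint (fun x => yy x * pp x * v x).
      apply: (bdv _ (M * M')); first exact: measurable_funM.
      by move=> x Ox; rewrite normrM ler_pM// ?yyM ?ppM.
    by have := rintB mO i1 i2; apply: eq_integrable => // x _ /=; rewrite mulrBl mulrA.
  have sut : sq ut by exact/(L2_mem mO)/AL2.
  have ig := igr _ _ _ _ _ su mmy mmphi yB phiB.
  have igt := igr _ _ _ _ _ sut mmyt mmphit ytB phitB.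
  have inv2 := rintZ mO nu iv2; have iI := rintB mO inv2 iw; have itI := rintZ mO t iI.
  have e_1 : Int (fun x => (nu * ut x - G ut x * Phi ut x) * v x
    - (nu * u x - G u x * Phi u x) * v x) = Int (fun x =>
      (nu * ut x - G ut x * Phi ut x) * v x)
    - Int (fun x => (nu * u x - G u x * Phi u x) * v x) by exact: (RintegralB mO igt ig).
  have e_2 : Int (fun x => t * (nu * v x ^+ 2 - w x * v x) - rem x * v x) =
    Int (fun x => t * (nu * v x ^+ 2 - w x * v x)) - Int (fun x => rem x * v x).
    exact: (RintegralB mO itI irem).
  have e_3 : Int (fun x => t * (nu * v x ^+ 2 - w x * v x)) =
    t * Int (fun x => nu * v x ^+ 2 - w x * v x) by exact: (RintegralZl _ mO iI).
  have e_4 : Int (fun x => nu * v x ^+ 2 - w x * v x) =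
    Int (fun x => nu * v x ^+ 2) - Int (fun x => w x * v x) by exact:
      (RintegralB mO inv2 iw).
  have e_5 : Int (fun x => nu * v x ^+ 2) = nu * Int (fun x => v x ^+ 2).
    exact: (RintegralZl _ mO iv2).
  rewrite -e_1 /I -e_5 -e_4 -e_3 -e_2; apply: eq_Rintegral => x _.
  by rewrite /rem (_ : ut x = u x + t * v x)//; ring.
set X := Int (fun x => rem x * v x) in remI *.
move=> h.
rewrite -(ler_pM2l t0) -[X in X * `|_|](gtr0_norm t0) -normrM mulrBr.
rewrite (zid _ _ X); apply: le_trans (ler_normB _ _) _; rewrite normrN.
apply: le_trans (lerD h remI) _.
rewrite zid2.
rewrite ler_wpM2l ?(ltW t0)// ler_wpM2r//.
rewrite addr_ge0 ?sqr_ge0// mulr_ge0//.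
  by rewrite !addr_ge0 ?mulr_ge0 ?addr_ge0 ?ltW.
by apply: Rintegral_ge0.
Qed.

End control_to_state.

(** * The operators M_u *)

Section newton_operator.
Context {R : realType} {n : nat} (Omega : set 'rV[R]_n).
Local Notation E := 'rV[R]_n.
Hypothesis mO : measurable (Omega : set (lebT n)).
Hypothesis fO : (leb n Omega < +oo)%E.
Hypothesis O0 : Omega !=set0.
Hypothesis bO : bounded_set Omega.
Variable mu : R.
Hypothesis mu0 : 0 < mu.
Local Notation meas f := (measurable_fun (Omega : set (lebT n)) (f : lebT n -> R)).
Local Notation sq := (@sqint _ (lebT n) R (leb n) Omega).
Local Notation l2 := (@l2norm _ (lebT n) R (leb n) Omega).
Local Notation V := (H1C Omega mu).
Local Notation L2 := (L2 Omega).
Local Notation L2s := (L2_seminormed mO fO).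
Implicit Types (u v w y z phi : E -> R).

Variable A : set (E -> R).
Hypothesis AL2 : forall u, A u -> fs_mem L2 u.
Hypothesis Aopen : forall u, A u -> exists2 r : R, 0 < r &
  forall w, fs_mem L2 w -> fs_norm L2 (w - (u : E -> R^o)) < r -> A w.

Lemma in_hoelder_sub y z : in_hoelder Omega mu y -> in_hoelder Omega mu z ->
  in_hoelder Omega mu (fun x => y x - z x).
Proof.
move=> hy hz; have := in_hoelder_lin (-1) hz hy.
by congr in_hoelder; apply/funext => x; rewrite mulN1r addrC.
Qed.

Lemma derivative_bound (T : (E -> R) -> E -> R) : bounded_linear L2 V T ->
  exists2 C : R, 0 <= C & forall v, fs_mem L2 v ->
    fs_norm V (T v) <= C * fs_norm L2 v /\
    forall x, Omega x -> `|T v x| <= C * fs_norm L2 v.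
Proof.
move=> [Tm _ [C hC]]; exists `|C| => // v mv.
have h : fs_norm V (T v) <= `|C| * fs_norm L2 v.
  apply: le_trans (hC _ mv) _; apply: ler_wpM2r (ler_norm _).
  exact: (fs_norm_ge0 L2s).
split=> // x /subset_closure cx; apply: le_trans h.
exact: (H1C_norm_sup O0 (Tm _ mv).2 cx).
Qed.

Lemma C1_close (F : (E -> R) -> E -> R) (DF : (E -> R) -> (E -> R) -> E -> R) u :
  class_C1 L2 V A F DF -> A u -> forall e, 0 < e -> exists2 r : R, 0 < r &
  forall u', fs_mem L2 u' -> fs_norm L2 (u' - (u : E -> R^o)) < r ->
    [/\ A u', forall x, Omega x -> `|F u' x - F u x| <= e &
        forall v x, fs_mem L2 v -> Omega x ->
          `|DF u' v x - DF u v x| <= e * fs_norm L2 v].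
Proof.
move=> [Fm Fd Fc] Au e e0.
have [FmA DFl] := Fm _ Au.
have [C C0 hC] := derivative_bound DFl.
have [r1 r10 h1] := Aopen Au.
have [r2 r20 h2] := Fd _ Au _ ltr01.
have [r3 r30 h3] := Fc _ Au _ e0.
have C1 : 0 < C + 1 by apply: ltr_wpDl.
(* Within [r2], the increment of [F] is at most [(1 + C)] times that of the control: 1 from the
   Frechet remainder, [C] from the derivative. *)
exists (Num.min (Num.min r1 r2) (Num.min r3 (e / (C + 1)))).
  by rewrite !lt_min r10 r20 r30 divr_gt0.
move=> u' mu'; rewrite !lt_min => /andP[/andP[d1 d2] /andP[d3 d4]].
have Au' := h1 _ mu' d1; have [FmB DFl'] := Fm _ Au'.
set h := u' - (u : E -> R^o) in d1 d2 d3 d4 h2.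
have mh : fs_mem L2 h by exact: (fs_memB L2s mu' (AL2 Au)).
have uh : (u : E -> R^o) + h = u' by rewrite addrC subrK.
split=> // [x Ox|v x mv Ox]; last first.
  have [DFm' _ _] := DFl'; have [DFm _ _] := DFl.
  have hh := in_hoelder_sub (DFm' _ mv).2 (DFm _ mv).2.
  exact: le_trans (H1C_norm_sup O0 hh (subset_closure Ox)) (h3 _ Au' d3 _ mv).
have g2 := h2 _ mh d2; rewrite uh mul1r in g2.
have [DFm _ _] := DFl.
have hh := in_hoelder_sub (in_hoelder_sub FmB.2 FmA.2) (DFm _ mh).2.
have g3 := le_trans (H1C_norm_sup O0 hh (subset_closure Ox)) g2.
have g4 := (hC _ mh).2 x Ox.
rewrite -(subrK (DF u h x) (F u' x - F u x)); apply: le_trans (ler_normD _ _) _.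
apply: le_trans (lerD g3 g4) _.
by move: d4; rewrite ltr_pdivlMr// => /ltW; apply: le_trans;
  rewrite mulrDr mulr1 addrC mulrC.
Qed.

(** Limits along an ultrafilter do not preserve measurability by themselves. Since the convergence
    is uniform, indices [j m] with error at most [1 / (m + 1)] give an ordinary limit of a
    sequence. *)
Lemma measurable_ultra_limit (f : nat -> E -> R) (g : E -> R) (F : set_system nat) :
  UltraFilter F -> (forall k, meas (f k)) ->
  (forall e, 0 < e -> F [set k | forall x, closure Omega x -> `|f k x - g x| <= e]) ->
  meas g.
Proof.
move=> UF mf hF.
have /choice[j hj] : forall m : nat, exists k, forall x, closure Omega x ->
    `|f k x - g x| <= m.+1%:R^-1.
  by move=> m; have := filter_ex (hF m.+1%:R^-1 _); apply; rewrite invr_gt0 ltr0n.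
apply: (@measurable_fun_cvg _ (lebT n) R Omega (fun m => f
  (j m)) g) => // x /subset_closure cx.
apply/cvgrPdist_le => e e0; near=> m.
rewrite distrC; apply: le_trans (hj m x cx) _; apply: ltW.
near: m; exact: (near_infty_natSinv_lt (PosNum e0)).
Unshelve. all: by end_near.
Qed.

Variables (nu alpha : R) (beta : \bar R).
Hypothesis nu0 : 0 < nu.
Variables (G Phi : (E -> R) -> E -> R) (DG DPhi : (E -> R) -> (E -> R) -> E -> R).
Hypothesis hG1 : class_C1 L2 V A G DG.
Hypothesis hPhi1 : class_C1 L2 V A Phi DPhi.

(* [M_u v = v - newton_op u v]. *)
Definition newton_op u v : E -> R := fun x =>
  cut alpha beta (nu^-1 * (G u x * Phi u x)) *
  (nu^-1 * (DG u v x * Phi u x + G u x * DPhi u v x)).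

Local Notation K := newton_op.

Lemma C1_mem (F : (E -> R) -> E -> R) (DF : (E -> R) -> (E -> R) -> E -> R) u :
  class_C1 L2 V A F DF -> A u -> meas (F u) /\
  (exists2 M : R, 0 < M & forall x, Omega x -> `|F u x| <= M).
Proof.
move=> [Fm _ _] Au; have [my _] := Fm _ Au; split; first exact: (H1C_meas mO my).
exact: (H1C_bounded O0 my).
Qed.

Lemma C1_deriv_mem (F : (E -> R) -> E -> R) (DF : (E -> R) -> (E -> R) -> E -> R) u v :
  class_C1 L2 V A F DF -> A u -> fs_mem L2 v -> fs_mem V (DF u v) /\ meas (DF u v).
Proof.
move=> [Fm _ _] Au mv; have [_ [DFm _ _]] := Fm _ Au.
by split; [exact: DFm|exact: (H1C_meas mO (DFm _ mv))].
Qed.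

Lemma newton_op_meas u v : A u -> fs_mem L2 v -> meas (K u v).
Proof.
move=> Au mv; have [my _] := C1_mem hG1 Au; have [mphi _] := C1_mem hPhi1 Au.
have [_ mz] := C1_deriv_mem hG1 Au mv; have [_ meta] := C1_deriv_mem hPhi1 Au mv.
apply: measurable_funM.
  by apply: measurable_cut;
    exact: (measurable_funM (measurable_cst _) (measurable_funM my mphi)).
apply: (measurable_funM (measurable_cst _)).
by apply: measurable_funD;
  [exact: (measurable_funM mz mphi)|exact: (measurable_funM my meta)].
Qed.

Lemma newton_op_sup u : A u -> exists2 C, 0 <= C & forall v x, fs_mem L2 v -> Omega x ->
  `|K u v x| <= C * fs_norm L2 v.
Proof.
move=> Au; have [_ [B B0 yB]] := C1_mem hG1 Au; have [_ [B' B'0 phiB]] := C1_mem hPhi1 Au.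
have [Gm _ _] := hG1; have [Z Z0 zB] := derivative_bound (Gm _ Au).2.
have [Pm _ _] := hPhi1; have [H H0 etaB] := derivative_bound (Pm _ Au).2.
have ni0 : 0 <= nu^-1 by rewrite invr_ge0 ltW.
exists (nu^-1 * (Z * B' + B * H)).
  by apply: mulr_ge0 => //; apply: addr_ge0; apply: mulr_ge0 => //; exact: ltW.
move=> v x mv Ox; have N0 := fs_norm_ge0 L2s mv.
rewrite normrM; apply: (@le_trans _ _ (1 * `|nu^-1 *
  (DG u v x * Phi u x + G u x * DPhi u v x)|)).
  by rewrite ler_wpM2r// cut01.
rewrite mul1r normrM (ger0_norm ni0) -mulrA ler_wpM2l//.
apply: le_trans (ler_normD _ _) _; rewrite mulrDl !normrM; apply: lerD.
  by rewrite mulrAC ler_pM//; [exact: (zB _ mv).2|exact: phiB].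
by rewrite -mulrA ler_pM//; [exact: yB|exact: (etaB _ mv).2].
Qed.

Lemma newton_op_bounded_linear u : A u -> bounded_linear L2 L2 (K u).
Proof.
move=> Au; have [C C0 hC] := newton_op_sup Au.
have mK v : fs_mem L2 v -> sq (K u v).
  move=> mv; apply: (sqint_bounded mO fO (newton_op_meas Au mv)).
  by apply: ae_in_all => x Ox; exact: hC.
have [Gm _ _] := hG1; have [Pm _ _] := hPhi1.
split=> [v mv|c v w mv mw|].
- exact/(L2_mem mO)/mK.
- have mcv := fs_memP L2s c mv mw.
  have kv : fs_mem L2 (K u v) by exact/(L2_mem mO)/mK.
  have kw : fs_mem L2 (K u w) by exact/(L2_mem mO)/mK.
  have kc : fs_mem L2 (K u (c *: (v : E -> R^o) + w)) by exact/(L2_mem mO)/mK.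
  have /(L2_mem mO) sd := fs_memB L2s kc (fs_memP L2s c kv kw).
  rewrite (L2_norm mO sd); apply: (l2norm_ae0 mO sd); apply: ae_in_all => x Ox.
  have e1 := bounded_linear_pointwise mO fO O0 c (Gm _ Au).2 mv mw Ox.
  have e2 := bounded_linear_pointwise mO fO O0 c (Pm _ Au).2 mv mw Ox.
  change (K u (c *: (v : E -> R^o) + w) x - (c * K u v x + K u w x) = 0).
  by rewrite /K e1 e2; ring.
- exists (C * Num.sqrt (fine (leb n Omega))) => v mv.
  rewrite (L2_norm mO (mK _ mv)) mulrAC.
  apply: (l2norm_bounded mO fO) (newton_op_meas Au mv) _.
    by apply: mulr_ge0 => //; exact: (fs_norm_ge0 L2s).
  by apply: ae_in_all => x Ox; exact: hC.
Qed.

(** The cut-off destroys equicontinuity, so compactness is applied to [DG u (v k)] and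
    [DPhi u (v k)] before multiplying. The cut-off depends on [u] only and is bounded by 1, hence
    uniform convergence of the other factor gives convergence in L^2. *)
Lemma newton_op_compact u : A u -> compact_op L2 (K u).
Proof.
move=> Au F UF v mv.
have [my [B B0 yB]] := C1_mem hG1 Au; have [mphi [B' B'0 phiB]] := C1_mem hPhi1 Au.
have lim (Q : (E -> R) -> E -> R) (DQ : (E -> R) -> (E -> R) -> E -> R) :
    class_C1 L2 V A Q DQ -> exists2 q : E -> R, meas q /\
    (exists M : R, forall x, Omega x -> `|q x| <= M) & forall e, 0 < e ->
    F [set k | forall x, closure Omega x -> `|DQ u (v k) x - q x| <= e].
  move=> hQ; have [Qm _ _] := hQ; have [C C0 hC] := derivative_bound (Qm _ Au).2.
  have mDQ k := C1_deriv_mem hQ Au (mv k).1.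
  have hn k : fs_norm V (DQ u (v k)) <= C.
    by apply: le_trans (hC _ (mv k).1).1 _; rewrite ler_piMr// (mv k).2.
  have [||q qC qF] := @hoelder_compact R n Omega mu mu0 O0 (fun k => DQ u (v k)) C F bO UF.
  - by move=> k x cx; apply: le_trans (H1C_norm_sup O0 (mDQ k).1.2 cx) (hn k).
  - move=> k x x' cx cx'; apply: le_trans (hoelder_norm_lip O0 (mDQ k).1.2 cx cx') _.
    by rewrite ler_wpM2r ?powR_ge0//; exact: le_trans (H1C_norm_hoelder _ _ _) (hn k).
  exists q => //; split; last by exists C => x /subset_closure; exact: qC.
  by apply: (measurable_ultra_limit UF _ qF) => k; exact: (mDQ k).2.
have [z [mz [Z zZ]] zF] := lim _ _ hG1; have [h [mh [H hH]] hF] := lim _ _ hPhi1.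
pose k0 x := cut alpha beta (nu^-1 * (G u x * Phi u x)).
pose q x := k0 x * (nu^-1 * (z x * Phi u x + G u x * h x)).
have mk0 : meas k0.
  by apply: measurable_cut;
    exact: (measurable_funM (measurable_cst _) (measurable_funM my mphi)).
have mq : meas q.
  apply: (measurable_funM mk0); apply: measurable_funM; first exact: measurable_cst.
  by apply: measurable_funD;
    [exact: (measurable_funM mz mphi)|exact: (measurable_funM my mh)].
have ni0 : 0 <= nu^-1 by rewrite invr_ge0 ltW.
have sq_q : sq q.
  apply: (sqint_bounded mO fO mq (B := nu^-1 * (Z * B' + B * H))).
  apply: ae_in_all => x Ox; rewrite normrM -[leRHS]mul1r ler_pM// ?cut01//.
  rewrite normrM (ger0_norm ni0) ler_wpM2l//.
  by apply: le_trans (ler_normD _ _) _; rewrite !normrM; apply: lerD;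
    rewrite ler_pM// ?zZ ?phiB ?yB ?hH.
exists q; first exact/(L2_mem mO).
move=> e e0.
pose S := Num.sqrt (fine (leb n Omega)).
have S0 : 0 <= S by exact: sqrtr_ge0.
pose c := nu^-1 * (B' + B) * S + 1.
have c0 : 0 < c by rewrite ltr_wpDl// !mulr_ge0// addr_ge0// ltW.
pose d := e / 2 / c.
have d0 : 0 < d by rewrite !divr_gt0.
apply: filterS (filterI (zF d d0) (hF d d0)) => k [hz hh].
change (fs_norm L2 (K u (v k) - (q : E -> R^o)) < e).
have mKv := newton_op_meas Au (mv k).1.
have [C C0 hC] := newton_op_sup Au.
have sK : sq (K u (v k)).
  by apply: (sqint_bounded mO fO mKv); apply: ae_in_all => x Ox; exact: hC (mv k).1 Ox.
have sd : sq (K u (v k) - (q : E -> R^o)).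
  by apply/(L2_mem mO)/(fs_memB L2s); exact/(L2_mem mO).
rewrite (L2_norm mO sd); apply: (@le_lt_trans _ _ (nu^-1 * (d * B' + B * d) * S)).
  apply: (l2norm_bounded mO fO).
  - by rewrite mulr_ge0// addr_ge0// mulr_ge0// ltW.
  - exact: sd.1.
  apply: ae_in_all => x Ox; have cx := subset_closure Ox.
  have -> : (K u (v k) - (q : E -> R^o)) x = k0 x * (nu^-1 *
     ((DG u (v k) x - z x) * Phi u x + G u x * (DPhi u (v k) x - h x))).
    change (K u (v k) x - q x = k0 x * (nu^-1 *
     ((DG u (v k) x - z x) * Phi u x + G u x * (DPhi u (v k) x - h x)))).
    by rewrite /K /q -/(k0 x); ring.
  rewrite normrM -[leRHS]mul1r ler_pM// ?cut01// normrM (ger0_norm ni0) ler_wpM2l//.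
  apply: le_trans (ler_normD _ _) _; rewrite !normrM; apply: lerD; rewrite ler_pM//.
  - exact: hz.
  - exact: phiB.
  - exact: yB.
  - exact: hh.
have -> : nu^-1 * (d * B' + B * d) * S = d * (c - 1) by rewrite /c; ring.
apply: (@le_lt_trans _ _ (e / 2)); last by rewrite ltr_pdivrMr// ltr_pMr// ltr1n.
by rewrite /d -mulrA ler_piMr ?divr_ge0 ?(ltW e0)// mulrC ler_pdivrMr// mul1r gerBl.
Qed.

Lemma l2norm_mul_bounded (f h : E -> R) (M : R) : 0 <= M -> sq f -> meas h ->
  (forall x, Omega x -> `|h x| <= M) -> l2 (fun x => f x * h x) <= M * l2 f.
Proof.
move=> M0 sf mh hM; have sM : sq (fun x => M * f x).
  by have := sqintP mO M sf ((L2_mem mO _).1 (fs_mem0 L2s)); congr sqint;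
    apply/funext => x; rewrite addr0.
have le x : Omega x -> `|f x * h x| <= `|M * f x|.
  by move=> Ox; rewrite !normrM mulrC (ger0_norm M0) ler_wpM2r// hM.
rewrite -[M](ger0_norm M0) -(l2normZ mO)//; apply: (l2norm_ae_le mO) => //.
  by apply: (sqint_ae_le mO _ sM); [exact: (measurable_funM sf.1 mh)|exact: (ae_in_all le)].
exact: (ae_in_all le).
Qed.

(** The difference of the operators is [(h' - h) w' / nu + h (w' - w) / nu]. In the first term the
    jump of the cut-off is small in L^2 and [w'] is bounded; in the second [w' - w] is uniformly
    small. *)
Lemma newton_op_close u : (alpha%:E < beta)%E -> A u ->
  leb n (Omega `&` [set x | nu^-1 * (G u x * Phi u x) = alpha]) = 0%E ->
  leb n (Omega `&` [set x | (nu^-1 * (G u x * Phi u x))%:E = beta]) = 0%E ->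
  forall theta, 0 < theta -> exists2 r : R, 0 < r &
  forall u', fs_mem L2 u' -> fs_norm L2 (u' - (u : E -> R^o)) < r ->
    A u' /\ forall v, fs_mem L2 v ->
      fs_norm L2 (K u' v - (K u v : E -> R^o)) <= theta * fs_norm L2 v.
Proof.
move=> ab Au sa sb theta th0.
have [my [B B0 yB]] := C1_mem hG1 Au; have [mphi [B' B'0 phiB]] := C1_mem hPhi1 Au.
have [Gm _ _] := hG1; have [Z Z0 zB] := derivative_bound (Gm _ Au).2.
have [Pm _ _] := hPhi1; have [H H0 etaB] := derivative_bound (Pm _ Au).2.
have ni0 : 0 <= nu^-1 by rewrite invr_ge0 ltW.
pose S := Num.sqrt (fine (leb n Omega)).
have S0 : 0 <= S by exact: sqrtr_ge0.
(* With [e] the closeness of states, adjoint states and derivatives and [N] the norm of [v]: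
   [|w' - w| <= e * kap * N] and [|w| <= W * N]. Then [c1 * N] bounds [w' / nu], [c2 * e * N] the
   second term in L^2, and [c3 * e] the change of [y phi / nu]. *)
pose kap := (B' + 1) + Z + (H + 1) + B.
pose W := Z * B' + B * H.
have kap0 : 0 <= kap by rewrite !addr_ge0// ltW.
have W0 : 0 <= W by apply: addr_ge0; apply: mulr_ge0 => //; exact: ltW.
pose c1 := nu^-1 * (W + kap).
have c10 : 0 <= c1 by rewrite mulr_ge0// addr_ge0.
pose c2 := nu^-1 * kap * S.
have c20 : 0 <= c2 by rewrite !mulr_ge0.
pose c3 := nu^-1 * ((B' + 1) + B).
have c30 : 0 <= c3 by rewrite mulr_ge0// !addr_ge0// ltW.
have ms : meas (fun x => nu^-1 * (G u x * Phi u x)).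
  exact: (measurable_funM (measurable_cst _) (measurable_funM my mphi)).
have quot (p c : R) : 0 < p -> 0 <= c -> 0 < p / (c + 1) /\ c * (p / (c + 1)) <= p.
  move=> p0 c0; have c1' : 0 < c + 1 by apply: ltr_wpDl.
  split; first exact: divr_gt0.
  by rewrite mulrCA ler_piMr ?(ltW p0)// ler_pdivrMr// mul1r lerDl.
have th2 : 0 < theta / 2 by rewrite divr_gt0.
have [e1_gt0 he1] := quot _ _ th2 c10.
have [rho rho0 hrho] := cut_stable mO fO ab ms sa sb e1_gt0.
have [e2_gt0 he2] := quot _ _ th2 c20.
have [e3_gt0 he3] := quot _ _ rho0 c30.
have [e [e0 ele1 ele2 ele3]] : exists e, [/\ 0 < e, e <= 1,
    e <= theta / 2 / (c2 + 1) & e <= rho / (c3 + 1)].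
  exists (Num.min 1 (Num.min (theta / 2 / (c2 + 1)) (rho / (c3 + 1)))).
  by rewrite !lt_min ltr01 e2_gt0 e3_gt0 !ge_min !lexx !orbT.
have {}he2 : c2 * e <= theta / 2 by apply: le_trans he2; exact: ler_wpM2l.
have {}he3 : c3 * e <= rho by apply: le_trans he3; exact: ler_wpM2l.
have [r1 r10 h1] := C1_close hG1 Au e0.
have [r2 r20 h2] := C1_close hPhi1 Au e0.
exists (Num.min r1 r2); first by rewrite lt_min r10.
move=> u' mu'; rewrite lt_min => /andP[/(h1 _ mu')[Au' dy dDy] /(h2 _ mu')[_ dphi dDphi]].
split=> // v mv; have N0 := fs_norm_ge0 L2s mv.
have [my' _] := C1_mem hG1 Au'; have [mphi' _] := C1_mem hPhi1 Au'.
have [_ mz] := C1_deriv_mem hG1 Au mv; have [_ meta] := C1_deriv_mem hPhi1 Au mv.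
have [_ mz'] := C1_deriv_mem hG1 Au' mv; have [_ meta'] := C1_deriv_mem hPhi1 Au' mv.
set N := fs_norm L2 v in N0 *.
pose w x := DG u v x * Phi u x + G u x * DPhi u v x.
pose w' x := DG u' v x * Phi u' x + G u' x * DPhi u' v x.
pose s x := nu^-1 * (G u x * Phi u x).
pose s' x := nu^-1 * (G u' x * Phi u' x).
have ms' : meas s'.
  exact: (measurable_funM (measurable_cst _) (measurable_funM my' mphi')).
have mw : meas w by exact: (measurable_funD (measurable_funM mz mphi)
  (measurable_funM my meta)).
have mw' : meas w' by exact: (measurable_funD (measurable_funM mz' mphi')
  (measurable_funM my' meta')).
have phi'B x : Omega x -> `|Phi u' x| <= B' + 1.
  move=> Ox; rewrite -(subrK (Phi u x) (Phi u' x)); apply: le_trans (ler_normD _ _) _.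
  by rewrite addrC; apply: lerD; [exact: phiB|exact: le_trans (dphi _ Ox) ele1].
have eta'B x : Omega x -> `|DPhi u' v x| <= (H + 1) * N.
  move=> Ox; rewrite -(subrK (DPhi u v x) (DPhi u' v x)); apply: le_trans (ler_normD _ _) _.
  rewrite addrC mulrDl; apply: lerD; first exact: (etaB _ mv).2.
  by apply: le_trans (dDphi _ _ mv Ox) _; rewrite ler_wpM2r.
have ss' x : Omega x -> `|s' x - s x| <= rho.
  move=> Ox; apply: le_trans he3.
  have -> : s' x - s x = nu^-1 * ((G u' x - G u x) * Phi u' x + G u x *
    (Phi u' x - Phi u x)).
    by rewrite /s /s'; ring.
  rewrite normrM (ger0_norm ni0) /c3 -mulrA ler_wpM2l//.
  apply: le_trans (ler_normD _ _) _; rewrite !normrM mulrDl; apply: lerD.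
    by rewrite mulrC ler_pM// ?phi'B// dy.
  by rewrite ler_pM// ?yB// dphi.
have ww' x : Omega x -> `|w' x - w x| <= e * kap * N.
  move=> Ox.
  have -> : w' x - w x = (DG u' v x - DG u v x) * Phi u' x + DG u v x * (Phi u' x - Phi u x)
     + (G u' x - G u x) * DPhi u' v x + G u x * (DPhi u' v x - DPhi u v x).
    by rewrite /w /w'; ring.
  have -> : e * kap * N = e * N * (B' + 1) + Z * N * e + e * ((H + 1) * N) + B * (e * N).
    by rewrite /kap; ring.
  apply: le_trans (ler_normD _ _) _; apply: lerD.
    apply: le_trans (ler_normD _ _) _; apply: lerD.
      apply: le_trans (ler_normD _ _) _; apply: lerD.
        by rewrite normrM ler_pM// ?phi'B// dDy.
      by rewrite normrM ler_pM// ?dphi//; exact: (zB _ mv).2.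
    by rewrite normrM ler_pM// ?eta'B// dy.
  by rewrite normrM ler_pM// ?yB// dDphi.
have wB x : Omega x -> `|w x| <= W * N.
  move=> Ox; apply: le_trans (ler_normD _ _) _; rewrite !normrM /W mulrDl; apply: lerD.
    by rewrite mulrAC ler_pM// ?phiB//; exact: (zB _ mv).2.
  by rewrite -mulrA ler_pM// ?yB//; exact: (etaB _ mv).2.
have w'B x : Omega x -> `|nu^-1 * w' x| <= c1 * N.
  move=> Ox; rewrite normrM (ger0_norm ni0) /c1 -mulrA ler_wpM2l//.
  rewrite -(subrK (w x) (w' x)); apply: le_trans (ler_normD _ _) _.
  rewrite addrC mulrDl; apply: lerD; first exact: wB.
  apply: le_trans (ww' _ Ox) _; rewrite ler_wpM2r// ler_piMl//.
pose f1 x := (cut alpha beta (s' x) - cut alpha beta (s x)) * (nu^-1 * w' x).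
pose f2 x := cut alpha beta (s x) * (nu^-1 * (w' x - w x)).
have mcs : meas (fun x => cut alpha beta (s x)) by exact: measurable_cut.
have mcs' : meas (fun x => cut alpha beta (s' x)) by exact: measurable_cut.
have mdc : meas (fun x => cut alpha beta (s' x) - cut alpha beta (s x)).
  exact: measurable_funB.
have mnw' : meas (fun x => nu^-1 * w' x) by exact: (measurable_funM (measurable_cst _) mw').
have sdc : sq (fun x => cut alpha beta (s' x) - cut alpha beta (s x)).
  apply: (sqint_bounded mO fO mdc (B := 1 + 1)); apply: ae_in_all => x Ox.
  by apply: le_trans (ler_normB _ _) _; apply: lerD; exact: cut01.
have mf1 : meas f1 by exact: (measurable_funM mdc mnw').
have mf2 : meas f2.
  by apply: (measurable_funM mcs); apply: (measurable_funM (measurable_cst _));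
    exact: measurable_funB.
have f2B x : Omega x -> `|f2 x| <= nu^-1 * (e * kap * N).
  move=> Ox; rewrite /f2 normrM -[leRHS]mul1r ler_pM// ?cut01// normrM (ger0_norm ni0).
  by rewrite ler_wpM2l// ww'.
have f1B x : Omega x -> `|f1 x| <= 2 * (c1 * N).
  move=> Ox; rewrite /f1 normrM ler_pM// ?w'B//.
  by apply: le_trans (ler_normB _ _) _; rewrite [2]splitr;
    apply: le_trans (lerD (cut01 _ _ _) (cut01 _ _ _)) _; lra.
have sf1 : sq f1 by apply: (sqint_bounded mO fO mf1); apply: ae_in_all; exact: f1B.
have sf2 : sq f2 by apply: (sqint_bounded mO fO mf2); apply: ae_in_all; exact: f2B.
have eK : K u' v - (K u v : E -> R^o) = fun x => f1 x + f2 x.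
  apply/funext => x; change (K u' v x - K u v x = f1 x + f2 x).
  rewrite /K -/(s x) -/(s' x) -/(w x) -/(w' x) /f1 /f2; ring.
have sK : sq (K u' v - (K u v : E -> R^o)).
  by rewrite eK; have := sqintP mO 1 sf1 sf2; congr sqint; apply/funext => x; rewrite mul1r.
rewrite (L2_norm mO sK) eK; apply: le_trans (l2norm_triangle mO sf1 sf2) _.
have -> : theta * N = theta / 2 * N + theta / 2 * N by rewrite -mulrDl -splitr.
have c1N : 0 <= c1 * N by exact: mulr_ge0.
apply: lerD.
  apply: le_trans (l2norm_mul_bounded c1N sdc mnw' w'B) _.
  apply: le_trans (ler_wpM2l c1N (hrho _ ms' ss')) _.
  by rewrite mulrAC ler_wpM2r.
have eN : 0 <= nu^-1 * (e * kap * N) by rewrite !mulr_ge0// ltW.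
apply: le_trans (l2norm_bounded mO fO eN mf2 (ae_in_all f2B)) _.
rewrite -/S; have -> : nu^-1 * (e * kap * N) * S = c2 * e * N by rewrite /c2; ring.
exact: ler_wpM2r.
Qed.

Lemma clamp_interior r : (alpha%:E < r%:E < beta)%E -> clamp alpha beta r = r.
Proof.
rewrite /clamp; case: beta => [b| |] /andP[]; rewrite ?lte_fin //.
  by move=> ar rb; rewrite max_r ?ltW// min_r// ltW.
by move=> ar _; rewrite max_r// ltW.
Qed.

(* A vector killed by [1 - t K] vanishes off the inactive set, hence lies in the
   critical cone; testing with [v] gives [(1 - t) nu |v|^2 + t J''(u)(v, v) = 0]. *)
Lemma newton_op_injective u (D2 : (E -> R) -> R) : A u ->
  ae_in Omega (fun x => u x = clamp alpha beta (nu^-1 * (G u x * Phi u x))) ->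
  (forall v, fs_mem L2 v -> D2 v = nu * integral_in Omega (fun x => v x ^+ 2)
    - integral_in Omega (fun x => (DG u v x * Phi u x + G u x * DPhi u v x) * v x)) ->
  (forall v, critical_cone Omega nu alpha beta u (G u) (Phi u) v ->
    ~ ae_in Omega (fun x => v x = 0) -> 0 < D2 v) ->
  forall t v, 0 <= t <= 1 -> fs_mem L2 v ->
    fs_norm L2 (v - t *: (K u v : E -> R^o)) = 0 -> fs_norm L2 v = 0.
Proof.
move=> Au proj hD2 ssc t v /andP[t0 t1] mv nv.
have sv := (L2_mem mO v).1 mv.
have Kl := newton_op_bounded_linear Au; have mK := lin_mem Kl mv.
have sd : sq (v - t *: (K u v : E -> R^o)).
  exact/(L2_mem mO)/(fs_memB L2s mv (fs_memZ L2s t mK)).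
rewrite (L2_norm mO sd) in nv.
have vK : ae_in Omega (fun x => v x = t * K u v x).
  by apply: ae_inW (l2norm_eq0_ae mO sd nv) => x _ /eqP; rewrite subr_eq0 => /eqP.
rewrite (L2_norm mO sv); apply: (l2norm_ae0 mO sv); apply: contrapT => nv0.
(* Where [v] does not vanish the cut-off must be 1, so neither bound is active. *)
have off x : v x = t * K u v x -> v x <> 0 -> (alpha%:E < (nu^-1 *
  (G u x * Phi u x))%:E < beta)%E.
  by move=> e nz; apply: contrapT => /negP h; apply: nz;
    rewrite e /K /cut (negbTE h) mul0r mulr0.
have cone : critical_cone Omega nu alpha beta u (G u) (Phi u) v.
  split=> //; apply: ae_inW (ae_inI vK proj) => x Ox [/off h ux].
  have hu : v x <> 0 -> u x = nu^-1 * (G u x * Phi u x).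
    by move=> /h /clamp_interior <-.
  split=> [nz|ua|ub]; first apply: contrapT; last 2 first.
  - have [->//|/eqP vx0] := eqVneq (v x) 0.
    by have := h vx0; rewrite -(hu vx0) ua ltxx.
  - have [->//|/eqP vx0] := eqVneq (v x) 0.
    by have := h vx0; rewrite -(hu vx0) ub ltxx andbF.
  by move=> /hu e; apply: nz; rewrite e mulVKf ?subrr// gt_eqF.
have := ssc _ cone nv0; rewrite (hD2 _ mv).
set X := integral_in Omega _; set Y := integral_in Omega _.
have X0 : 0 <= X by apply: Rintegral_ge0 => x _; exact: sqr_ge0.
have [my [B B0 yB]] := C1_mem hG1 Au; have [mphi [B' B'0 phiB]] := C1_mem hPhi1 Au.
have [_ mz] := C1_deriv_mem hG1 Au mv; have [_ meta] := C1_deriv_mem hPhi1 Au mv.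
have [Gm _ _] := hG1; have [Z Z0 zB] := derivative_bound (Gm _ Au).2.
have [Pm _ _] := hPhi1; have [H H0 etaB] := derivative_bound (Pm _ Au).2.
pose w x := DG u v x * Phi u x + G u x * DPhi u v x.
have mw : meas w by exact: (measurable_funD (measurable_funM mz mphi)
  (measurable_funM my meta)).
have iw : @rintegrable _ (lebT n) R (leb n) Omega (fun x => w x * v x).
  have wB x : Omega x -> `|w x| <= Z * fs_norm L2 v * B' + B * (H * fs_norm L2 v).
    move=> Ox; apply: le_trans (ler_normD _ _) _; rewrite !normrM; apply: lerD.
      by rewrite ler_pM// ?phiB//; exact: (zB _ mv).2.
    by rewrite ler_pM// ?yB//; exact: (etaB _ mv).2.
  have := rint_mul_bounded mO (sqint_rint mO fO sv) mw wB.
  by apply: eq_integrable => // x _; rewrite /= mulrC.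
have nuXY : nu * X = t * Y.
  rewrite /X /Y /integral_in -!RintegralZl//; last exact: sv.2.
  apply: ae_eq_Rint => //; [exact: (rintZ mO _ sv.2)|exact: (rintZ mO _ iw)|].
  apply: ae_inW vK => x Ox e; rewrite -/(w x).
  have [->|/eqP vx0] := eqVneq (v x) 0; first by rewrite expr0n !mulr0.
  rewrite expr2 {1}e /K /cut (off _ e vx0) mul1r -/(w x).
  by rewrite !mulrA [nu * t]mulrC -[t * nu * _]mulrA mulfV ?mulr1// gt_eqF.
have nX0 : 0 <= nu * X by rewrite mulr_ge0// ltW.
rewrite subr_gt0 => YX.
(* The second order condition reads [Y < nu * X = t * Y], impossible for [t <= 1] once [Y >= 0]. A
   negative [Y] would force [nu * X = t * Y = 0], that is, [v = 0]. *)
have Y0 : 0 <= Y.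
  rewrite leNgt; apply/negP => Yn.
  have tY : t * Y <= 0 by rewrite mulr_ge0_le0// ltW.
  have X00 : X = 0.
    have : nu * X = 0 by apply/eqP; rewrite eq_le nX0 nuXY tY.
    by move/eqP; rewrite mulf_eq0 gt_eqF//= => /eqP.
  apply: nv0; apply: (l2norm_eq0_ae mO sv).
  by rewrite /l2norm -[X in Num.sqrt X]/X X00 sqrtr0.
have : t * Y <= Y by rewrite ler_piMl.
by rewrite -nuXY leNgt YX.
Qed.

End newton_operator.

(** * The problem data *)

Section problem_data.
Context {R : realType} {n : nat} (Omega : set 'rV[R]_n).
Local Notation E := 'rV[R]_n.

Lemma weak_solution_congr (B : 'I_n -> 'I_n -> E -> R) (f f' h y : E -> R) :
  (forall x, Omega x -> f x = f' x) ->
  weak_solution Omega B f h y -> weak_solution Omega B f' h y.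
Proof.
move=> ff' [yH wk]; split=> // w wH; rewrite -(wk w wH); congr (_ + _).
by apply: eq_Rintegral => x /set_mem Ox; rewrite ff'.
Qed.

Lemma minf_ge (u : E -> R) (alpha : R) :
  ae_in Omega (fun x => alpha <= u x) -> (alpha%:E <= minf Omega u)%E.
Proof.
move=> h; apply/ess_infP; apply: leb_aeS h => x h.
by rewrite /patch; case: ifPn => [/set_mem Ox|_]; rewrite ?leey// lee_fin h.
Qed.

Lemma Uad_A0 (a0 alpha : R) (beta : \bar R) (u : E -> R) :
  - a0 < alpha -> Uad Omega alpha beta u -> A0 Omega a0 u.
Proof.
move=> a0alpha [mu ub]; split=> //.
apply: (@lt_le_trans _ _ (a0%:E + alpha%:E)%E).
  by rewrite -EFinD lte_fin -ltrBlDl sub0r.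
apply: leeD => //; apply: minf_ge; apply: ae_inW ub => x _ /andP[+ _].
by rewrite lee_fin.
Qed.

Hypothesis mO : measurable (Omega : set (lebT n)).
Hypothesis fO : (leb n Omega < +oo)%E.

Lemma Aset_L2 (a0 : R) eps (u : E -> R) :
  Aset Omega a0 eps u -> fs_mem (L2 Omega) u.
Proof. by move=> [u0 _ []]. Qed.

Lemma Aset_open (a0 : R) eps (u : E -> R) : Aset Omega a0 eps u ->
  exists2 r : R, 0 < r & forall w, fs_mem (L2 Omega) w ->
    fs_norm (L2 Omega) (w - (u : E -> R^o)) < r -> Aset Omega a0 eps w.
Proof.
move=> [u0 Au0 [mu du]]; have L2s := L2_seminormed mO fO.
exists (eps u0 - fs_norm (L2 Omega) (u - (u0 : E -> R^o))); first by rewrite subr_gt0.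
move=> w mw dw; exists u0 => //; split=> //.
apply: le_lt_trans (fs_dist_trans L2s mw mu Au0.1) _.
by rewrite -ltrBrDr.
Qed.

Lemma clamp_lower (alpha : R) (beta : \bar R) : (alpha%:E < beta)%E ->
  clamp alpha beta alpha = alpha.
Proof.
case: beta => [b| |] ab //; rewrite /clamp maxxx//.
by apply/min_r/ltW; rewrite -lte_fin.
Qed.

Lemma clamp_upper (alpha : R) (beta : \bar R) (r : R) : (alpha%:E < beta)%E ->
  r%:E = beta -> clamp alpha beta r = r.
Proof.
move=> ab rb; rewrite -rb in ab *; have ar : alpha < r by rewrite -lte_fin.
by rewrite /clamp (max_r (ltW ar)) minxx.
Qed.

(* Off the null set where the projection formula fails, a point where
   [y phi / nu] equals a bound lies in [Sigma]. *)
Lemma null_level_sets (nu alpha : R) (beta : \bar R) (u y phi : E -> R) :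
  0 < nu -> (alpha%:E < beta)%E ->
  ae_in Omega (fun x => u x = clamp alpha beta (nu^-1 * (y x * phi x))) ->
  leb n (Sigma Omega nu alpha beta u y phi) = 0%E ->
  leb n (Omega `&` [set x | nu^-1 * (y x * phi x) = alpha]) = 0%E /\
  leb n (Omega `&` [set x | (nu^-1 * (y x * phi x))%:E = beta]) = 0%E.
Proof.
move=> nu0 ab [N [mN N0 sN]] S0.
have null (P : set E) : Omega `&` P `<=` Sigma Omega nu alpha beta u y phi `|` N ->
    leb n (Omega `&` P) = 0%E.
  move=> sub; apply/eqP; rewrite eq_le outer_measure_ge0 andbT.
  apply: le_trans (le_outer_measure _ _ _ sub) _.
  by apply: le_trans (outer_measureU2 _ _ _) _; rewrite -[leRHS]adde0; apply: leeD;
    rewrite ?S0 ?N0.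
have proj x : Omega x -> ~ N x -> u x = clamp alpha beta (nu^-1 * (y x * phi x)).
  by move=> Ox Nx; apply: contrapT => h; apply: Nx; apply: sN => /= /(_ Ox).
have res (x : E) (r : R) : nu^-1 * (y x * phi x) = r -> nu * r - y x * phi x = 0.
  by move=> <-; rewrite mulVKf ?subrr// gt_eqF.
split; apply: null => x [Ox /= sx]; have [Nx|Nx] := pselect (N x);
  [by right|left|by right|left].
- have ua : u x = alpha by rewrite (proj x Ox Nx) sx clamp_lower.
  by split=> //; [left|rewrite ua; exact: res].
- have us : u x = nu^-1 * (y x * phi x) by rewrite (proj x Ox Nx); exact: clamp_upper.
  by split=> //; [right; rewrite us|exact/res/esym].
Qed.

End problem_data.

Theorem theorem4p5 (R : realType) (d : nat) (hd : d = 2%N \/ d = 3%N)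
  (* domain and operator *)
  (Omega : set 'rV[R]_d) (hOmega : lipschitz_domain Omega)
  (aij : 'I_d -> 'I_d -> 'rV[R]_d -> R) (M_A Lam_A : R)
  (haij : elliptic Omega aij M_A Lam_A)
  (* nonlinearity, boundary datum, cost integrand *)
  (p q : \bar R) (hp : ((d%:R / 2)%:E < p)%E) (hq : ((d%:R - 1)%:E < q)%E)
  (a : 'rV[R]_d -> R -> R) (a0 : R) (ha0 : 0 <= a0)
  (ha : nonlinearity Omega p a0 a)
  (g : 'rV[R]_d -> R) (hg : in_Lp_bd Omega q g)
  (L : 'rV[R]_d -> R -> R) (hL : cost_integrand Omega p L)
  (* control constraints *)
  (nu alpha : R) (beta : \bar R) (hnu : 0 < nu)
  (halpha : - a0 < alpha) (hbeta : (alpha%:E < beta)%E)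
  (* Hoelder exponent *)
  (mu : R) (hmu : hoelder_exponent Omega aij p q mu)
  (* the open set A, the control-to-state map G and its derivatives *)
  (C4 : R) (hC4 : embedding_constant Omega C4)
  (eps : ('rV[R]_d -> R) -> R) (heps : radii Omega Lam_A a0 C4 eps)
  (G : ('rV[R]_d -> R) -> 'rV[R]_d -> R)
  (DG : ('rV[R]_d -> R) -> ('rV[R]_d -> R) -> 'rV[R]_d -> R)
  (D2G : ('rV[R]_d -> R) -> ('rV[R]_d -> R) -> ('rV[R]_d -> R) ->
         'rV[R]_d -> R)
  (hG : forall u, Aset Omega a0 eps u ->
    is_unique_solution Omega (state Omega aij a g mu u) (G u))
  (hG2 : class_C2 (L2 Omega) (H1C Omega mu) (Aset Omega a0 eps) G DG D2G)
  (* the control-to-adjoint-state map Phi and its derivative *)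
  (Phi : ('rV[R]_d -> R) -> 'rV[R]_d -> R)
  (DPhi : ('rV[R]_d -> R) -> ('rV[R]_d -> R) -> 'rV[R]_d -> R)
  (hPhi : forall u, Aset Omega a0 eps u ->
    is_unique_solution Omega (adjoint_state Omega aij a L mu u (G u)) (Phi u))
  (hPhi1 : class_C1 (L2 Omega) (H1C Omega mu) (Aset Omega a0 eps) Phi DPhi)
  (* the functional J and its derivatives *)
  (DJ : ('rV[R]_d -> R) -> ('rV[R]_d -> R) -> R)
  (D2J : ('rV[R]_d -> R) -> ('rV[R]_d -> R) -> ('rV[R]_d -> R) -> R)
  (hJ2 : class_C2 (L2 Omega) (real_space R) (Aset Omega a0 eps)
    (J Omega L nu G) DJ D2J)
  (* first order optimality conditions *)
  (ubar ybar phibar : 'rV[R]_d -> R)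
  (hubar : Uad Omega alpha beta ubar)
  (hybar : state Omega aij a g mu ubar ybar)
  (hphibar : adjoint_state Omega aij a L mu ubar ybar phibar)
  (hproj : ae_in Omega (fun x =>
    ubar x = clamp alpha beta (nu^-1 * (ybar x * phibar x))))
  (* strict complementarity *)
  (hSigma : leb d (Sigma Omega nu alpha beta ubar ybar phibar) = 0%E)
  (* second order sufficient condition *)
  (hSSC : forall v, critical_cone Omega nu alpha beta ubar ybar phibar v ->
    ~ ae_in Omega (fun x => v x = 0) -> 0 < D2J ubar v v) :
  exists delta C : R, [/\ 0 < delta, 0 < C,
    fball (L2 Omega) delta ubar `<=` Aset Omega a0 eps &
    forall u, fball (L2 Omega) delta ubar u ->
      exists N : ('rV[R]_d -> R) -> 'rV[R]_d -> R,
        is_inverse (L2 Omega) (Mop nu alpha beta G Phi DG DPhi u) N /\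
        opnorm (L2 Omega) (L2 Omega) N <= C].
Proof.
have d0 : (0 < d)%N by case: hd => ->.
have p1 : (1 <= p)%E.
  apply: le_trans (ltW hp); rewrite lee_fin ler_pdivlMr// mul1r ler_nat.
  by case: hd => ->.
have [nzO _ _ bO _] := hOmega.
have mO := elliptic_measurable d0 haij.
have fO := leb_bounded_lty bO.
have [/andP[mu0 _] _] := hmu.
set A := Aset Omega a0 eps in hG hG2 hPhi hPhi1 hJ2 *.
have AL2 u : A u -> fs_mem (L2 Omega) u by exact: Aset_L2.
have Aopen u := @Aset_open _ _ _ mO fO a0 eps u.
have L2s := L2_seminormed mO fO.
(* [ubar] is itself a centre in the union defining the open set, so a whole ball around it lies
   inside. *)
have A0u : A0 Omega a0 ubar by exact: Uad_A0 hubar.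
have [eps0 _] := heps _ A0u.
have ballA : fball (L2 Omega) (eps ubar) ubar `<=` A by move=> u ub; exists ubar.
have mubar : fs_mem (L2 Omega) ubar by case: A0u.
have Au : A ubar.
  by apply: ballA; split=> //; rewrite subrr (fs_norm0 L2s).
have [hG1 _ _ _] := hG2.
(* Uniqueness identifies the given state with [G ubar], but only on [Omega]. The adjoint equation is
   rewritten with [G ubar] before uniqueness of the adjoint state can be used. *)
have yE x : Omega x -> ybar x = G ubar x by exact: (hG _ Au).2.
have [mphi wphi] := hphibar.
have adjG : adjoint_state Omega aij a L mu ubar (G ubar) phibar.
  split; first exact: mphi.
  by refine (weak_solution_congr _ wphi) => x Ox; rewrite (yE x Ox).
have phiE x : Omega x -> phibar x = Phi ubar x by move=> Ox;
  exact: (proj2 (hPhi _ Au) _ adjG x Ox).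
have proj : ae_in Omega (fun x => ubar x = clamp alpha beta (nu^-1 *
  (G ubar x * Phi ubar x))).
  by apply: ae_inW hproj => x Ox; rewrite yE// phiE.
have [sa sb] : leb d (Omega `&` [set x | nu^-1 * (G ubar x * Phi ubar x) = alpha]) = 0%E /\
    leb d (Omega `&` [set x | (nu^-1 * (G ubar x * Phi ubar x))%:E = beta]) = 0%E.
  have sets (P : R -> Prop) : Omega `&` [set x | P (nu^-1 * (G ubar x * Phi ubar x))] =
      Omega `&` [set x | P (nu^-1 * (ybar x * phibar x))].
    by apply/seteqP; split=> x [Ox]; rewrite /= yE// phiE.
  rewrite (sets (fun r => r = alpha)) (sets (fun r => r%:E = beta)).
  exact: null_level_sets hproj hSigma.
have hess v : fs_mem (L2 Omega) v -> D2J ubar v v =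
    nu * integral_in Omega (fun x => v x ^+ 2) - integral_in Omega
      (fun x => (DG ubar v x * Phi ubar x + G ubar x * DPhi ubar v x) * v x).
  move=> mv; apply: (cost_hessian mO fO nzO AL2 Aopen
    (nonlinearity_C2_integrand mO fO p1 ha)
    (cost_C2_integrand mO fO p1 hL) hnu _ hG1 _ hPhi1 hJ2 Au mv).
  - by move=> u Au'; exact: (hG u Au').1.
  - by move=> u Au'; exact: (hPhi u Au').1.
have ssc v : critical_cone Omega nu alpha beta ubar (G ubar) (Phi ubar) v ->
    ~ ae_in Omega (fun x => v x = 0) -> 0 < D2J ubar v v.
  move=> [mv cone]; apply: hSSC; split=> //.
  by apply: ae_inW cone => x Ox; rewrite yE// phiE.
pose K := newton_op nu alpha beta G Phi DG DPhi.
have Kl u : A u -> bounded_linear (L2 Omega) (L2 Omega) (K u).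
  by move=> Au'; exact: (newton_op_bounded_linear mO fO nzO alpha beta hnu hG1 hPhi1).
have [C C0 isoC] : exists2 C : R, 0 < C &
    iso_bound (L2 Omega) C (fun v => v - (K ubar v : 'rV[R]_d -> R^o)).
  apply: (iso_id_sub_compact L2s (L2_complete mO fO) (Kl _ Au)).
    exact: (newton_op_compact mO fO nzO bO mu0 alpha beta hnu hG1 hPhi1).
  exact: (newton_op_injective mO fO nzO hnu hG1 hPhi1 Au proj hess ssc).
(* Closeness [1 / (2 C)] makes the product in [iso_perturb] exactly 1/2, whence the final constant
   [2 C]. *)
have C2 : 0 < (C * 2)^-1 by rewrite invr_gt0 mulr_gt0.
have [r r0 hr] := newton_op_close mO fO nzO AL2 Aopen hnu hG1 hPhi1 hbeta Au sa sb C2.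
exists (Num.min r (eps ubar)), (C * 2); split.
- by rewrite lt_min r0.
- exact: mulr_gt0.
- by move=> u [mu']; rewrite lt_min => /andP[_ du]; exact: ballA.
move=> u [mu']; rewrite lt_min => /andP[/(hr _ mu')[Au' close] _].
have lin1 : bounded_linear (L2 Omega) (L2 Omega) (fun v => v - (K u v : 'rV[R]_d -> R^o)).
  have := bounded_linear_id_sub L2s 1 (Kl _ Au').
  by congr bounded_linear; apply/funext => v; rewrite scale1r.
have iso2 : iso_bound (L2 Omega) (C * 2) (fun v => v - (K u v : 'rV[R]_d -> R^o)).
  apply: (iso_perturb L2s (L2_complete mO fO) (ltW C0) (ltW C2) _ isoC lin1).
    by rewrite invfM mulrA mulfV ?mul1r// gt_eqF.
  move=> v mv; cbv beta; rewrite opprB addrC addrA subrK (fs_distC L2s); first exact: close.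
    exact: (lin_mem (Kl _ Au)).
  exact: (lin_mem (Kl _ Au')).
(* [Mop] and [v - K u v] are convertible, since [hcut] unfolds to [cut] at [y phi / nu]. *)
exact: (inverse_of_iso L2s (mulr_gt0 C0 _) iso2).
Qed.
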